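(* Let $ML^n_p=(J^1(T,M),L)$ be a metrical multi-time Lagrange space (with $\dim T=p$, $\dim M=n$, temporal semi-Riemannian metric $h$ on $T$, and Kronecker $h$-regular Lagrangian function $L$ with associated d-tensor $g_{ij}$), endowed with its canonical nonlinear connection $\Gamma$. Then there is a unique $h$-normal $\Gamma$-linear connection $$C\Gamma=(H^\gamma_{\alpha\beta},G^k_{j\gamma},L^i_{jk},C^{i(\gamma)}_{j(k)})$$ on $J^1(T,M)$ having the metrical properties (i) $g_{ij|k}=0$ and $g_{ij}|^{(\gamma)}_{(k)}=0$; (ii) $\displaystyle G^k_{j\gamma}=\frac{g^{ki}}2\frac{\delta g_{ij}}{\delta t^\gamma}$, $\quad L^k_{ij}=L^k_{ji}$, $\quad C^{i(\gamma)}_{j(k)}=C^{i(\gamma)}_{k(j)}$.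
   Context: Greek indices run from $1$ to $p$, Latin indices from $1$ to $n$; repeated indices are summed. $T$ has local coordinates $(t^\alpha)$, $M$ has local coordinates $(x^i)$, and $E=J^1(T,M)\to T\times M$ is the first-order jet bundle with induced coordinates $(t^\alpha,x^i,x^i_\alpha)$, which change by $\tilde t^\alpha=\tilde t^\alpha(t^\beta)$, $\tilde x^i=\tilde x^i(x^j)$, $\tilde x^i_\alpha=\frac{\partial\tilde x^i}{\partial x^j}\frac{\partial t^\beta}{\partial\tilde t^\alpha}x^j_\beta$. When $p=1$ one writes $t=t^1$, $y^i=x^i_1$. $h=(h_{\alpha\beta}(t))$ is a fixed semi-Riemannian metric on $T$ with inverse $(h^{\alpha\beta})$ and Christoffel symbols $H^\gamma_{\alpha\beta}$. A d-tensor is a family of local functions on $E$ transforming tensorially under these coordinate changes. Metrical multi-time Lagrange space: a pair $(J^1(T,M),L)$ with $L:E\to\mathbb{R}$ smooth and Kronecker $h$-regular, i.e. $\frac12\frac{\partial^2L}{\partial x^i_\alpha\partial x^j_\beta}=h^{\alpha\beta}(t^\gamma)g_{ij}(t^\gamma,x^k,x^k_\gamma)$ with $g_{ij}$ a symmetric d-tensor of rank $n$ and constant signature; $(g^{ij})$ is the inverse of $(g_{ij})$. If $p\geq2$, necessarily $L=h^{\alpha\beta}(t)g_{ij}(t,x)x^i_\alpha x^j_\beta+U^{(\alpha)}_{(i)}(t,x)x^i_\alpha+F(t,x)$ with $U$ a d-tensor and $F$ a smooth function on $T\times M$; put $U^{(\alpha)}_{(i)j}=\frac{\partial U^{(\alpha)}_{(i)}}{\partial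 x^j}-\frac{\partial U^{(\alpha)}_{(j)}}{\partial x^i}$ and $\Gamma^l_{jk}=\frac{g^{li}}2\left(\frac{\partial g_{ij}}{\partial x^k}+\frac{\partial g_{ik}}{\partial x^j}-\frac{\partial g_{jk}}{\partial x^i}\right)$. Canonical nonlinear connection $\Gamma=(M^{(i)}_{(\alpha)\beta},N^{(i)}_{(\alpha)j})$: $M^{(i)}_{(\alpha)\beta}=-H^\gamma_{\alpha\beta}x^i_\gamma$ (for $p=1$: $-H^1_{11}y^i$), and $$N^{(i)}_{(\alpha)j}=\begin{cases}h_{11}\dfrac{\partial\mathcal{G}^i}{\partial y^j},&p=1\\[2mm]\Gamma^i_{jk}x^k_\alpha+\dfrac{g^{ik}}2\dfrac{\partial g_{jk}}{\partial t^\alpha}+\dfrac{g^{ik}}4h_{\alpha\gamma}U^{(\gamma)}_{(k)j},&p\geq2,\end{cases}$$ where for $p=1$: $\mathcal{G}^i=\frac{g^{ik}}4\left[\frac{\partial^2L}{\partial x^j\partial y^k}y^j-\frac{\partial L}{\partial x^k}+\frac{\partial^2L}{\partial t\partial y^k}+\frac{\partial L}{\partial y^k}H^1_{11}+2h^{11}H^1_{11}g_{kl}y^l\right]$. Adapted bases: $\frac{\delta}{\delta t^\alpha}=\frac{\partial}{\partial t^\alpha}-M^{(j)}_{(\beta)\alpha}\frac{\partial}{\partial x^j_\beta}$, $\frac{\delta}{\delta x^i}=\frac{\partial}{\partial x^i}-N^{(j)}_{(\beta)i}\frac{\partial}{\partial x^j_\beta}$, together with $\frac{\partial}{\partial x^i_\alpha}$;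 dual basis $dt^\alpha$, $dx^i$, $\delta x^i_\alpha=dx^i_\alpha+M^{(i)}_{(\alpha)\beta}dt^\beta+N^{(i)}_{(\alpha)j}dx^j$. Let $h_T,h_M,v$ be the projections of vector fields on $E$ onto the spans of $\frac{\delta}{\delta t^\alpha}$, $\frac{\delta}{\delta x^i}$, $\frac{\partial}{\partial x^i_\alpha}$ respectively. A $\Gamma$-linear connection is a linear connection $\nabla$ on $E$ with $\nabla h_T=0$, $\nabla h_M=0$, $\nabla v=0$. Its nine families of local coefficients are defined by $$\nabla_{\frac{\delta}{\delta t^\gamma}}\tfrac{\delta}{\delta t^\beta}=\bar G^\alpha_{\beta\gamma}\tfrac{\delta}{\delta t^\alpha},\quad \nabla_{\frac{\delta}{\delta t^\gamma}}\tfrac{\delta}{\delta x^i}=G^k_{i\gamma}\tfrac{\delta}{\delta x^k},\quad \nabla_{\frac{\delta}{\delta t^\gamma}}\tfrac{\partial}{\partial x^i_\beta}=G^{(k)(\beta)}_{(\alpha)(i)\gamma}\tfrac{\partial}{\partial x^k_\alpha},$$ $$\nabla_{\frac{\delta}{\delta x^j}}\tfrac{\delta}{\delta t^\beta}=\bar L^\alpha_{\beta j}\tfrac{\delta}{\delta t^\alpha},\quad \nabla_{\frac{\delta}{\delta x^j}}\tfrac{\delta}{\delta x^i}=L^k_{ij}\tfrac{\delta}{\delta x^k},\quad \nabla_{\frac{\delta}{\delta x^j}}\tfrac{\partial}{\partial x^i_\beta}=L^{(k)(\beta)}_{(\alpha)(i)j}\tfrac{\partial}{\partial x^k_\alpha},$$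 $$\nabla_{\frac{\partial}{\partial x^j_\gamma}}\tfrac{\delta}{\delta t^\beta}=\bar C^{\alpha(\gamma)}_{\beta(j)}\tfrac{\delta}{\delta t^\alpha},\quad \nabla_{\frac{\partial}{\partial x^j_\gamma}}\tfrac{\delta}{\delta x^i}=C^{k(\gamma)}_{i(j)}\tfrac{\delta}{\delta x^k},\quad \nabla_{\frac{\partial}{\partial x^j_\gamma}}\tfrac{\partial}{\partial x^i_\beta}=C^{(k)(\beta)(\gamma)}_{(\alpha)(i)(j)}\tfrac{\partial}{\partial x^k_\alpha}.$$ A $\Gamma$-linear connection is $h$-normal if $\bar G^\alpha_{\beta\gamma}=H^\alpha_{\beta\gamma}$, $\bar L^\alpha_{\beta j}=0$, $\bar C^{\alpha(\gamma)}_{\beta(j)}=0$ and $\nabla J=0$, where $J=h_{\alpha\beta}\delta^i_j\,\frac{\partial}{\partial x^i_\alpha}\otimes dt^\beta\otimes dx^j$. For such a connection one has $G^{(k)(\beta)}_{(\alpha)(i)\gamma}=\delta^\beta_\alpha G^k_{i\gamma}-\delta^k_iH^\beta_{\alpha\gamma}$, $L^{(k)(\beta)}_{(\alpha)(i)j}=\delta^\beta_\alpha L^k_{ij}$, $C^{(k)(\beta)(\gamma)}_{(\alpha)(i)(j)}=\delta^\beta_\alpha C^{k(\gamma)}_{i(j)}$, so it is determined by, and denoted as, the four coefficients $(H^\gamma_{\alpha\beta},G^k_{i\gamma},L^k_{ij},C^{k(\gamma)}_{i(j)})$. The $M$-horizontal and vertical covariant derivatives of $g_{ij}$ are $$g_{ij|k}=\frac{\delta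 g_{ij}}{\delta x^k}-g_{mj}L^m_{ik}-g_{im}L^m_{jk},\qquad g_{ij}|^{(\gamma)}_{(k)}=\frac{\partial g_{ij}}{\partial x^k_\gamma}-g_{mj}C^{m(\gamma)}_{i(k)}-g_{im}C^{m(\gamma)}_{j(k)}.$$ *)

(* Defs.v *)
From HB Require Import structures.
From mathcomp Require Import all_boot all_order all_algebra.
From mathcomp Require Import all_classical all_reals all_analysis.
From mathcomp Require Import ring.
Import numFieldNormedType.Exports.
Import Order.TTheory GRing.Theory Num.Theory.

Set Implicit Arguments.
Unset Strict Implicit.
Unset Printing Implicit Defensive.

Local Open Scope classical_set_scope.
Local Open Scope ring_scope.

Section Smooth.
Context {R : realType} {V W : normedModType R}.

Definition iter_derive (s : seq V) (f : V -> W) : V -> W :=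
  foldr (fun v (F : V -> W) (x : V) => 'D_v F x) f s.

(* C^oo on the open set U: all iterated directional derivatives, of every
   order, exist and are (Frechet) differentiable at each point of U. *)
Definition smooth_on (U : set V) (f : V -> W) : Prop :=
  forall (s : seq V) (x : V), U x -> differentiable (iter_derive s f) x.

End Smooth.

Record smooth_manifold (R : realType) (m : nat) := SmoothManifold {
  carrier :> topologicalType;
  chart : Type;
  cdom : chart -> set carrier;
  cmap : chart -> carrier -> 'rV[R]_m;
  cinv : chart -> 'rV[R]_m -> carrier;
  _ : hausdorff_space carrier;
  _ : @second_countable carrier;
  _ : forall x : carrier, exists a : chart, cdom a x;
  _ : forall a : chart, open (cdom a);
  _ : forall a : chart, open (cmap a @` cdom a);
  _ : forall (a : chart) (x : carrier), cdom a x -> cinv a (cmap a x) = x;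
  _ : forall a : chart, {within cdom a, continuous (cmap a)};
  _ : forall a : chart, {within cmap a @` cdom a, continuous (cinv a)};
  _ : forall a a' : chart,
        smooth_on (cmap a @` (cdom a `&` cdom a')) (cmap a' \o cinv a) }.

Section Charts.
Context {R : realType} {m : nat} (X : smooth_manifold R m).

Definition cimage (a : chart X) : set 'rV[R]_m := cmap a @` cdom a.

Definition coverlap (a a' : chart X) : set 'rV[R]_m :=
  cmap a @` (cdom a `&` cdom a').

Definition ctrans (a a' : chart X) : 'rV[R]_m -> 'rV[R]_m := cmap a' \o cinv a.

(* As `jacobian` acts on row vectors, entry (i, j) of the matrix below is
   d(new coordinate j) / d(old coordinate i). *)
Definition cjac (a a' : chart X) (x : 'rV[R]_m) : 'M[R]_m :=
  jacobian (ctrans a a') x.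

End Charts.

(* A is congruent to diag(-1, ..., -1, 1, ..., 1) with q entries -1, that is, the
   quadratic form of A is nondegenerate of signature (m - q, q). *)
Definition has_index (R : realType) (m : nat) (A : 'M[R]_m) (q : nat) : Prop :=
  (q <= m)%N /\
  exists2 P : 'M[R]_m, P \in unitmx &
    P *m A *m P^T = diag_mx (\row_(i < m) (if (i < q)%N then - 1 else 1)).

Section Temporal.
Context {R : realType} {p : nat} (T : smooth_manifold R p).

Definition metric_family := chart T -> 'rV[R]_p -> 'M[R]_p.

Definition semi_riemannian (h : metric_family) : Prop :=
  [/\ forall a : chart T, smooth_on (cimage a) (h a),
      forall (a a' : chart T) (t : 'rV[R]_p), coverlap a a' t ->
        h a t = cjac a a' t *m h a' (ctrans a a' t) *m (cjac a a' t)^T,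
      forall (a : chart T) (t : 'rV[R]_p), cimage a t ->
        (h a t)^T = h a t /\ h a t \in unitmx
    & exists q : nat, forall (a : chart T) (t : 'rV[R]_p), cimage a t ->
        has_index (h a t) q].

(* christoffel h a t c a1 a2 is H^c_{a1 a2} at the coordinates t of chart a. *)
Definition christoffel (h : metric_family) (a : chart T) (t : 'rV[R]_p)
    (c a1 a2 : 'I_p) : R :=
  \sum_(m < p) invmx (h a t) c m / 2%:R *
    ('D_(delta_mx 0 a2) (fun s => h a s m a1) t
     + 'D_(delta_mx 0 a1) (fun s => h a s m a2) t
     - 'D_(delta_mx 0 m) (fun s => h a s a1 a2) t).

End Temporal.

(* The first-order jet bundle E = J^1(T, M) is given by its canonical atlas: a
   chart of E is a pair (chart of T, chart of M); the coordinates of a point are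
   (t, x, u) with u i a = x^i_a, and they change by `jtrans`.  Functions, tensors
   and vector fields on E are families of local objects, indexed by these charts
   and compatible with the coordinate changes; see `jtrans_jet` for `jtrans`. *)
Definition jcoord (R : realType) (p n : nat) : normedModType R :=
  ('rV[R]_p * 'rV[R]_n * 'M[R]_(n, p))%type.

Section Jets.
Context {R : realType} {p n : nat}.
Context (T : smooth_manifold R p) (M : smooth_manifold R n).
Local Notation V := (jcoord R p n).

Definition jchart : Type := (chart T * chart M)%type.

Definition jdom (c : jchart) : set V :=
  [set z | cimage c.1 z.1.1 /\ cimage c.2 z.1.2].

Definition joverlap (c c' : jchart) : set V :=
  [set z | coverlap c.1 c'.1 z.1.1 /\ coverlap c.2 c'.2 z.1.2].

(* The last component is (dx'^i/dx^j) (dt^b/dt'^a) x^j_b. *)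
Definition jtrans (c c' : jchart) (z : V) : V :=
  (ctrans c.1 c'.1 z.1.1,
   ctrans c.2 c'.2 z.1.2,
   (cjac c.2 c'.2 z.1.2)^T *m z.2
     *m (cjac c'.1 c.1 (ctrans c.1 c'.1 z.1.1))^T).

Definition et (a : 'I_p) : V := (delta_mx 0 a, 0, 0).
Definition ex (i : 'I_n) : V := (0, delta_mx 0 i, 0).
Definition eu (i : 'I_n) (a : 'I_p) : V := (0, 0, delta_mx i a).

Definition dt (a : 'I_p) (f : V -> R) (z : V) : R := 'D_(et a) f z.
Definition dx (i : 'I_n) (f : V -> R) (z : V) : R := 'D_(ex i) f z.
Definition du (i : 'I_n) (a : 'I_p) (f : V -> R) (z : V) : R := 'D_(eu i a) f z.

Definition function_family := jchart -> V -> R.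

Definition smooth_function (L : function_family) : Prop :=
  (forall c : jchart, smooth_on (jdom c) (L c)) /\
  (forall (c c' : jchart) (z : V), joverlap c c' z ->
     L c z = L c' (jtrans c c' z)).

Definition dtensor_family := jchart -> V -> 'M[R]_n.

Definition dtensor02 (g : dtensor_family) : Prop :=
  (forall c : jchart, smooth_on (jdom c) (g c)) /\
  (forall (c c' : jchart) (z : V), joverlap c c' z ->
     g c z = cjac c.2 c'.2 z.1.2 *m g c' (jtrans c c' z)
               *m (cjac c.2 c'.2 z.1.2)^T).

Definition metrical_lagrange_space (h : metric_family T) (L : function_family)
    (g : dtensor_family) : Prop :=
  [/\ smooth_function L,
      dtensor02 g,
      forall (c : jchart) (z : V), jdom c z ->
        (g c z)^T = g c z /\ \rank (g c z) = n,
      exists q : nat, forall (c : jchart) (z : V), jdom c z ->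
        has_index (g c z) q
    & forall (c : jchart) (z : V), jdom c z ->
        forall (i j : 'I_n) (a b : 'I_p),
          2%:R^-1 * du i a (du j b (L c)) z
          = invmx (h c.1 z.1.1) a b * g c z i j].

Record nonlinear_coefs := NonlinearCoefs {
  Mcoef : jchart -> V -> 'I_n -> 'I_p -> 'I_p -> R;  (* M^{(i)}_{(a)b} *)
  Ncoef : jchart -> V -> 'I_n -> 'I_p -> 'I_n -> R   (* N^{(i)}_{(a)j} *) }.

Section Canonical.
Variables (h : metric_family T) (L : function_family) (g : dtensor_family).

Definition Mcan (c : jchart) (z : V) (i : 'I_n) (a b : 'I_p) : R :=
  - \sum_(e < p) christoffel h c.1 z.1.1 e a b * z.2 i e.

(* The functions G^i of the case p = 1; there, a is the only temporal index. *)
Definition spray (c : jchart) (a : 'I_p) (i : 'I_n) (z : V) : R :=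
  let H := christoffel h c.1 z.1.1 a a a in
  \sum_(k < n) invmx (g c z) i k / 4%:R *
    (\sum_(j < n) dx j (du k a (L c)) z * z.2 j a
     - dx k (L c) z
     + dt a (du k a (L c)) z
     + du k a (L c) z * H
     + 2%:R * invmx (h c.1 z.1.1) a a * H * \sum_(l < n) g c z k l * z.2 l a).

(* For p >= 2, L is a polynomial of degree 2 in u, and U^{(a)}_{(i)} is the
   coefficient of u i a in L: see `Ucoef_decomposition`. *)
Definition Ucoef (c : jchart) (a : 'I_p) (i : 'I_n) (z : V) : R :=
  du i a (L c) (z.1, 0).

Definition Ucurl (c : jchart) (a : 'I_p) (i j : 'I_n) (z : V) : R :=
  dx j (Ucoef c a i) z - dx i (Ucoef c a j) z.

Definition gChristoffel (c : jchart) (z : V) (l j k : 'I_n) : R :=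
  \sum_(i < n) invmx (g c z) l i / 2%:R *
    (dx k (fun w => g c w i j) z
     + dx j (fun w => g c w i k) z
     - dx i (fun w => g c w j k) z).

Definition Ncan (c : jchart) (z : V) (i : 'I_n) (a : 'I_p) (j : 'I_n) : R :=
  if p == 1%N then h c.1 z.1.1 a a * du j a (spray c a i) z
  else \sum_(k < n) gChristoffel c z i j k * z.2 k a
       + \sum_(k < n) invmx (g c z) i k / 2%:R * dt a (fun w => g c w j k) z
       + \sum_(k < n) invmx (g c z) i k / 4%:R *
           \sum_(e < p) h c.1 z.1.1 a e * Ucurl c e k j z.

Definition canonical_nonlinear : nonlinear_coefs := NonlinearCoefs Mcan Ncan.

End Canonical.

Section Adapted.
Variable Gam : nonlinear_coefs.

Definition delta_t (c : jchart) (a : 'I_p) (z : V) : V :=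
  (delta_mx 0 a, 0, - \matrix_(j < n, b < p) Mcoef Gam c z j b a).
Definition delta_x (c : jchart) (i : 'I_n) (z : V) : V :=
  (0, delta_mx 0 i, - \matrix_(j < n, b < p) Ncoef Gam c z j b i).
Definition partial_u (i : 'I_n) (a : 'I_p) (z : V) : V := eu i a.

Definition co_t (a : 'I_p) (X : V -> V) (z : V) : R := (X z).1.1 0 a.
Definition co_x (i : 'I_n) (X : V -> V) (z : V) : R := (X z).1.2 0 i.
Definition co_u (c : jchart) (i : 'I_n) (a : 'I_p) (X : V -> V) (z : V) : R :=
  (X z).2 i a + \sum_(b < p) Mcoef Gam c z i a b * co_t b X z
              + \sum_(j < n) Ncoef Gam c z i a j * co_x j X z.

Definition proj_T (c : jchart) (X : V -> V) (z : V) : V :=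
  \sum_(a < p) co_t a X z *: delta_t c a z.
Definition proj_M (c : jchart) (X : V -> V) (z : V) : V :=
  \sum_(i < n) co_x i X z *: delta_x c i z.
Definition proj_v (c : jchart) (X : V -> V) (z : V) : V :=
  \sum_(i < n) \sum_(a < p) co_u c i a X z *: partial_u i a z.

End Adapted.

(* A linear connection on E acts on local vector fields: for X, Y smooth on an
   open subset U of the domain of the chart c, `nabla c X Y` is the expression in
   the chart c of the vector field nabla_X Y on U.  Its values off U, or on
   non-smooth arguments, are irrelevant. *)
Definition connection_family := jchart -> (V -> V) -> (V -> V) -> V -> V.

Definition local_domain (c : jchart) (U : set V) : Prop :=
  open U /\ U `<=` jdom c.

(* X' is the expression in the chart c' of the field with expression X on U in
   the chart c. *)
Definition same_field (c c' : jchart) (U : set V) (X X' : V -> V) : Prop :=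
  forall z : V, U z -> X' (jtrans c c' z) = 'd (jtrans c c') z (X z).

Definition linear_connection (nabla : connection_family) : Prop :=
  (forall (c : jchart) (U : set V) (X Y : V -> V), local_domain c U ->
     smooth_on U X -> smooth_on U Y ->
     [/\ smooth_on U (nabla c X Y),
         forall X' Y' : V -> V, {in U, X =1 X'} -> {in U, Y =1 Y'} ->
           {in U, nabla c X Y =1 nabla c X' Y'},
         forall X' : V -> V, smooth_on U X' ->
           {in U, nabla c (X \+ X') Y =1 nabla c X Y \+ nabla c X' Y},
         forall Y' : V -> V, smooth_on U Y' ->
           {in U, nabla c X (Y \+ Y') =1 nabla c X Y \+ nabla c X Y'}
       & forall f : V -> R, smooth_on U f ->
           {in U, nabla c (fun z => f z *: X z) Y
                  =1 (fun z => f z *: nabla c X Y z)} /\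
           {in U, nabla c X (fun z => f z *: Y z)
                  =1 (fun z => 'D_(X z) f z *: Y z + f z *: nabla c X Y z)}]) /\
  (forall (c c' : jchart) (U : set V) (X Y X' Y' : V -> V),
     open U -> U `<=` joverlap c c' ->
     smooth_on U X -> smooth_on U Y ->
     smooth_on (jtrans c c' @` U) X' -> smooth_on (jtrans c c' @` U) Y' ->
     same_field c c' U X X' -> same_field c c' U Y Y' ->
     same_field c c' U (nabla c X Y) (nabla c' X' Y')).

Definition same_connection (nabla nabla' : connection_family) : Prop :=
  forall (c : jchart) (U : set V) (X Y : V -> V), local_domain c U ->
    smooth_on U X -> smooth_on U Y -> {in U, nabla c X Y =1 nabla' c X Y}.

Section Compatible.
Variable Gam : nonlinear_coefs.

(* (nabla_X P) Y = nabla_X (P Y) - P (nabla_X Y) vanishes for P = h_T, h_M, v. *)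
Definition Gamma_linear (nabla : connection_family) : Prop :=
  linear_connection nabla /\
  forall (c : jchart) (U : set V) (X Y : V -> V), local_domain c U ->
    smooth_on U X -> smooth_on U Y -> forall z : V, U z ->
    [/\ nabla c X (proj_T Gam c Y) z - proj_T Gam c (nabla c X Y) z = 0,
        nabla c X (proj_M Gam c Y) z - proj_M Gam c (nabla c X Y) z = 0
      & nabla c X (proj_v Gam c Y) z - proj_v Gam c (nabla c X Y) z = 0].

Section Coefficients.
Variables (nabla : connection_family) (c : jchart) (z : V).
Let dlt := delta_t Gam c.
Let dlx := delta_x Gam c.

(* The coefficients of a Gamma-linear connection used below, read off with the
   dual basis; the arguments are in the order: upper index, lower indices, and
   for the C's the upper index in parentheses comes last. *)
Definition Gbar (a b e : 'I_p) : R := co_t a (nabla c (dlt e) (dlt b)) z.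
Definition Lbar (a b : 'I_p) (j : 'I_n) : R :=
  co_t a (nabla c (dlx j) (dlt b)) z.
Definition Cbar (a b : 'I_p) (j : 'I_n) (e : 'I_p) : R :=
  co_t a (nabla c (partial_u j e) (dlt b)) z.
Definition Gcoef (k i : 'I_n) (e : 'I_p) : R :=
  co_x k (nabla c (dlt e) (dlx i)) z.
Definition Lcoef (k i j : 'I_n) : R := co_x k (nabla c (dlx j) (dlx i)) z.
Definition Ccoef (k i j : 'I_n) (e : 'I_p) : R :=
  co_x k (nabla c (partial_u j e) (dlx i)) z.

End Coefficients.

Variable h : metric_family T.

(* J = h_{ab} d/dx^i_a (x) dt^b (x) dx^i *)
Definition Jtensor (c : jchart) (X Y : V -> V) (z : V) : V :=
  \sum_(i < n) \sum_(a < p) \sum_(b < p)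
    (h c.1 z.1.1 a b * co_t b X z * co_x i Y z) *: partial_u i a z.

Definition h_normal (nabla : connection_family) : Prop :=
  [/\ Gamma_linear nabla,
      forall (c : jchart) (z : V), jdom c z -> forall a b e : 'I_p,
        Gbar nabla c z a b e = christoffel h c.1 z.1.1 a b e,
      forall (c : jchart) (z : V), jdom c z -> forall (a b : 'I_p) (j : 'I_n),
        Lbar nabla c z a b j = 0,
      forall (c : jchart) (z : V), jdom c z ->
        forall (a b : 'I_p) (j : 'I_n) (e : 'I_p), Cbar nabla c z a b j e = 0
    & forall (c : jchart) (U : set V) (X Y Z : V -> V), local_domain c U ->
        smooth_on U X -> smooth_on U Y -> smooth_on U Z ->
        forall z : V, U z ->
          nabla c Z (Jtensor c X Y) z - Jtensor c (nabla c Z X) Y z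
            - Jtensor c X (nabla c Z Y) z = 0].

Variable g : dtensor_family.

(* g_{ij|k} *)
Definition cov_M (nabla : connection_family) (c : jchart) (z : V)
    (i j k : 'I_n) : R :=
  'D_(delta_x Gam c k z) (fun w => g c w i j) z
  - \sum_(m < n) g c z m j * Lcoef nabla c z m i k
  - \sum_(m < n) g c z i m * Lcoef nabla c z m j k.

(* g_{ij}|^{(e)}_{(k)} *)
Definition cov_v (nabla : connection_family) (c : jchart) (z : V)
    (i j k : 'I_n) (e : 'I_p) : R :=
  'D_(partial_u k e z) (fun w => g c w i j) z
  - \sum_(m < n) g c z m j * Ccoef nabla c z m i k e
  - \sum_(m < n) g c z i m * Ccoef nabla c z m j k e.

Definition metrical_properties (nabla : connection_family) : Prop :=
  forall (c : jchart) (z : V), jdom c z ->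
  [/\ (forall i j k : 'I_n, cov_M nabla c z i j k = 0) /\
      (forall (i j k : 'I_n) (e : 'I_p), cov_v nabla c z i j k e = 0),
      forall (k j : 'I_n) (e : 'I_p),
        Gcoef nabla c z k j e
        = \sum_(i < n) invmx (g c z) k i / 2%:R *
            'D_(delta_t Gam c e z) (fun w => g c w i j) z,
      forall k i j : 'I_n, Lcoef nabla c z k i j = Lcoef nabla c z k j i
    & forall (i j k : 'I_n) (e : 'I_p),
        Ccoef nabla c z i j k e = Ccoef nabla c z i k j e].

End Compatible.

End Jets.

Lemma Ucoef_decomposition (R : realType) (p n : nat)
    (T : smooth_manifold R p) (M : smooth_manifold R n) (h : metric_family T)
    (L : function_family T M) (c : jchart T M)
    (g : 'rV[R]_p * 'rV[R]_n -> 'M[R]_n)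
    (U : 'I_p -> 'I_n -> 'rV[R]_p * 'rV[R]_n -> R)
    (F : 'rV[R]_p * 'rV[R]_n -> R) :
  (forall z : jcoord R p n, jdom c z -> L c z =
     \sum_(a < p) \sum_(b < p) \sum_(i < n) \sum_(j < n)
        invmx (h c.1 z.1.1) a b * g z.1 i j * z.2 i a * z.2 j b
     + \sum_(i < n) \sum_(a < p) U a i z.1 * z.2 i a + F z.1) ->
  forall (z : jcoord R p n) (a : 'I_p) (i : 'I_n), jdom c z ->
    Ucoef L c a i z = U a i z.1.
Proof.
move=> LE [tx u] a i dz.
set Q := \sum_(a' < p) \sum_(b < p) \sum_(i' < n) \sum_(j < n)
        invmx (h c.1 tx.1) a' b * g tx i' j * (delta_mx i a : 'M[R]_(n, p)) i' a'
          * (delta_mx i a : 'M[R]_(n, p)) j b.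
have E s : L c ((tx, s *: delta_mx i a) : jcoord R p n)
    = s ^+ 2 * Q + s * U a i tx + F tx.
  rewrite LE //=; congr (_ + _ + _).
    rewrite /Q mulr_sumr; apply: eq_bigr => a' _.
    rewrite mulr_sumr; apply: eq_bigr => b _.
    rewrite mulr_sumr; apply: eq_bigr => i' _.
    rewrite mulr_sumr; apply: eq_bigr => j _.
    by rewrite !mxE; ring.
  rewrite (bigD1 i) //= (bigD1 a) //= !mxE !eqxx mulr1 mulrC.
  rewrite big1 ?addr0 => [|b nb]; last first.
    by rewrite !mxE eqxx /= (negbTE nb) !mulr0.
  rewrite big1 ?addr0 // => j nj; rewrite big1 // => b _.
  by rewrite !mxE (negbTE nj) !mulr0.
rewrite /Ucoef /du /derive; apply: cvg_lim => //.
have -> : (fun s : R => s^-1 *: ((L c \o shift ((tx, 0) : jcoord R p n)) (s *: eu i a)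
             - L c (tx, 0)))
  = (fun s : R => s^-1 *: (s ^+ 2 * Q + s * U a i tx)).
  apply/funext => s; congr (_ *: _).
  have -> : ((tx, 0) : jcoord R p n) = (tx, 0 *: delta_mx i a) by rewrite scale0r.
  rewrite E /=.
  have -> : s *: eu i a + (tx, 0 *: delta_mx i a) = (tx, s *: delta_mx i a).
    rewrite scale0r; congr pair; rewrite /= ?addr0 //.
    by case: (tx) => t x /=; congr pair; rewrite /= scaler0 add0r.
  by rewrite E (expr2 0) !mul0r !add0r addrK.
have cv : (fun s : R => s * Q + U a i tx) @ 0^' --> U a i tx.
  have : (fun s : R => s * Q + U a i tx) @ 0^' --> 0 * Q + U a i tx.
    apply: cvgD; last exact: cvg_cst.
    apply: cvgM; last exact: cvg_cst.
    exact: nbhs_dnbhs.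
  by rewrite mul0r add0r.
apply: cvg_trans cv; apply: near_eq_cvg.
near=> s.
have s0 : s != 0 by near: s; exact: nbhs_dnbhs_neq.
by rewrite /GRing.scale /= mulrDr mulrA expr2 !mulrA mulVf // !mul1r.
Unshelve. all: by end_near.
Qed.

(* `jtrans` is the change of coordinates of the 1-jet at t of the map T -> M with
   local expression f. *)
Lemma jtrans_jet (R : realType) (p n : nat)
    (T : smooth_manifold R p) (M : smooth_manifold R n) (c c' : jchart T M)
    (f : 'rV[R]_p -> 'rV[R]_n) (t : 'rV[R]_p) :
  let t' := ctrans c.1 c'.1 t in
  let f' := ctrans c.2 c'.2 \o f \o ctrans c'.1 c.1 in
  ctrans c'.1 c.1 t' = t -> differentiable f t ->
  differentiable (ctrans c.2 c'.2) (f t) ->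
  differentiable (ctrans c'.1 c.1) t' ->
  jtrans c c' (t, f t, (jacobian f t)^T) = (t', f' t', (jacobian f' t')^T).
Proof.
move=> t' f' tK df ds dt'.
rewrite /jtrans /= -/t' /f' /= tK; congr pair.
rewrite -!trmx_mul; congr (_^T).
have jc (m1 m2 m3 : nat) (F : 'rV[R]_m1 -> 'rV[R]_m2) (G : 'rV[R]_m2 -> 'rV[R]_m3) x :
   differentiable F x -> differentiable G (F x) ->
   jacobian (G \o F) x = jacobian F x *m jacobian G (F x).
  move=> dF dG; apply/row_matrixP => k; rewrite row_mul.
  by rewrite !rowE /jacobian !mul_rV_lin1 diff_comp //= mul_rV_lin1.
rewrite (jc _ _ _ _ (ctrans c.2 c'.2 \o f)) //; last first.
  by rewrite tK; apply: differentiable_comp.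
by rewrite tK jc.
Qed.

(* Main.v *)
Require Import Defs.
From HB Require Import structures.
From mathcomp Require Import all_boot all_order all_algebra.
From mathcomp Require Import all_classical all_reals all_analysis.
From mathcomp Require Import ring.
Import numFieldNormedType.Exports.
Import Order.TTheory GRing.Theory Num.Theory.

(** In the basis adapted to the canonical nonlinear connection, a linear
    connection that commutes with the three projections consists of one
    matrix-valued one-form on each of the three subbundles.  On the span of the
    [delta/delta t^a], h-normality makes it the Levi-Civita connection of [h].
    Every vertical field is a sum of values [J (A, delta/delta x^i)], so the
    parallelism of [J] expresses the form on the vertical bundle through the two
    others.  There remains the form on the span of the [delta/delta x^i].  Along
    [delta/delta t^a] it is prescribed by (ii); along [delta/delta x^k], and
    along [d/dx^k_a] for each fixed [a], conditions (i) and (ii) say that its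
    coefficients are symmetric and metric for [g].  As in the fundamental lemma
    of Riemannian geometry, exactly one family of coefficients has this property,
    the one of the Koszul formula ([koszul_metric], [koszul_unique]).  This gives
    uniqueness ([cartan_unique]) and a formula [cartan] for the only candidate.

    What existence requires is that this formula does not depend on the chart.
    Uniqueness at a point gives the transformation law of Koszul coefficients
    ([koszul_transform]), in which the Hessian of the change of coordinates
    appears as inhomogeneous term, and this term cancels the derivative of the
    Jacobian in the covariant derivative ([cartan_transform]).  The argument
    presupposes that the adapted components are tensorial, that is, that the
    canonical coefficients do transform as a nonlinear connection
    ([canonical_transform]).  The temporal ones are Christoffel symbols of [h].
    The spatial ones need two arguments.

    For [p >= 2], the third derivatives of [L] along the fibres are symmetric,
    which is compatible with their product form [h^ab g_ij] only if [g] is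
    constant along the fibres ([g_vertical_const]).  So [Gamma^i_jk x^k_a] has
    the inhomogeneous term of a linear connection, and the other summands are
    tensors: a derivative in [t] of [g], and the exterior derivative in [x] of
    the one-forms [U].

    For [p = 1], the functions [G^i] come from the Euler-Lagrange equation of
    the density [L sqrt |h|]: its left-hand side is a covector along curves, and
    after subtraction of the covariant acceleration term
    [2 h^11 g (x'' - H x')] it depends only on [(t, x, x')] and transforms with
    the Hessian of the change of coordinates ([euler_transform],
    [sprayv_transform]).  This law is quadratic in [x'], and its derivative along
    the fibre is the law of [N]. *)

Set Implicit Arguments.
Unset Strict Implicit.
Unset Printing Implicit Defensive.

Local Open Scope classical_set_scope.
Local Open Scope ring_scope.

(** * Derivatives on open sets and smooth functions *)

Section Calculus.
Context {R : realType} {V W : normedModType R}.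
Implicit Types (f g : V -> W) (U : set V) (x v : V).

(** [g] is [f] plus a function that vanishes near [x], and for the latter the
    expansion with linear part 0 is exact. *)
Lemma near_eq_differentiable f g x :
  (\near x, f x = g x) -> differentiable f x -> differentiable g x.
Proof.
move=> fg df.
have gE : g = f + (g - f) by rewrite addrC subrK.
rewrite gE; apply: differentiableD => //.
set e := g - f.
have e0 : \forall y \near x, e y = 0.
  near=> y; rewrite /e /= fctE; apply/eqP; rewrite subr_eq0; apply/eqP.
  by apply: esym; near: y.
have ee : e \o shift x = cst (e x) + (\0 : {linear V -> W}) +o_ 0 id.
  apply/eqaddoP => _/posnumP[eps]; near=> h.
  have -> : (e \o shift x - (cst (e x) + \0)) h = 0.
    rewrite !fctE /=.
    have -> : e x = 0 by apply: nbhs_singleton e0.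
    rewrite (_ : e (h + x) = 0) ?subrr ?addr0 ?subr0 //.
    near: h; have := e0; rewrite (near_shift 0 x) /= => e0'.
    near=> h; have -> : h + x = h + (x - 0) by rewrite subr0.
    by near: h.
  by rewrite normr0 mulr_ge0.
have c0 : continuous (\0 : {linear V -> W}) by exact: cst_continuous.
have dE := diff_unique c0 ee.
apply/diff_locallyP; rewrite dE; split => //.
Unshelve. all: by end_near. Qed.

Lemma open_near_eq U f g x :
  open U -> {in U, f =1 g} -> U x -> \near x, f x = g x.
Proof.
move=> oU fg Ux; have := open_nbhs_nbhs (conj oU Ux).
by apply: filter_app; near=> y => Uy; apply: fg; rewrite inE.
Unshelve. all: by end_near. Qed.

Lemma open_derive_eq U f g v x :
  open U -> {in U, f =1 g} -> U x -> 'D_v f x = 'D_v g x.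
Proof. by move=> oU fg Ux; apply/near_eq_derive/(open_near_eq oU fg Ux). Qed.

Lemma smooth_differentiable U f x : smooth_on U f -> U x -> differentiable f x.
Proof. by move=> sf Ux; apply: (sf [::]). Qed.

Lemma smooth_derive U f v : smooth_on U f -> smooth_on U ('D_v f).
Proof.
by move=> sf s x Ux; have := sf (rcons s v) x Ux; rewrite /iter_derive foldr_rcons.
Qed.

Lemma smooth_subset U U' f : U' `<=` U -> smooth_on U f -> smooth_on U' f.
Proof. by move=> UU sf s x /UU; apply: sf. Qed.

(** Induction-friendly form of [smooth_on]: closure properties of smooth functions
    are proved order by order, since the derivative of, say, a product is a sum
    of products of the same shape. *)
Fixpoint Cn k U f : Prop :=
  (forall x, U x -> differentiable f x) /\
  (if k is k'.+1 then forall v, Cn k' U ('D_v f) else True).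

Lemma Cn_diff k U f x : Cn k U f -> U x -> differentiable f x.
Proof. by case: k => [|k] [+ _]; apply. Qed.

Lemma CnP U f : smooth_on U f <-> forall k, Cn k U f.
Proof.
split=> [sf k|Cf s].
  elim: k f sf => [|k IH] f sf; split => //.
  - by move=> x; apply: smooth_differentiable.
  - by move=> x; apply: smooth_differentiable.
  - by move=> v; apply/IH/smooth_derive.
elim/last_ind: s f Cf => [|s v IH] f Cf x Ux; first exact: (Cn_diff (Cf 0%N)).
rewrite /iter_derive foldr_rcons; apply: IH => // k.
by case: (Cf k.+1) => _; apply.
Qed.

Lemma CnS k U f : Cn k.+1 U f -> Cn k U f.
Proof.
by elim: k f => [|k IH] f [df Df]; split => // v; apply/IH.
Qed.

Lemma Cn_ext k U f g : open U -> {in U, f =1 g} -> Cn k U f -> Cn k U g.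
Proof.
move=> oU; elim: k f g => [|k IH] f g fg.
  case=> df _; split=> // x Ux.
  by apply: near_eq_differentiable (df x Ux); apply: open_near_eq Ux.
case=> df Df; split=> [x Ux|v].
  by apply: near_eq_differentiable (df x Ux); apply: open_near_eq Ux.
apply: IH (Df v) => x; rewrite inE => Ux; exact: open_derive_eq Ux.
Qed.

Lemma smooth_ext U f g :
  open U -> {in U, f =1 g} -> smooth_on U f -> smooth_on U g.
Proof. by move=> oU fg /CnP sf; apply/CnP => k; apply: Cn_ext (sf k). Qed.

Lemma Cn_cst k U (w : W) : Cn k U (cst w).
Proof.
elim: k w => [|k IH] w; split => //; move=> x; try by move=> _; apply: differentiable_cst.
by have -> : 'D_x (cst w : V -> W) = cst 0 by apply/funext => y; rewrite derive_cst.
Qed.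

Lemma smooth_cst U (w : W) : smooth_on U (cst w : V -> W).
Proof. by apply/CnP => k; apply: Cn_cst. Qed.

Lemma CnD k U f g : open U -> Cn k U f -> Cn k U g -> Cn k U (f \+ g).
Proof.
move=> oU; elim: k f g => [|k IH] f g [df Df] [dg Dg].
  by split=> // x Ux; apply: differentiableD; [apply: df|apply: dg].
split=> [x Ux|v]; first by apply: differentiableD; [apply: df|apply: dg].
apply: Cn_ext (IH _ _ (Df v) (Dg v)) => // x; rewrite inE => Ux /=.
by rewrite deriveD //; apply: diff_derivable; [apply: df|apply: dg].
Qed.

Lemma smoothD U f g : open U -> smooth_on U f -> smooth_on U g ->
  smooth_on U (f \+ g).
Proof. by move=> oU /CnP sf /CnP sg; apply/CnP => k; apply: CnD. Qed.

Lemma smooth_sum U (I : Type) (r : seq I) (P : pred I) (F : I -> V -> W) :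
  open U -> (forall i, P i -> smooth_on U (F i)) ->
  smooth_on U (fun x => \sum_(i <- r | P i) F i x).
Proof.
move=> oU sF; elim: r => [|i r IH].
  by have -> : (fun x => \sum_(i <- [::] | P i) F i x) = cst 0
    by [apply/funext => x; rewrite big_nil]; apply: smooth_cst.
case Pi: (P i); last first.
  by have -> : (fun x => \sum_(i <- i :: r | P i) F i x) =
      (fun x => \sum_(i <- r | P i) F i x) by apply/funext => x; rewrite big_cons Pi.
have -> : (fun x => \sum_(i <- i :: r | P i) F i x) =
   F i \+ (fun x => \sum_(i <- r | P i) F i x).
  by apply/funext => x; rewrite big_cons Pi.
by apply: smoothD => //; apply: sF.
Qed.

End Calculus.

(** * Calculus with linear maps, products and matrices *)

Section Linear.
Context {R : realType}.

Lemma linear_derive (V W : normedModType R) (l : V -> W) (hl : linear l)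
    (cl : continuous l) (x v : V) :
  differentiable l x /\ 'D_v l x = l v.
Proof.
pose lM := GRing.isLinear.Build _ _ _ _ l hl.
pose L : {linear V -> W} := HB.pack l lM.
have dL : differentiable (L : V -> W) x by apply: linear_differentiable.
by split=> //; rewrite (deriveE v (dL : differentiable l x)) (@diff_lin R V W L).
Qed.

Lemma derive_comp (V W Z : normedModType R) (f : V -> W) (g : W -> Z) (x v : V) :
  differentiable f x -> differentiable g (f x) ->
  'D_v (g \o f) x = 'D_('D_v f x) g (f x).
Proof.
move=> df dg; rewrite !deriveE //; last exact: differentiable_comp.
by rewrite diff_comp.
Qed.

Lemma derive_linear_post (V W Z : normedModType R) (f : V -> W) (l : W -> Z)
    (hl : linear l) (cl : continuous l) (x v : V) :
  differentiable f x -> 'D_v (l \o f) x = l ('D_v f x).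
Proof.
move=> df; have [dl Dl] := linear_derive hl cl (f x) ('D_v f x).
by rewrite derive_comp.
Qed.

(** Both sides are limits of the same difference quotients. *)
Lemma derive_linear_pre (V W Z : normedModType R) (l : V -> W) (f : W -> Z)
    (hl : linear l) (x v : V) :
  'D_v (f \o l) x = 'D_(l v) f (l x).
Proof.
rewrite /derive.
have -> // : (fun h => h^-1 *: (((f \o l) \o shift x) (h *: v) - (f \o l) x)) =
  (fun h => h^-1 *: ((f \o shift (l x)) (h *: l v) - f (l x))).
by apply/funext => h /=; rewrite hl.
Qed.

Lemma derive_dirD (V W : normedModType R) (f : V -> W) (x v w : V) :
  differentiable f x -> 'D_(v + w) f x = 'D_v f x + 'D_w f x.
Proof. by move=> df; rewrite !deriveE // linearD. Qed.

Lemma derive_dirZ (V W : normedModType R) (f : V -> W) (x v : V) (a : R) :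
  differentiable f x -> 'D_(a *: v) f x = a *: 'D_v f x.
Proof. by move=> df; rewrite !deriveE // linearZ. Qed.

Lemma derive_dir_sum (V W : normedModType R) (f : V -> W) (x : V) (I : Type)
    (r : seq I) (P : pred I) (F : I -> V) :
  differentiable f x ->
  'D_(\sum_(i <- r | P i) F i) f x = \sum_(i <- r | P i) 'D_(F i) f x.
Proof.
by move=> df; rewrite deriveE // linear_sum; apply: eq_bigr => i _; rewrite deriveE.
Qed.

Lemma smooth_linear (V W : normedModType R) (U : set V) (l : V -> W) :
  linear l -> continuous l -> smooth_on U l.
Proof.
move=> hl cl; apply/CnP => -[|k]; split => //.
- by move=> x _; case: (linear_derive hl cl x 0).
- by move=> x _; case: (linear_derive hl cl x 0).
move=> v; have -> : 'D_v l = cst (l v).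
  by apply/funext => x; case: (linear_derive hl cl x v).
exact: Cn_cst.
Qed.

Lemma smooth_linear_post (V W Z : normedModType R) (U : set V) (f : V -> W)
    (l : W -> Z) :
  linear l -> continuous l -> open U -> smooth_on U f -> smooth_on U (l \o f).
Proof.
move=> hl cl oU /CnP sf; apply/CnP => k.
have {sf} : Cn k U f by [].
have dl y : differentiable l y by case: (linear_derive hl cl y 0).
elim: k f => [|k IH] f [df Df]; split => //.
- by move=> x Ux; apply: differentiable_comp => //; apply: df.
- by move=> x Ux; apply: differentiable_comp => //; apply: df.
move=> v; apply: Cn_ext (IH _ (Df v)) => // x; rewrite inE => Ux /=.
by rewrite -(derive_linear_post hl cl _ (df x Ux)).
Qed.

Lemma smooth_linear_pre (V W Z : normedModType R) (U : set W) (l : V -> W)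
    (f : W -> Z) :
  linear l -> continuous l -> smooth_on U f -> smooth_on (l @^-1` U) (f \o l).
Proof.
move=> hl cl /CnP sf; apply/CnP => k.
have {sf} : Cn k U f by [].
have dl y : differentiable l y by case: (linear_derive hl cl y 0).
elim: k f => [|k IH] f [df Df]; split => //.
- by move=> x Ux; apply: differentiable_comp => //; apply: df.
- by move=> x Ux; apply: differentiable_comp => //; apply: df.
move=> v; have -> : 'D_v (f \o l) = 'D_(l v) f \o l.
  by apply/funext => x; rewrite derive_linear_pre.
exact/IH/Df.
Qed.

End Linear.

Section Products.
Context {R : realType} {V : normedModType R}.
Implicit Types (f g : V -> R) (U : set V).

Lemma CnM k U f g : open U -> Cn k U f -> Cn k U g -> Cn k U (f \* g).
Proof.
move=> oU; elim: k f g => [|k IH] f g Cf Cg.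
  by split=> // x Ux; apply: differentiableM; [apply: Cn_diff Cf _|apply: Cn_diff Cg _].
have df x : U x -> differentiable f x by apply: Cn_diff Cf.
have dg x : U x -> differentiable g x by apply: Cn_diff Cg.
split=> [x Ux|v]; first by apply: differentiableM; [apply: df|apply: dg].
have C' : Cn k U ((f \* 'D_v g) \+ (g \* 'D_v f)).
  by apply: CnD => //; apply: IH => //;
    [exact: CnS|case: Cg => _; apply|exact: CnS|case: Cf => _; apply].
apply: Cn_ext C' => // x; rewrite inE => Ux /=.
by rewrite deriveM //; apply: diff_derivable; [apply: df|apply: dg].
Qed.

Lemma smoothM U f g : open U -> smooth_on U f -> smooth_on U g ->
  smooth_on U (fun x => f x * g x).
Proof. by move=> oU /CnP sf /CnP sg; apply/CnP => k; apply: CnM. Qed.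

(** The derivative of [f^-1] is a product of smooth functions and of copies of
    [f^-1], so each order of smoothness gives the next one. *)
Lemma smoothV U f : open U -> (forall x, U x -> f x != 0) -> smooth_on U f ->
  smooth_on U (fun x => (f x)^-1).
Proof.
move=> oU f0 sf; apply/CnP.
have df x : U x -> differentiable f x by apply: smooth_differentiable.
have dV x : U x -> differentiable (fun x => (f x)^-1) x.
  by move=> Ux; apply: differentiableV; [apply: df | apply: f0].
elim=> [|k IH]; split => // v.
have sN : smooth_on U (fun x => (- 1) * 'D_v f x).
  apply: smoothM => //; first exact: smooth_cst.
  exact: smooth_derive.
have C' : Cn k U ((fun x => (- 1) * 'D_v f x) \*
     ((fun x => (f x)^-1) \* (fun x => (f x)^-1))).
  by apply: CnM => //; [apply: (CnP _ _).1 | apply: CnM].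
apply: Cn_ext C' => // x; rewrite inE => Ux /=.
have dfv : derivable f x v by apply/diff_derivable/df.
rewrite (deriveV (f0 _ Ux) dfv : 'D_v (fun y => (f y)^-1) x = - (f x) ^- 2 *: 'D_v f x).
by rewrite /GRing.scale /= -exprVn expr2; ring.
Qed.

Lemma smooth_prod U (I : Type) (r : seq I) (P : pred I) (F : I -> V -> R) :
  open U -> (forall i, P i -> smooth_on U (F i)) ->
  smooth_on U (fun x => \prod_(i <- r | P i) F i x).
Proof.
move=> oU sF; elim: r => [|i r IH].
  by have -> : (fun x => \prod_(i <- [::] | P i) F i x) = cst 1
    by [apply/funext => x; rewrite big_nil]; apply: smooth_cst.
case Pi: (P i); last first.
  by have -> : (fun x => \prod_(i <- i :: r | P i) F i x) =
      (fun x => \prod_(i <- r | P i) F i x) by apply/funext => x; rewrite big_cons Pi.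
have -> : (fun x => \prod_(i <- i :: r | P i) F i x) =
   (fun x => F i x * \prod_(i <- r | P i) F i x).
  by apply/funext => x; rewrite big_cons Pi.
by apply: smoothM => //; apply: sF.
Qed.

End Products.

Section Matrices.
Context {R : realType} {V : normedModType R}.
Implicit Types (U : set V).

Lemma coord_linear m n (i : 'I_m) (j : 'I_n) :
  linear (fun A : 'M[R]_(m, n) => A i j : R).
Proof. by move=> a u v; rewrite !mxE. Qed.

Lemma scalel_linear (W : normedModType R) (w : W) :
  linear (fun a : R => a *: w).
Proof. by move=> a b c; rewrite scalerDl scalerA. Qed.

Lemma smooth_coord U m n (F : V -> 'M[R]_(m, n)) i j : open U ->
  smooth_on U F -> smooth_on U (fun x => F x i j).
Proof.
move=> oU; apply: (@smooth_linear_post R V _ _ U F (fun A : 'M[R]_(m, n) => A i j)) => //.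
- exact: coord_linear.
- exact: coord_continuous.
Qed.

Lemma smoothZ U (W : normedModType R) (f : V -> R) (w : W) : open U ->
  smooth_on U f -> smooth_on U (fun x => f x *: w).
Proof.
move=> oU; apply: (@smooth_linear_post R V _ _ U f (fun a : R => a *: w)) => //.
- exact: scalel_linear.
- exact: scalel_continuous.
Qed.

Lemma smooth_mx U m n (F : V -> 'M[R]_(m, n)) : open U ->
  (forall i j, smooth_on U (fun x => F x i j)) -> smooth_on U F.
Proof.
move=> oU sF.
have -> : F = (fun x => \sum_i \sum_j F x i j *: delta_mx i j).
  by apply/funext => x; rewrite -matrix_sum_delta.
apply: smooth_sum => // i _; apply: smooth_sum => // j _.
exact: smoothZ.
Qed.

Lemma smooth_mulmx U m n q (F : V -> 'M[R]_(m, n)) (G : V -> 'M[R]_(n, q)) : open U ->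
  smooth_on U F -> smooth_on U G -> smooth_on U (fun x => F x *m G x).
Proof.
move=> oU sF sG; apply: smooth_mx => // i j.
have -> : (fun x => (F x *m G x) i j) = (fun x => \sum_k F x i k * G x k j).
  by apply/funext => x; rewrite mxE.
by apply: smooth_sum => // k _; apply: smoothM => //; apply: smooth_coord.
Qed.

Lemma smooth_trmx U m n (F : V -> 'M[R]_(m, n)) : open U ->
  smooth_on U F -> smooth_on U (fun x => (F x)^T).
Proof.
move=> oU sF; apply: smooth_mx => // i j.
have -> : (fun x => (F x)^T i j) = (fun x => F x j i).
  by apply/funext => x; rewrite mxE.
exact: smooth_coord.
Qed.

Lemma smooth_det U m (F : V -> 'M[R]_m) : open U ->
  smooth_on U F -> smooth_on U (fun x => \det (F x)).
Proof.
move=> oU sF; apply: smooth_sum => // s _; apply: smoothM => //.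
  exact: smooth_cst.
by apply: smooth_prod => // i _; apply: smooth_coord.
Qed.

Lemma smooth_invmx U m (F : V -> 'M[R]_m) : open U ->
  (forall x, U x -> F x \in unitmx) ->
  smooth_on U F -> smooth_on U (fun x => invmx (F x)).
Proof.
move=> oU uF sF; apply: smooth_mx => // i j.
have sG : smooth_on U (fun x => (\det (F x))^-1 * cofactor (F x) j i).
  apply: smoothM => //.
    apply: smoothV => //; last exact: smooth_det.
    by move=> x /uF; rewrite unitmxE unitfE.
  apply: smoothM => //; first exact: smooth_cst.
  apply: smooth_det => //; apply: smooth_mx => // k l.
  have -> : (fun x => row' j (col' i (F x)) k l) = (fun x => F x (lift j k) (lift i l)).
    by apply/funext => x; rewrite !mxE.
  exact: smooth_coord.
apply: smooth_ext sG => // x; rewrite inE => Ux.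
by rewrite /invmx uF // !mxE.
Qed.

Lemma derive_coord m n (F : V -> 'M[R]_(m, n)) (x v : V) i j :
  differentiable F x -> ('D_v F x) i j = 'D_v (fun y => F y i j) x.
Proof. by move=> dF; rewrite derive_mx ?mxE //; apply: diff_derivable. Qed.

Lemma differentiable_mx m n (F : V -> 'M[R]_(m, n)) (x : V) :
  (forall i j, differentiable (fun y => F y i j) x) -> differentiable F x.
Proof.
move=> dF.
have -> : F = (\sum_i (fun y => \sum_j F y i j *: delta_mx i j)).
  apply/funext => y; rewrite fct_sumE {1}[F y]matrix_sum_delta.
  by [].
apply: differentiable_sum => i.
have -> : (fun y => \sum_j F y i j *: delta_mx i j) =
   \sum_j (fun y => F y i j *: (delta_mx i j : 'M[R]_(m,n))).
  by apply/funext => y; rewrite fct_sumE.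
by apply: differentiable_sum => j; apply: differentiableZl.
Qed.

Lemma differentiable_entry m n (F : V -> 'M[R]_(m, n)) (x : V) i j :
  differentiable F x -> differentiable (fun y => F y i j) x.
Proof.
move=> dF; apply: (@differentiable_comp _ _ _ _ F (fun A : 'M[R]_(m, n) => A i j : R)) => //.
exact: differentiable_coord.
Qed.

Lemma derive_mulmx m n q (F : V -> 'M[R]_(m, n)) (G : V -> 'M[R]_(n, q)) (x v : V) :
  differentiable F x -> differentiable G x ->
  differentiable (fun y => F y *m G y) x /\
  'D_v (fun y => F y *m G y) x = 'D_v F x *m G x + F x *m 'D_v G x.
Proof.
move=> dF dG.
have E i j : (fun y => (F y *m G y) i j) =
     \sum_k ((fun y => F y i k) * (fun y => G y k j)).
  by apply/funext => y; rewrite mxE fct_sumE.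
have dFG : differentiable (fun y => F y *m G y) x.
  apply: differentiable_mx => i j; rewrite E; apply: differentiable_sum => k.
  by apply: differentiableM; apply: differentiable_entry.
split=> //; apply/matrixP => i j; rewrite derive_coord // E derive_sum; last first.
  move=> k; apply: diff_derivable.
  by apply: differentiableM; apply: differentiable_entry.
rewrite !mxE -big_split /=; apply: eq_bigr => k _.
rewrite deriveM; try by apply/diff_derivable/differentiable_entry.
rewrite !derive_coord // addrC; congr (_ + _); exact: mulrC.
Qed.

Lemma differentiable_trmx m n (F : V -> 'M[R]_(m, n)) (x : V) :
  differentiable F x -> differentiable (fun y => (F y)^T) x.
Proof.
move=> dF; apply: differentiable_mx => i j.
have -> : (fun y => (F y)^T i j) = (fun y => F y j i).
  by apply/funext => y; rewrite mxE.
exact: differentiable_entry.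
Qed.

Lemma derive_trmx m n (F : V -> 'M[R]_(m, n)) (x v : V) :
  differentiable F x -> 'D_v (fun y => (F y)^T) x = ('D_v F x)^T.
Proof.
move=> dF; apply/matrixP => i j.
rewrite derive_coord ?mxE ?derive_coord //; last exact: differentiable_trmx.
congr ('D_v _ x); by apply/funext => y; rewrite mxE.
Qed.

End Matrices.

(** * Symmetry of second derivatives *)

Section Schwarz.
Context {R : realType} {V : normedModType R}.
Implicit Types (U : set V) (f : V -> R).

Lemma open_segment U x v w : open U -> U x ->
  exists2 e : R, 0 < e & forall s r, `|s| < e -> `|r| < e ->
     U (x + s *: v + r *: w).
Proof.
move=> oU Ux; have /nbhs_ballP [e /= e0 be] := open_nbhs_nbhs (conj oU Ux).
set m := `|v| + `|w| + 1.
have m0 : 0 < m by rewrite /m ltr_wpDl // addr_ge0.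
exists (e / m) => [|s r hs hr]; first by rewrite divr_gt0.
apply: be; rewrite -ball_normE /= -addrA opprD addrA subrr sub0r normrN.
apply: le_lt_trans (ler_normD _ _) _; rewrite !normrZ.
have h1 : `|s| * `|v| <= e / m * `|v| by rewrite ler_wpM2r // ltW.
have h2 : `|r| * `|w| <= e / m * `|w| by rewrite ler_wpM2r // ltW.
apply: le_lt_trans (lerD h1 h2) _; rewrite -mulrDr.
rewrite -mulrA gtr_pMr // mulrC ltr_pdivrMr // mul1r /m ltrDl.
exact: ltr01.
Qed.

Lemma mean_value_dir f x v (t : R) :
  (forall s, `|s| <= `|t| -> differentiable f (x + s *: v)) ->
  exists2 s, `|s| <= `|t| & f (x + t *: v) - f x = t * 'D_v f (x + s *: v).
Proof.
move=> df.
pose l (s : R) := x + s *: (t *: v).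
have dl s : is_derive s (1 : R) l (t *: v).
  have -> : l = cst x + (fun s : R => s *: (t *: v)) by apply/funext.
  have [d1 d2] := @linear_derive R R V (fun s : R => s *: (t *: v))
     (@scalel_linear R V _) (@scalel_continuous R V _) s (1 : R).
  apply: DeriveDef.
    by apply: derivableD; [exact: derivable_cst|exact: diff_derivable].
  rewrite deriveD; [|exact: derivable_cst|exact: diff_derivable].
  by rewrite derive_cst add0r d2 scale1r.
have dfl (s : R) : 0 <= s <= 1 -> is_derive s (1 : R) (f \o l) (t * 'D_v f (l s)).
  move=> /andP[s0 s1].
  have dfs : differentiable f (l s).
    rewrite /l scalerA; apply: df; rewrite normrM ger0_norm //.
    by rewrite ler_piMl.
  have dls : differentiable l s by apply/derivable1_diffP; case: (dl s).
  apply: DeriveDef; first by apply/diff_derivable/differentiable_comp.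
  rewrite derive_comp //; case: (dl s) => _ ->.
  by rewrite derive_dirZ.
have := @MVT R (f \o l) (fun s => t * 'D_v f (l s)) 0 1 ltr01.
case=> [s|| s].
- by rewrite in_itv /= => /andP[/ltW s0 /ltW s1]; apply: dfl; rewrite s0.
- apply: derivable_within_continuous => s; rewrite in_itv /= => /dfl [] //.
rewrite in_itv /= => /andP[/ltW s0 /ltW s1].
rewrite /l /= scale1r scale0r addr0 subr0 mulr1 => E.
exists (s * t); first by rewrite normrM ger0_norm // ler_piMl.
by rewrite E scalerA.
Qed.

(** Symmetric in [v] and [w]; divided by [t ^ 2] it tends to either of the mixed
    second derivatives. *)
Definition second_difference f x v w (t : R) :=
  f (x + t *: v + t *: w) - f (x + t *: v) - f (x + t *: w) + f x.

Lemma differentiable_shift f x w :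
  differentiable f (x + w) -> differentiable (fun y => f (y + w)) x /\
  forall v, 'D_v (fun y => f (y + w)) x = 'D_v f (x + w).
Proof.
move=> df.
have dl : differentiable (fun y : V => y + w) x.
  by have -> : (fun y : V => y + w) = id + cst w by []; apply: differentiableD.
split=> [|v]; first by apply: (@differentiable_comp _ _ _ _ (fun y => y + w) f).
rewrite (derive_comp (f := fun y => y + w) (g := f)) //.
have -> : (fun y : V => y + w) = id + cst w by [].
rewrite deriveD; [|exact: derivable_id|exact: derivable_cst].
by rewrite derive_id derive_cst addr0.
Qed.

(** The mean value theorem turns the second difference into a difference of
    first derivatives, to which differentiability of ['D_v f] at [x] applies. *)
Lemma second_difference_cvg U f x v w : open U -> U x ->
  (forall y, U y -> differentiable f y) -> differentiable ('D_v f) x ->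
  t ^- 2 * second_difference f x v w t @[t --> (0 : R)^'] --> 'D_w ('D_v f) x.
Proof.
move=> oU Ux df dD.
have [e1 e10 He1] := open_segment v w oU Ux.
apply/cvgrPdist_le => /= eps eps0.
(* [`|t| * m] bounds the two increments [s *: v] and [s *: v + t *: w] together *)
set m := `|v| + `|v| + `|w| + 1.
have m0 : 0 < m by rewrite /m ltr_wpDl // !addr_ge0.
have em0 : 0 < eps / m by rewrite divr_gt0.
have := diff_locally dD; move=> /eqaddoP /(_ _ em0) /nbhs_ballP [e2 /= e20 He2].
have {}He2 h : `|h| < e2 ->
    `|'D_v f (x + h) - 'D_v f x - 'D_h ('D_v f) x| <= eps / m * `|h|.
  move=> hh; have := He2 h; rewrite -ball_normE /= sub0r normrN => /(_ hh).
  rewrite (deriveE h dD) (addrC x h).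
  rewrite -[X in `|X|]/('D_v f (h + x) - ('D_v f x + 'd ('D_v f) x h)).
  by rewrite opprD addrA.
have e3 : 0 < Num.min e1 (e2 / m) by rewrite lt_min e10 divr_gt0.
near=> t.
have t0 : t != 0 by near: t; exact: nbhs_dnbhs_neq.
have tm : `|t| < Num.min e1 (e2 / m).
  by near: t; exact: dnbhs0_lt.
have [te1 te2] : `|t| < e1 /\ `|t| < e2 / m by move: tm; rewrite lt_min => /andP.
have tme2 : `|t| * m < e2 by rewrite -ltr_pdivlMr.
have [s st E] : exists2 s, `|s| <= `|t| &
    second_difference f x v w t =
    t * ('D_v f (x + s *: v + t *: w) - 'D_v f (x + s *: v)).
  have dF s : `|s| <= `|t| ->
     differentiable (fun y => f (y + t *: w)) (x + s *: v) /\
     differentiable f (x + s *: v) /\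
     'D_v (fun y => f (y + t *: w)) (x + s *: v) = 'D_v f (x + s *: v + t *: w).
    move=> st; have se1 : `|s| < e1 by apply: le_lt_trans te1.
    have [h1 h2] := @differentiable_shift f (x + s *: v) (t *: w)
        (df _ (He1 _ _ se1 te1)).
    split=> //; split => //.
    apply: df; rewrite -[x + _]addr0 -(scale0r w); apply: He1 => //.
    by rewrite normr0.
  have := @mean_value_dir ((fun y => f (y + t *: w)) - f) x v t.
  case=> [s /dF [d1 [d2 _]]|s st].
    by apply: differentiableB.
  have [d1 [d2 d3]] := dF s st.
  rewrite deriveB; try exact: diff_derivable.
  rewrite d3 => E; exists s => //; rewrite -E /second_difference.
  rewrite -[RHS]/(f (x + t *: v + t *: w) - f (x + t *: v) -
     (f (x + t *: w) - f x)); ring.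
have hs : `|s *: v| <= `|t| * `|v| by rewrite normrZ ler_wpM2r.
have hst : `|s *: v + t *: w| <= `|t| * (`|v| + `|w|).
  by rewrite (le_trans (ler_normD _ _)) // mulrDr lerD // normrZ.
have b1 : `|s *: v| < e2.
  apply: le_lt_trans tme2; apply: le_trans hs _; rewrite ler_wpM2l // /m.
  by rewrite -!addrA lerDl !addr_ge0.
have b2 : `|s *: v + t *: w| < e2.
  apply: le_lt_trans tme2; apply: le_trans hst _; rewrite ler_wpM2l // /m.
  by rewrite -!addrA lerD2l addrCA lerDl !addr_ge0.
have := He2 _ b1; have := He2 _ b2; rewrite E.
rewrite addrA derive_dirD // (derive_dirZ _ _ dD) (derive_dirZ _ _ dD).
set a := 'D_v f (_ + _ + _); set b := 'D_v f (_ + _); set c := 'D_v f x.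
set dv := 'D_v _ x; set dw := 'D_w _ x => h2 h1.
have key : `|(a - b) - t * dw| <= eps / m * (`|t| * (`|v| + `|v| + `|w|)).
  have -> : a - b - t * dw = (a - c - (s *: dv + t *: dw)) - (b - c - s *: dv).
    by rewrite /GRing.scale /=; ring.
  apply: le_trans (ler_normB _ _) _.
  apply: le_trans (lerD h2 h1) _; rewrite -mulrDr ler_wpM2l //; first exact: ltW.
  apply: le_trans (lerD hst hs) _; rewrite -mulrDr.
  by rewrite addrAC addrC.
have -> : dw - t ^- 2 * (t * (a - b)) = - (t^-1 * (a - b - t * dw)).
  by field.
rewrite normrN normrM normfV -ler_pdivlMl ?invr_gt0 ?normr_gt0 // invrK.
apply: le_trans key _; rewrite mulrCA ler_wpM2l //.
rewrite -mulrA -[leRHS]mulr1 ler_wpM2l ?ltW //.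
by rewrite [m^-1 * _]mulrC ltr_pdivrMr // mul1r /m ltrDl ltr01.
Unshelve. all: by end_near. Qed.

Lemma derive_swap U f x v w : open U -> U x -> smooth_on U f ->
  'D_v ('D_w f) x = 'D_w ('D_v f) x.
Proof.
move=> oU Ux sf.
have df y : U y -> differentiable f y by apply: smooth_differentiable.
have dd z : differentiable ('D_z f) x.
  by apply: smooth_differentiable Ux; apply: smooth_derive.
have c1 := second_difference_cvg (w := w) oU Ux df (dd v).
have c2 := second_difference_cvg (w := v) oU Ux df (dd w).
have E : second_difference f x w v = second_difference f x v w.
  by apply/funext => t; rewrite /second_difference (addrAC x (t *: w)); ring.
rewrite E in c2.
by rewrite -(cvg_lim _ c1) // -(cvg_lim _ c2).
Qed.

Lemma derive_swap_mx U m n (F : V -> 'M[R]_(m, n)) x v w :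
  open U -> U x -> smooth_on U F -> 'D_v ('D_w F) x = 'D_w ('D_v F) x.
Proof.
move=> oU Ux sF; apply/matrixP => i j.
have E a b : ('D_a ('D_b F) x) i j = 'D_a ('D_b (fun y => F y i j)) x.
  rewrite derive_coord; last first.
    by apply: smooth_differentiable Ux; apply: smooth_derive.
  apply: open_derive_eq Ux => // y; rewrite inE => Uy.
  by rewrite derive_coord //; apply: smooth_differentiable Uy.
have sFij : smooth_on U (fun y => F y i j : R) by apply: smooth_coord.
exact: etrans (E v w) (etrans (derive_swap v w oU Ux sFij) (esym (E w v))).
Qed.

End Schwarz.

(** * The Koszul formula at a point *)

Section Koszul.
Context {R : realType} {m : nat}.
Implicit Types (S A : 'M[R]_m) (D G : 'I_m -> 'M[R]_m).

(** With [S] a metric and [D k] its derivative in the direction [k], this is the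
    Christoffel symbol with upper index [c] and lower indices [a], [b]. *)
Definition koszul S D (c a b : 'I_m) : R :=
  \sum_(e < m) invmx S c e / 2%:R * (D b e a + D a e b - D e a b).

(** The connection matrix in the direction [k].  It acts on row vectors from the
    right: the row index is the lower one. *)
Definition koszul_mx S D (k : 'I_m) : 'M[R]_m := \matrix_(i, c) koszul S D c i k.

Lemma invmx_sym S : S^T = S -> (invmx S)^T = invmx S.
Proof. by move=> sS; rewrite trmx_inv sS. Qed.

Lemma koszul_sym S D c a b : (forall k, (D k)^T = D k) ->
  koszul S D c a b = koszul S D c b a.
Proof.
move=> sD; apply: eq_bigr => e _; congr (_ * (_ - _)); first by rewrite addrC.
by rewrite -[in LHS]sD mxE.
Qed.

(** Lowering the upper index removes the inverse of [S]; metricity and uniqueness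
    are read off from this form. *)
Lemma koszul_lower S D k : S^T = S -> S \in unitmx ->
  koszul_mx S D k *m S =
  \matrix_(i, j) (2%:R^-1 * (D k j i + D i j k - D j i k)).
Proof.
move=> sS uS; apply/matrixP => i j; rewrite !mxE.
have -> : \sum_c koszul_mx S D k i c * S c j =
   \sum_e (2%:R^-1 * (D k e i + D i e k - D e i k)) * \sum_c invmx S e c * S c j.
  under eq_bigr do rewrite mxE /koszul mulr_suml.
  rewrite exchange_big /=; apply: eq_bigr => e _; rewrite mulr_sumr.
  apply: eq_bigr => c _.
  have -> : invmx S e c = invmx S c e by rewrite -[in LHS](invmx_sym sS) mxE.
  by ring.
have E e : \sum_c invmx S e c * S c j = (e == j)%:R.
  by have := mulVmx uS => /matrixP /(_ e j); rewrite !mxE.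
rewrite (bigD1 j) //= E eqxx mulr1 big1 ?addr0 // => e ne.
by rewrite E (negbTE ne) mulr0.
Qed.

Lemma koszul_metric S D k : S^T = S -> S \in unitmx -> (forall k, (D k)^T = D k) ->
  koszul_mx S D k *m S + S *m (koszul_mx S D k)^T = D k.
Proof.
move=> sS uS sD.
have -> : S *m (koszul_mx S D k)^T = (koszul_mx S D k *m S)^T.
  by rewrite trmx_mul sS.
rewrite koszul_lower //; apply/matrixP => i j; rewrite !mxE.
have E e a b : D e a b = D e b a by rewrite -[in LHS]sD mxE.
by rewrite (E k j i) (E i j k) (E j i k); field.
Qed.

(** The fundamental lemma of Riemannian geometry at a point: cyclic permutation
    of the metricity condition isolates one coefficient. *)
Lemma koszul_unique S D G k : S^T = S -> S \in unitmx ->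
  (forall k i c, G k i c = G i k c) ->
  (forall k, G k *m S + S *m (G k)^T = D k) -> G k = koszul_mx S D k.
Proof.
move=> sS uS sG mG.
suff E : G k *m S = koszul_mx S D k *m S.
  by rewrite -[LHS](mulmxK uS) E mulmxK.
rewrite koszul_lower //; apply/matrixP => i j; rewrite [RHS]mxE.
pose g a b c := (G a *m S) b c.
have gs a b c : g a b c = g b a c.
  by rewrite /g !mxE; apply: eq_bigr => e _; rewrite sG.
(* the three cyclic permutations of this identity determine [g k i j] *)
have DE a b c : D a b c = g a b c + g a c b.
  rewrite -mG mxE; congr (_ + _).
  by rewrite -[in LHS]sS -trmx_mul mxE.
rewrite !DE -/(g k i j) (gs j k i) (gs i k j) (gs i j k).
by field.
Qed.

End Koszul.

Section KoszulTransform.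
Context {R : realType} {m : nat}.
Variables (S S' A : 'M[R]_m) (D D' dA : 'I_m -> 'M[R]_m).

(** Uniqueness gives the inhomogeneous transformation law: the transported
    coefficients are again symmetric and metric. *)
Lemma koszul_transform k : S^T = S -> S'^T = S' -> S' \in unitmx -> A \in unitmx ->
  S = A *m S' *m A^T ->
  (forall k, (D' k)^T = D' k) ->
  (forall k, D k = dA k *m S' *m A^T + A *m (\sum_l A k l *: D' l) *m A^T
                   + A *m S' *m (dA k)^T) ->
  (forall k i c, dA k i c = dA i k c) ->
  koszul_mx S D k *m A = dA k + A *m \sum_l A k l *: koszul_mx S' D' l.
Proof.
move=> sS sS' uS' uA SE sD' DE dAs.
have uS : S \in unitmx by rewrite SE !unitmx_mul uA uS' unitmx_tr uA.
pose C k := \sum_l A k l *: koszul_mx S' D' l.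
(* the coefficients of the metric [S'] transported by [A] *)
pose G k := (dA k + A *m C k) *m invmx A.
suff -> : koszul_mx S D k = G k by rewrite /G mulmxKV.
apply/esym/koszul_unique => //.
- move=> a b c; rewrite /G !mxE; apply: eq_bigr => e _; congr (_ * _).
  rewrite !mxE dAs; congr (_ + _).
  transitivity (\sum_q \sum_l A b q * A a l * koszul_mx S' D' l q e).
    apply: eq_bigr => q _; rewrite summxE mulr_sumr; apply: eq_bigr => l _.
    by rewrite mxE mulrA.
  rewrite exchange_big /=; apply: eq_bigr => l _.
  rewrite summxE mulr_sumr; apply: eq_bigr => q _.
  rewrite [X in _ = _ * X]mxE [A b q * _]mulrC -!mulrA; congr (_ * (_ * _)).
  by rewrite !mxE koszul_sym.
move=> a; rewrite /G SE !trmx_mul linearD /= trmx_mul DE.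
have -> : \sum_l A a l *: D' l = C a *m S' + S' *m (C a)^T.
  rewrite /C linear_sum /= mulmx_suml mulmx_sumr -big_split /=.
  apply: eq_bigr => l _; rewrite linearZ /= -scalemxAl -scalemxAr -scalerDr.
  by rewrite koszul_metric.
have K1 : invmx A *m (A *m S' *m A^T) = S' *m A^T.
  by rewrite !mulmxA mulVmx // mul1mx.
have K2 : A *m S' *m A^T *m (invmx A)^T = A *m S'.
  by rewrite -!mulmxA -trmx_mul mulVmx // trmx1 mulmx1.
rewrite -[_ *m invmx A *m _]mulmxA K1 [A *m S' *m A^T *m (_ *m _)]mulmxA K2.
rewrite !(mulmxDl, mulmxDr) !mulmxA.
by rewrite -!addrA; congr (_ + (_ + _)); rewrite addrC.
Qed.

End KoszulTransform.

(** * Changes of charts and the differential of the jet coordinate changes *)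

Section ManifoldCharts.
Context {R : realType} {m : nat} (X : smooth_manifold R m).
Implicit Types (a b : chart X) (x : 'rV[R]_m).

Lemma cinvK a (y : X) : cdom a y -> cinv a (cmap a y) = y.
Proof. by case: X a y => *; auto. Qed.

Lemma cimage_open a : open (cimage a).
Proof. by rewrite /cimage; case: X a => ? ? ? ? ? ? ? ? ? H *; apply: H. Qed.

Lemma cdom_open a : open (cdom a).
Proof. by case: X a => ? ? ? ? ? ? ? ? H *; apply: H. Qed.

Lemma ctrans_smooth a b : smooth_on (coverlap a b) (ctrans a b).
Proof. by rewrite /coverlap /ctrans; case: X a b => *; auto. Qed.

Lemma coverlap_sub a b : coverlap a b `<=` cimage a.
Proof. by move=> _ [y [ay _] <-]; exists y. Qed.

Lemma coverlapE a b x : coverlap a b x <-> cimage a x /\ cdom b (cinv a x).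
Proof.
split=> [[y [ay yb] <-]|[[y ay <-]]]; first by split; [exists y | rewrite cinvK].
by rewrite cinvK // => yb; exists y.
Qed.

Lemma ctrans_overlap a b x : coverlap a b x -> coverlap b a (ctrans a b x).
Proof.
by move=> [y [ay yb] <-]; rewrite /ctrans /= cinvK //; exists y.
Qed.

Lemma ctransK a b x : coverlap a b x -> ctrans b a (ctrans a b x) = x.
Proof. by move=> [y [ay yb] <-]; rewrite /ctrans /= !cinvK. Qed.

Lemma coverlap_open a b : open (coverlap a b).
Proof.
have ca : {within cimage a, continuous (cinv a)}.
  by rewrite /cimage; case: X a => *; auto.
have -> : coverlap a b = cimage a `&` cinv a @^-1` cdom b.
  by apply/seteqP; split=> x; rewrite coverlapE.
have := ca; rewrite continuous_open_subspace; last exact: cimage_open.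
move=> /(continuous_inP _ (@cimage_open a)); apply; exact: cdom_open.
Qed.

Lemma ctrans_differentiable a b x : coverlap a b x -> differentiable (ctrans a b) x.
Proof. by apply: smooth_differentiable; apply: ctrans_smooth. Qed.

Lemma derive_ctrans a b x v : coverlap a b x ->
  'D_v (ctrans a b) x = v *m cjac a b x.
Proof. by move=> ab; apply: deriveEjacobian; apply: ctrans_differentiable. Qed.

Lemma cjacK a b x : coverlap a b x -> cjac a b x *m cjac b a (ctrans a b x) = 1%:M.
Proof.
move=> ab; apply/row_matrixP => i; rewrite !rowE mulmxA mulmx1.
have -> : delta_mx 0 i *m cjac a b x = 'D_(delta_mx 0 i) (ctrans a b) x.
  exact: esym (derive_ctrans _ ab).
apply: etrans (esym (derive_ctrans _ (ctrans_overlap ab))) _.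
rewrite -derive_comp; last 2 first.
- exact: ctrans_differentiable.
- exact/ctrans_differentiable/ctrans_overlap.
rewrite -[RHS](derive_id x); apply: open_derive_eq ab; first exact: coverlap_open.
by move=> y; rewrite inE => /ctransK.
Qed.

Lemma cjac_unit a b x : coverlap a b x -> cjac a b x \in unitmx.
Proof. by move=> /cjacK /mulmx1_unit [uA _]; exact: uA. Qed.

Lemma cjac_inv a b x : coverlap a b x ->
  cjac b a (ctrans a b x) = invmx (cjac a b x).
Proof.
move=> ab; rewrite -[LHS]mul1mx -(mulVmx (cjac_unit ab)) -mulmxA cjacK //.
by rewrite mulmx1.
Qed.

Lemma cjacE a b x i j : coverlap a b x ->
  cjac a b x i j = ('D_(delta_mx 0 i) (ctrans a b) x) 0 j.
Proof. by move=> ab; rewrite derive_ctrans // -rowE [RHS]mxE. Qed.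

Lemma cjac_smooth a b : smooth_on (coverlap a b) (cjac a b).
Proof.
apply: smooth_mx => [|i j]; first exact: coverlap_open.
have s1 : smooth_on (coverlap a b) (fun x => ('D_(delta_mx 0 i) (ctrans a b) x) 0 j : R).
  apply: smooth_coord; first exact: coverlap_open.
  exact/smooth_derive/ctrans_smooth.
apply: smooth_ext s1; first exact: coverlap_open.
by move=> x; rewrite inE => ab; rewrite cjacE.
Qed.

Lemma cjac_differentiable a b x : coverlap a b x -> differentiable (cjac a b) x.
Proof. by apply: smooth_differentiable; apply: cjac_smooth. Qed.

(** Schwarz for the change of charts, whose first derivative is [cjac]. *)
Lemma derive_cjac_sym a b x (v w : 'rV[R]_m) : coverlap a b x ->
  w *m 'D_v (cjac a b) x = v *m 'D_w (cjac a b) x.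
Proof.
move=> ab.
have E (v' w' : 'rV[R]_m) : w' *m 'D_v' (cjac a b) x = 'D_v' ('D_w' (ctrans a b)) x.
  have [_] := @derive_mulmx R _ _ _ _ (cst w') (cjac a b) x v'
     (differentiable_cst _ _) (cjac_differentiable ab).
  rewrite derive_cst mul0mx add0r => <-.
  apply: open_derive_eq ab; first exact: coverlap_open.
  by move=> y; rewrite inE => yab; rewrite derive_ctrans.
rewrite E (E w v); apply: (derive_swap_mx (U := coverlap a b)) => //.
- exact: coverlap_open.
- exact: ctrans_smooth.
Qed.

Lemma derive_cjac_sym_entry a b x k i j : coverlap a b x ->
  ('D_(delta_mx 0 k) (cjac a b) x) i j = ('D_(delta_mx 0 i) (cjac a b) x) k j.
Proof.
move=> ab; have := derive_cjac_sym (delta_mx 0 k) (delta_mx 0 i) ab.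
move: ('D_(delta_mx 0 k) _ x) ('D_(delta_mx 0 i) _ x) => P Q.
by rewrite -!rowE => /rowP /(_ j); rewrite !mxE.
Qed.

End ManifoldCharts.

Section JetDerivative.
Context {R : realType} {p n : nat}.
Context (T : smooth_manifold R p) (M : smooth_manifold R n).
Local Notation V := (jcoord R p n).
Implicit Types (c : jchart T M) (z v : V).

Lemma tproj_linear : linear (fun z : V => z.1.1). Proof. by []. Qed.
Lemma xproj_linear : linear (fun z : V => z.1.2). Proof. by []. Qed.
Lemma uproj_linear : linear (fun z : V => z.2). Proof. by []. Qed.
Lemma tproj_continuous : continuous (fun z : V => z.1.1).
Proof. by move=> z; apply: continuous_comp; exact: cvg_fst. Qed.
Lemma xproj_continuous : continuous (fun z : V => z.1.2).
Proof. by move=> z; apply: continuous_comp; [exact: cvg_fst|exact: cvg_snd]. Qed.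
Lemma uproj_continuous : continuous (fun z : V => z.2).
Proof. by move=> z; exact: cvg_snd. Qed.

Lemma jdom_open c : open (jdom c).
Proof.
have -> : jdom c = (fun z : V => z.1.1) @^-1` (cimage c.1) `&`
   (fun z : V => z.1.2) @^-1` (cimage c.2) by [].
apply: openI; apply: open_comp; try exact: cimage_open.
- by move=> z _; exact: tproj_continuous.
- by move=> z _; exact: xproj_continuous.
Qed.

Lemma joverlap_open c c' : open (joverlap c c').
Proof.
have -> : joverlap c c' = (fun z : V => z.1.1) @^-1` (coverlap c.1 c'.1) `&`
   (fun z : V => z.1.2) @^-1` (coverlap c.2 c'.2) by [].
apply: openI; apply: open_comp; try exact: coverlap_open.
- by move=> z _; exact: tproj_continuous.
- by move=> z _; exact: xproj_continuous.
Qed.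

Lemma joverlap_sub c c' : joverlap c c' `<=` jdom c.
Proof. by move=> z [/coverlap_sub ? /coverlap_sub ?]. Qed.

Lemma jtrans_dom c c' z : joverlap c c' z -> jdom c' (jtrans c c' z).
Proof.
by move=> [/ctrans_overlap/coverlap_sub ? /ctrans_overlap/coverlap_sub ?].
Qed.

Lemma derive_pair (W W1 W2 : normedModType R) (f : W -> W1) (g : W -> W2) (x v : W) :
  differentiable f x -> differentiable g x ->
  differentiable (fun y => (f y, g y)) x /\
  'D_v (fun y => (f y, g y)) x = ('D_v f x, 'D_v g x).
Proof.
move=> df dg; have d := differentiable_pair df dg; split=> //.
by rewrite deriveE // diff_pair // !deriveE.
Qed.

Lemma derive_base (W W' : normedModType R) (l : V -> W) (f : W -> W') z v :
  linear l -> continuous l -> differentiable f (l z) ->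
  differentiable (fun y => f (l y)) z /\ 'D_v (fun y => f (l y)) z = 'D_(l v) f (l z).
Proof.
move=> hl cl df; split; last exact: (derive_linear_pre f hl).
apply: (@differentiable_comp _ _ _ _ l f) => //.
by case: (linear_derive hl cl z 0).
Qed.

Lemma derive_inverse_of_product m (A B dA dB : 'M[R]_m) : A \in unitmx -> B = invmx A ->
  dA *m B + A *m dB = 0 -> dB = - (invmx A *m dA *m invmx A).
Proof.
move=> uA -> /eqP; rewrite addrC addr_eq0 => /eqP E.
by rewrite -[LHS]mul1mx -(mulVmx uA) -[LHS]mulmxA E mulmxN mulmxA.
Qed.

Section Overlap.
Variables (c c' : jchart T M) (z : V).
Hypothesis zc : joverlap c c' z.

Definition jacT := cjac c.1 c'.1 z.1.1.
Definition jacM := cjac c.2 c'.2 z.1.2.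
Definition djacT v := 'D_(v.1.1) (cjac c.1 c'.1) z.1.1.
Definition djacM v := 'D_(v.1.2) (cjac c.2 c'.2) z.1.2.

Lemma jacT_unit : jacT \in unitmx. Proof. by case: zc => /cjac_unit. Qed.
Lemma jacM_unit : jacM \in unitmx. Proof. by case: zc => _ /cjac_unit. Qed.

(** The differential of [jtrans c c'] at [z], in closed form.  The last line is the
    contribution of the inverse Jacobian of the temporal coordinates. *)
Definition djtrans v : V :=
  (v.1.1 *m jacT, v.1.2 *m jacM,
   ((djacM v)^T *m z.2 + jacM^T *m v.2) *m (invmx jacT)^T
   - jacM^T *m z.2 *m (invmx jacT *m djacT v *m invmx jacT)^T).

(** Obtained from the product with the Jacobian of the inverse change, which is
    constant. *)
Lemma derive_cjac_back v :
  differentiable (fun y : V => cjac c'.1 c.1 (ctrans c.1 c'.1 y.1.1)) z /\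
  'D_v (fun y : V => cjac c'.1 c.1 (ctrans c.1 c'.1 y.1.1)) z =
   - (invmx jacT *m djacT v *m invmx jacT).
Proof.
have [zT _] := zc.
set Bi := fun y : V => _.
have [d1 D1] := derive_base v tproj_linear tproj_continuous (cjac_differentiable zT).
have d2 : differentiable Bi z.
  have [d2 _] := derive_base v tproj_linear tproj_continuous
     (ctrans_differentiable zT).
  apply: (@differentiable_comp _ _ _ _ (fun y : V => ctrans c.1 c'.1 y.1.1)
     (cjac c'.1 c.1)) => //.
  exact/cjac_differentiable/ctrans_overlap.
split; first exact: d2.
have [_ E] := derive_mulmx v d1 d2.
have E0 : 'D_v (fun y : V => cjac c.1 c'.1 y.1.1 *m Bi y) z = 0.
  rewrite -[RHS](derive_cst (1%:M : 'M[R]_p) z v).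
  apply: open_derive_eq zc; first exact: joverlap_open.
  by move=> y; rewrite inE => -[yT _]; rewrite /Bi cjacK.
apply: (derive_inverse_of_product (B := Bi z)); first exact: jacT_unit.
  exact: cjac_inv.
by rewrite /djacT -D1; apply: etrans (esym E) E0.
Qed.

Lemma derive_jtrans v :
  differentiable (jtrans c c') z /\ 'D_v (jtrans c c') z = djtrans v.
Proof.
have [zT zM] := zc.
have [dt Dt] := derive_base v tproj_linear tproj_continuous (ctrans_differentiable zT).
have [dx Dx] := derive_base v xproj_linear xproj_continuous (ctrans_differentiable zM).
have [dA DA] := derive_base v xproj_linear xproj_continuous (cjac_differentiable zM).
have [du Du] := linear_derive uproj_linear uproj_continuous z v.
have [dB DB] := derive_cjac_back v.
have [dAu DAu] := derive_mulmx v (differentiable_trmx dA) du.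
have [dP DP] := derive_mulmx v dAu (differentiable_trmx dB).
have [d2 D2] := derive_pair v dt dx.
have [d3 D3] := derive_pair v d2 dP.
split; first exact: d3.
rewrite [LHS]D3 D2 Dt Dx DP DAu !derive_trmx // DA DB Du.
rewrite !derive_ctrans // -/jacT -/jacM cjac_inv // -/jacT.
by rewrite /djtrans linearN /= mulmxN.
Qed.

Lemma djtransE v : 'd (jtrans c c') z v = djtrans v.
Proof. by have [d <-] := derive_jtrans v; rewrite deriveE. Qed.

Lemma derive_comp_jtrans (W : normedModType R) (f : V -> W) v :
  differentiable f (jtrans c c' z) ->
  differentiable (fun y => f (jtrans c c' y)) z /\
  'D_v (fun y => f (jtrans c c' y)) z = 'D_(djtrans v) f (jtrans c c' z).
Proof.
move=> df; have [d D] := derive_jtrans v.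
split; first by apply: (@differentiable_comp _ _ _ _ (jtrans c c') f).
by apply: etrans (derive_comp v d df) _; rewrite D.
Qed.

End Overlap.
End JetDerivative.

(** * Smooth vector fields in jet coordinates *)

Section SmoothFields.
Context {R : realType} {p n : nat}.
Local Notation V := (jcoord R p n).

Lemma smooth_scalemx (W : normedModType R) (U : set W) (k l : nat) (f : W -> R)
    (F : W -> 'M[R]_(k, l)) :
  open U -> smooth_on U f -> smooth_on U F -> smooth_on U (fun z => f z *: F z).
Proof.
move=> oU sf sF; apply: smooth_mx => // i j.
have -> : (fun z => (f z *: F z) i j) = (fun z => f z * F z i j).
  by apply/funext => z; rewrite mxE.
by apply: smoothM => //; apply: smooth_coord.
Qed.

Lemma jcoord_frame (v : V) :
  v = \sum_a v.1.1 0 a *: et a + \sum_i v.1.2 0 i *: ex i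
      + \sum_i \sum_a v.2 i a *: eu i a :> V.
Proof.
have s1 (I : Type) (r : seq I) (F : I -> V) :
    (\sum_(i <- r) F i : V).1.1 = \sum_(i <- r) (F i).1.1.
  by elim/big_rec2: _ => // i x y _ <-.
have s2 (I : Type) (r : seq I) (F : I -> V) :
    (\sum_(i <- r) F i : V).1.2 = \sum_(i <- r) (F i).1.2.
  by elim/big_rec2: _ => // i x y _ <-.
have s3 (I : Type) (r : seq I) (F : I -> V) :
    (\sum_(i <- r) F i : V).2 = \sum_(i <- r) (F i).2.
  by elim/big_rec2: _ => // i x y _ <-.
have sD1 (x y : V) : (x + y).1.1 = x.1.1 + y.1.1 by [].
have sD2 (x y : V) : (x + y).1.2 = x.1.2 + y.1.2 by [].
have sD3 (x y : V) : (x + y).2 = x.2 + y.2 by [].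
have s1' : v.1.1 = \sum_a v.1.1 0 a *: delta_mx 0 a := row_sum_delta _.
have s2' : v.1.2 = \sum_a v.1.2 0 a *: delta_mx 0 a := row_sum_delta _.
have s3' : v.2 = \sum_i \sum_a v.2 i a *: delta_mx i a := matrix_sum_delta _.
case: v s1' s2' s3' => [[vt vx] vu] /= s1' s2' s3'.
congr (_, _, _).
- rewrite sD1 !s1 /= [in LHS]s1' -[LHS]addr0 -[LHS]addr0.
  congr (_ + _ + _); apply: esym; apply: big1 => i _; rewrite /= ?scaler0 //.
  by rewrite s1 big1 // => a _; rewrite /= scaler0.
- rewrite sD2 !s2 /= [in LHS]s2' -[LHS]addr0 -[X in X + 0]add0r.
  congr (_ + _ + _); apply: esym; apply: big1 => i _; rewrite /= ?scaler0 //.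
  by rewrite s2 big1 // => a _; rewrite /= scaler0.
rewrite sD3 !s3 /= [in LHS]s3' -[LHS]add0r -[X in X + _]add0r.
congr (_ + _ + _); try by apply: esym; apply: big1 => i _; rewrite /= ?scaler0.
by apply: eq_bigr => i _; rewrite s3.
Qed.

Lemma derive_frame (W : normedModType R) (F : V -> W) z v : differentiable F z ->
  'D_v F z = \sum_a v.1.1 0 a *: 'D_(et a) F z + \sum_i v.1.2 0 i *: 'D_(ex i) F z
      + \sum_i \sum_a v.2 i a *: 'D_(eu i a) F z.
Proof.
move=> dF; rewrite [in LHS](jcoord_frame v).
rewrite (derive_dirD _ _ dF) (derive_dirD _ _ dF) !(derive_dir_sum _ _ _ dF).
congr (_ + _ + _); apply: eq_bigr => i _; rewrite ?(derive_dirZ _ _ dF) //.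
rewrite (derive_dir_sum _ _ _ dF); apply: eq_bigr => a _.
by rewrite (derive_dirZ _ _ dF).
Qed.

Implicit Types (U : set V) (X Y : V -> V).

Lemma smooth_tcomp U X : open U -> smooth_on U X -> smooth_on U (fun z => (X z).1.1).
Proof.
move=> oU sX; apply: (@smooth_linear_post _ _ V _ U X (fun z : V => z.1.1)) => //.
exact: tproj_continuous.
Qed.

Lemma smooth_xcomp U X : open U -> smooth_on U X -> smooth_on U (fun z => (X z).1.2).
Proof.
move=> oU sX; apply: (@smooth_linear_post _ _ V _ U X (fun z : V => z.1.2)) => //.
exact: xproj_continuous.
Qed.

Lemma smooth_ucomp U X : open U -> smooth_on U X -> smooth_on U (fun z => (X z).2).
Proof.
move=> oU sX; apply: (@smooth_linear_post _ _ V _ U X (fun z : V => z.2)) => //.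
exact: uproj_continuous.
Qed.

Lemma smooth_field U (a : V -> 'rV[R]_p) (b : V -> 'rV[R]_n) (w : V -> 'M[R]_(n, p)) :
  open U -> smooth_on U a -> smooth_on U b -> smooth_on U w ->
  smooth_on U (fun z => (a z, b z, w z) : V).
Proof.
move=> oU sa sb sw.
have -> : (fun z => (a z, b z, w z) : V) =
   (fun z => (a z, 0, 0) : V) \+ ((fun z => (0, b z, 0) : V) \+ (fun z => (0, 0, w z) : V)).
  by apply/funext => z; congr (_, _, _); rewrite /= ?addr0 ?add0r.
apply: smoothD => //; [|apply: smoothD => //].
- apply: (@smooth_linear_post _ _ _ V U a (fun x => (x, 0, 0))) => //.
    by move=> k x y; congr (_, _, _); rewrite /= ?scaler0 ?addr0.
  by move=> x; apply: differentiable_continuous; do 2!apply: differentiable_pair => //; exact: differentiable_cst.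
- apply: (@smooth_linear_post _ _ _ V U b (fun x => (0, x, 0))) => //.
    by move=> k x y; congr (_, _, _); rewrite /= ?scaler0 ?addr0.
  by move=> x; apply: differentiable_continuous; do 2!apply: differentiable_pair => //; exact: differentiable_cst.
apply: (@smooth_linear_post _ _ _ V U w (fun x => (0, 0, x))) => //.
  by move=> k x y; congr (_, _, _); rewrite /= ?scaler0 ?addr0.
by move=> x; apply: differentiable_continuous; do 2!apply: differentiable_pair => //; exact: differentiable_cst.
Qed.

(** Iterated derivatives are taken along constant vectors, so a derivative along
    a field is first expanded in the coordinate frame. *)
Lemma smooth_derive_field_scalar U X (f : V -> R) : open U ->
  smooth_on U X -> smooth_on U f -> smooth_on U (fun z => 'D_(X z) f z).
Proof.
move=> oU sX sf.
have st : smooth_on U (fun z => (X z).1.1) by apply: smooth_tcomp.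
have sx : smooth_on U (fun z => (X z).1.2) by apply: smooth_xcomp.
have su : smooth_on U (fun z => (X z).2) by apply: smooth_ucomp.
have s1 : smooth_on U ((fun z => \sum_a (X z).1.1 0 a * 'D_(et a) f z) \+
   ((fun z => \sum_i (X z).1.2 0 i * 'D_(ex i) f z)
      \+ (fun z => \sum_i \sum_a (X z).2 i a * 'D_(eu i a) f z))).
  apply: smoothD => //; [|apply: smoothD => //]; apply: smooth_sum => // i _.
  - by apply: smoothM => //; [apply: smooth_coord|apply: smooth_derive].
  - by apply: smoothM => //; [apply: smooth_coord|apply: smooth_derive].
  apply: smooth_sum => // a _.
  by apply: smoothM => //; [apply: smooth_coord|apply: smooth_derive].
apply: smooth_ext s1 => // z; rewrite inE => Uz.
rewrite [RHS]derive_frame; last exact: smooth_differentiable Uz.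
by rewrite /= addrA.
Qed.

Lemma smooth_derive_field U X k l (F : V -> 'M[R]_(k, l)) : open U ->
  smooth_on U X -> smooth_on U F -> smooth_on U (fun z => 'D_(X z) F z).
Proof.
move=> oU sX sF; apply: smooth_mx => // i j.
have s1 : smooth_on U (fun z => 'D_(X z) (fun y => F y i j : R) z).
  by apply: smooth_derive_field_scalar => //; apply: smooth_coord.
apply: smooth_ext s1 => // z; rewrite inE => Uz.
by apply: esym; apply: derive_coord; apply: smooth_differentiable Uz.
Qed.

Lemma smooth_koszul_mx (W : normedModType R) (U : set W) m (S : W -> 'M[R]_m)
   (D : W -> 'I_m -> 'M[R]_m) k : open U ->
  (forall z, U z -> S z \in unitmx) ->
  smooth_on U S -> (forall l, smooth_on U (fun z => D z l)) ->
  smooth_on U (fun z => koszul_mx (S z) (D z) k).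
Proof.
move=> oU uS sS sD; apply: smooth_mx => // i j.
have -> : (fun z => koszul_mx (S z) (D z) k i j) = (fun z => koszul (S z) (D z) j i k).
  by apply/funext => z; rewrite mxE.
have sI := smooth_invmx oU uS sS.
apply: smooth_sum => // e _.
apply: (@smoothM _ _ _ (fun z => invmx (S z) j e / 2%:R)) => //.
  apply: smoothM => //; [exact: smooth_coord|exact: smooth_cst].
have -> : (fun z => D z k e i + D z i e k - D z e i k) =
   (fun z => D z k e i) \+ ((fun z => D z i e k) \+ (fun z => (- 1) * D z e i k)).
  by apply/funext => z /=; rewrite mulN1r addrA.
apply: smoothD => //; first exact: smooth_coord.
apply: smoothD => //; first exact: smooth_coord.
apply: smoothM => //; [exact: smooth_cst|exact: smooth_coord].
Qed.

End SmoothFields.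

(** * Adapted components and the connection given by its coefficients *)

Section Geometry.
Context {R : realType} {p n : nat}.
Context {T : smooth_manifold R p} {M : smooth_manifold R n}.
Local Notation V := (jcoord R p n).
Variables (h : metric_family T) (g : dtensor_family T M) (Gam : nonlinear_coefs T M).
Implicit Types (c : jchart T M) (z v : V) (X Y : V -> V) (U : set V).

Definition Mmx c z (b : 'I_p) : 'M[R]_(n, p) := \matrix_(i, a) Mcoef Gam c z i a b.
Definition Nmx c z (j : 'I_n) : 'M[R]_(n, p) := \matrix_(i, a) Ncoef Gam c z i a j.

(** The horizontal part that the nonlinear connection adds to the components
    [dx^i_a] of a vector to give its components [delta x^i_a]. *)
Definition nl_term c z (a : 'rV[R]_p) (b : 'rV[R]_n) : 'M[R]_(n, p) :=
  \sum_e a 0 e *: Mmx c z e + \sum_j b 0 j *: Nmx c z j.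

(** The components of [v] with respect to the forms [delta x^i_a].  With [v.1.1]
    and [v.1.2] they make up the adapted components of [v], from which [assemble]
    recovers [v]. *)
Definition ver c z v : 'M[R]_(n, p) := v.2 + nl_term c z v.1.1 v.1.2.

Definition assemble c z (a : 'rV[R]_p) (b : 'rV[R]_n) (w : 'M[R]_(n, p)) : V :=
  (a, b, w - nl_term c z a b).

Lemma ver_assemble c z a b w : ver c z (assemble c z a b w) = w.
Proof. by rewrite /ver /= subrK. Qed.

Lemma assemble_ver c z v : assemble c z v.1.1 v.1.2 (ver c z v) = v.
Proof. by case: v => [[a b] w]; rewrite /assemble /ver /= addrK. Qed.

Lemma nl_termD c z a a' b b' :
  nl_term c z (a + a') (b + b') = nl_term c z a b + nl_term c z a' b'.
Proof.
rewrite /nl_term addrACA -!big_split /=; congr (_ + _);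
  by apply: eq_bigr => e _; rewrite mxE scalerDl.
Qed.

Lemma nl_termZ c z k a b :
  nl_term c z (k *: a) (k *: b) = k *: nl_term c z a b.
Proof.
rewrite /nl_term scalerDr !scaler_sumr; congr (_ + _);
  by apply: eq_bigr => e _; rewrite mxE scalerA.
Qed.

Lemma nl_term0 c z : nl_term c z 0 0 = 0.
Proof.
by rewrite /nl_term !big1 ?addr0 // => i _; rewrite mxE scale0r.
Qed.

Lemma verD c z v (w : V) : ver c z (v + w) = ver c z v + ver c z w.
Proof. by rewrite /ver /= nl_termD addrACA. Qed.

Lemma verZ c z k v : ver c z (k *: v) = k *: ver c z v.
Proof. by rewrite /ver -[(k *: v).1.1]/(k *: v.1.1) -[(k *: v).1.2]/(k *: v.1.2) nl_termZ -scalerDr. Qed.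

Lemma assembleD c z a b w a' b' w' :
  assemble c z (a + a') (b + b') (w + w') = assemble c z a b w + assemble c z a' b' w'.
Proof. by rewrite /assemble nl_termD opprD addrACA. Qed.

Lemma assembleZ c z k a b w :
  assemble c z (k *: a) (k *: b) (k *: w) = k *: assemble c z a b w.
Proof. by rewrite /assemble nl_termZ -scalerBr. Qed.

Lemma nl_term_t c z e : nl_term c z (delta_mx 0 e) 0 = Mmx c z e.
Proof.
rewrite /nl_term [X in _ + X]big1 => [|j _]; last by rewrite mxE scale0r.
rewrite addr0 (bigD1 e) //= mxE !eqxx scale1r big1 ?addr0 // => i ie.
by rewrite mxE eqxx (negbTE ie) scale0r.
Qed.

Lemma nl_term_x c z j : nl_term c z 0 (delta_mx 0 j) = Nmx c z j.
Proof.
rewrite /nl_term [X in X + _]big1 => [|i _]; last by rewrite mxE scale0r.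
rewrite add0r (bigD1 j) //= mxE !eqxx scale1r big1 ?addr0 // => i ie.
by rewrite mxE eqxx (negbTE ie) scale0r.
Qed.

Lemma delta_tE c a z : delta_t Gam c a z = assemble c z (delta_mx 0 a) 0 0.
Proof. by rewrite /assemble nl_term_t sub0r. Qed.

Lemma delta_xE c i z : delta_x Gam c i z = assemble c z 0 (delta_mx 0 i) 0.
Proof. by rewrite /assemble nl_term_x sub0r. Qed.

Lemma partial_uE c i a z : partial_u i a z = assemble c z 0 0 (delta_mx i a).
Proof. by rewrite /assemble nl_term0 subr0. Qed.

Lemma co_uE c i a X z : co_u Gam c i a X z = ver c z (X z) i a.
Proof.
rewrite /co_u /ver /nl_term !mxE !summxE -addrA; congr (_ + (_ + _)).
  by apply: eq_bigr => e _; rewrite !mxE mulrC.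
by apply: eq_bigr => e _; rewrite !mxE mulrC.
Qed.

Definition dh (a : chart T) t (b : 'I_p) : 'M[R]_p := 'D_(delta_mx 0 b) (h a) t.

(** The connection matrix of the Levi-Civita connection of [h] along [w]. *)
Definition Tconn (a : chart T) t (w : 'rV[R]_p) : 'M[R]_p :=
  \sum_b w 0 b *: koszul_mx (h a t) (dh a t) b.

(** The connection matrix on the span of the [delta/delta x^i], along the temporal,
    spatial and vertical adapted directions.  The first is prescribed, the two
    others are forced by symmetry and metricity. *)
Definition Mconn_t c z (a : 'rV[R]_p) : 'M[R]_n :=
  2%:R^-1 *: ('D_(assemble c z a 0 0) (g c) z *m invmx (g c z)).
Definition Mconn_x c z (b : 'rV[R]_n) : 'M[R]_n :=
  \sum_k b 0 k *: koszul_mx (g c z) (fun l => 'D_(delta_x Gam c l z) (g c) z) k.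
Definition Mconn_u c z (w : 'M[R]_(n, p)) : 'M[R]_n :=
  \sum_k \sum_e w k e *: koszul_mx (g c z) (fun l => 'D_(eu l e) (g c) z) k.
Definition Mconn c z v : 'M[R]_n :=
  Mconn_t c z v.1.1 + Mconn_x c z v.1.2 + Mconn_u c z (ver c z v).

(** Each adapted component of [Y] is differentiated covariantly.  A vertical
    component has an upper spatial and a lower temporal index, hence the signs of
    the last line. *)
Definition cartan : connection_family T M := fun c X Y z =>
  let K := Tconn c.1 z.1.1 (X z).1.1 in
  let W := Mconn c z (X z) in
  assemble c z
    ('D_(X z) (fun y => (Y y).1.1) z + (Y z).1.1 *m K)
    ('D_(X z) (fun y => (Y y).1.2) z + (Y z).1.2 *m W)
    ('D_(X z) (fun y => ver c y (Y y)) z + W^T *m ver c z (Y z) - ver c z (Y z) *m K^T).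

Hypothesis hh : semi_riemannian h.
Hypothesis hg : dtensor02 g.
Hypothesis g_sym : forall c z, jdom c z -> (g c z)^T = g c z.
Hypothesis g_unit : forall c z, jdom c z -> g c z \in unitmx.
Hypothesis Msmooth : forall c e, smooth_on (jdom c) (fun z => Mmx c z e).
Hypothesis Nsmooth : forall c j, smooth_on (jdom c) (fun z => Nmx c z j).

Lemma h_smooth a : smooth_on (cimage a) (h a). Proof. by case: hh. Qed.
Lemma h_diff a t : cimage a t -> differentiable (h a) t.
Proof. by apply: smooth_differentiable; apply: h_smooth. Qed.
Lemma h_sym a t : cimage a t -> (h a t)^T = h a t.
Proof. by case: hh => _ _ H _ /H []. Qed.
Lemma h_unit a t : cimage a t -> h a t \in unitmx.
Proof. by case: hh => _ _ H _ /H []. Qed.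
Lemma g_smooth c : smooth_on (jdom c) (g c). Proof. by case: hg. Qed.
Lemma g_diff c z : jdom c z -> differentiable (g c) z.
Proof. by apply: smooth_differentiable; apply: g_smooth. Qed.

Lemma derive_sym_mx (W : normedModType R) m (F : W -> 'M[R]_m) (U : set W) (x v : W) :
  open U -> U x -> smooth_on U F -> (forall y, U y -> (F y)^T = F y) ->
  ('D_v F x)^T = 'D_v F x.
Proof.
move=> oU Ux sF sym; rewrite -derive_trmx; last exact: smooth_differentiable Ux.
by apply: open_derive_eq Ux => // y; rewrite inE => /sym.
Qed.

Lemma dh_sym a t b : cimage a t -> (dh a t b)^T = dh a t b.
Proof.
move=> at_; apply: derive_sym_mx at_ _ _; [exact: cimage_open|exact: h_smooth|].
by move=> y; apply: h_sym.
Qed.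

Lemma dg_sym c z v : jdom c z -> ('D_v (g c) z)^T = 'D_v (g c) z.
Proof.
move=> zc; apply: derive_sym_mx zc _ _; [exact: jdom_open|exact: g_smooth|].
by move=> y; apply: g_sym.
Qed.

Lemma christoffelE a t e a1 a2 : cimage a t ->
  christoffel h a t e a1 a2 = koszul_mx (h a t) (dh a t) a2 a1 e.
Proof.
move=> at_; rewrite mxE /christoffel /koszul; apply: eq_bigr => m _.
have dE b i j : dh a t b i j = 'D_(delta_mx 0 b) (fun y => h a y i j) t.
  exact: derive_coord (h_diff at_).
by rewrite !dE.
Qed.

Section Smoothness.
Variables (c : jchart T M) (U : set V).
Hypotheses (oU : open U) (Ud : U `<=` jdom c).

Let subU (W : normedModType R) (F : V -> W) : smooth_on (jdom c) F -> smooth_on U F.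
Proof. exact: smooth_subset. Qed.

Lemma nl_term_smooth a b : smooth_on U a -> smooth_on U b ->
  smooth_on U (fun z => nl_term c z (a z) (b z)).
Proof.
move=> sa sb; apply: smoothD => //; apply: smooth_sum => // i _;
  by apply: smooth_scalemx => //; [apply: smooth_coord|apply: subU].
Qed.

Lemma ver_smooth X : smooth_on U X -> smooth_on U (fun z => ver c z (X z)).
Proof.
move=> sX; apply: smoothD => //; first exact: smooth_ucomp.
by apply: nl_term_smooth; [apply: smooth_tcomp|apply: smooth_xcomp].
Qed.

Lemma smoothB (W : normedModType R) (F G : V -> W) :
  smooth_on U F -> smooth_on U G -> smooth_on U (fun z => F z - G z).
Proof.
move=> sF sG; apply: smoothD => //.
apply: (@smooth_linear_post _ _ W _ U G -%R) => //.
  by move=> k x y; rewrite opprD scalerN.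
by move=> x; apply: opp_continuous.
Qed.

Lemma assemble_smooth a b w : smooth_on U a -> smooth_on U b -> smooth_on U w ->
  smooth_on U (fun z => assemble c z (a z) (b z) (w z)).
Proof.
move=> sa sb sw; apply: smooth_field => //; apply: smoothB => //.
exact: nl_term_smooth.
Qed.

Lemma Tconn_smooth a : smooth_on U a -> smooth_on U (fun z => Tconn c.1 z.1.1 (a z)).
Proof.
move=> sa; apply: smooth_sum => // b _; apply: smooth_scalemx => //.
  exact: smooth_coord.
have s1 : smooth_on (cimage c.1) (fun t => koszul_mx (h c.1 t) (dh c.1 t) b).
  apply: smooth_koszul_mx; [exact: cimage_open|exact: h_unit|exact: h_smooth|].
  by move=> l; apply/smooth_derive/h_smooth.
have := smooth_linear_pre (@tproj_linear R p n) (@tproj_continuous R p n) s1.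
by apply: smooth_subset => z /Ud [].
Qed.

Lemma Mconn_smooth X : smooth_on U X -> smooth_on U (fun z => Mconn c z (X z)).
Proof.
move=> sX.
have sg : smooth_on U (g c) by apply/subU/g_smooth.
have ug z : U z -> g c z \in unitmx by move=> /Ud; apply: g_unit.
have sv := ver_smooth sX.
apply: smoothD => //; first apply: smoothD => //.
- have s2 : smooth_on U (fun z => 'D_(assemble c z (X z).1.1 0 0) (g c) z *m invmx (g c z)).
    apply: smooth_mulmx => //; last exact: smooth_invmx.
    apply: smooth_derive_field => //.
    apply: assemble_smooth; [exact: smooth_tcomp|exact: smooth_cst|exact: smooth_cst].
  by apply: smooth_scalemx s2 => //; exact: smooth_cst.
- apply: smooth_sum => // k _; apply: smooth_scalemx => //.
    by apply: smooth_coord => //; apply: smooth_xcomp.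
  apply: smooth_koszul_mx => // l; apply: smooth_derive_field => //.
  have -> : delta_x Gam c l = (fun z => assemble c z 0 (delta_mx 0 l) 0).
    by apply/funext => z; rewrite delta_xE.
  by apply: assemble_smooth; apply: smooth_cst.
apply: smooth_sum => // k _; apply: smooth_sum => // e _.
apply: smooth_scalemx => //; first exact: smooth_coord.
by apply: smooth_koszul_mx => // l; apply: smooth_derive.
Qed.

Lemma cartan_smooth X Y : smooth_on U X -> smooth_on U Y ->
  smooth_on U (cartan c X Y).
Proof.
move=> sX sY.
have sK : smooth_on U (fun z => Tconn c.1 z.1.1 (X z).1.1).
  by apply: Tconn_smooth; apply: smooth_tcomp.
have sW := Mconn_smooth sX.
have sv := ver_smooth sY.
have st : smooth_on U (fun y => (Y y).1.1) by apply: smooth_tcomp.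
have sx : smooth_on U (fun y => (Y y).1.2) by apply: smooth_xcomp.
apply: assemble_smooth.
- apply: smoothD => //; first exact: smooth_derive_field.
  exact: smooth_mulmx.
- apply: smoothD => //; first exact: smooth_derive_field.
  exact: smooth_mulmx.
apply: smoothB; last by apply: smooth_mulmx => //; apply: smooth_trmx.
apply: smoothD => //; first exact: smooth_derive_field.
by apply: smooth_mulmx => //; apply: smooth_trmx.
Qed.

End Smoothness.

End Geometry.

(** * Covariant derivatives in adapted components *)

Section DeriveScale.
Context {R : realType} {V : normedModType R}.

Lemma derive_scalemx k l (f : V -> R) (F : V -> 'M[R]_(k, l)) (x v : V) :
  differentiable f x -> differentiable F x ->
  'D_v (fun y => f y *: F y) x = 'D_v f x *: F x + f x *: 'D_v F x.
Proof.
move=> df dF.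
have E i j : (fun y => (f y *: F y) i j) = f * (fun y => F y i j).
  by apply/funext => y; rewrite mxE.
have d : differentiable (fun y => f y *: F y) x.
  apply: differentiable_mx => i j; rewrite E; apply: differentiableM => //.
  exact: differentiable_entry.
apply/matrixP => i j; rewrite (derive_coord v i j d) E deriveM; last 2 first.
- exact: diff_derivable.
- by apply/diff_derivable/differentiable_entry.
have := derive_coord v i j dF; move: ('D_v F x) => P <-.
rewrite [RHS]mxE [X in _ = X + _]mxE [X in _ = _ + X]mxE addrC.
congr (_ + _); exact: mulrC.
Qed.

End DeriveScale.

Section Cartan.
Context {R : realType} {p n : nat}.
Context {T : smooth_manifold R p} {M : smooth_manifold R n}.
Local Notation V := (jcoord R p n).
Variables (h : metric_family T) (g : dtensor_family T M) (Gam : nonlinear_coefs T M).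
Implicit Types (c : jchart T M) (z v : V) (X Y : V -> V) (U : set V).
Local Notation ver := (ver Gam).
Local Notation assemble := (assemble Gam).
Local Notation Tconn := (Tconn h).
Local Notation Mconn_t := (Mconn_t g Gam).
Local Notation Mconn_x := (Mconn_x g Gam).
Local Notation Mconn_u := (@Mconn_u R p n T M g).
Local Notation Mconn := (Mconn g Gam).
Local Notation cartan := (cartan h g Gam).

Hypothesis hh : semi_riemannian h.
Hypothesis hg : dtensor02 g.
Hypothesis g_sym : forall c z, jdom c z -> (g c z)^T = g c z.
Hypothesis g_unit : forall c z, jdom c z -> g c z \in unitmx.
Hypothesis Msmooth : forall c e, smooth_on (jdom c) (fun z => Mmx Gam c z e).
Hypothesis Nsmooth : forall c j, smooth_on (jdom c) (fun z => Nmx Gam c z j).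

Lemma Tconn_linear a t : linear (Tconn a t).
Proof.
move=> k v w; rewrite /Tconn scaler_sumr -big_split /=; apply: eq_bigr => b _.
by rewrite !mxE scalerDl scalerA.
Qed.

Lemma Mconn_linear c z : jdom c z -> linear (Mconn c z).
Proof.
move=> zc k v w; rewrite /Mconn verD verZ.
rewrite -[(k *: v + w).1.1]/(k *: v.1.1 + w.1.1).
rewrite -[(k *: v + w).1.2]/(k *: v.1.2 + w.1.2).
have Et : Mconn_t c z (k *: v.1.1 + w.1.1) = k *: Mconn_t c z v.1.1 + Mconn_t c z w.1.1.
  rewrite /Mconn_t.
  have -> : assemble c z (k *: v.1.1 + w.1.1) 0 0
      = k *: assemble c z v.1.1 0 0 + assemble c z w.1.1 0 0.
    by rewrite -assembleZ -assembleD !scaler0 !addr0.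
  have dg := g_diff hg zc.
  rewrite (derive_dirD _ _ dg) (derive_dirZ _ _ dg) mulmxDl scalerDr.
  by rewrite -scalemxAl !scalerA mulrC.
have Ex : Mconn_x c z (k *: v.1.2 + w.1.2) = k *: Mconn_x c z v.1.2 + Mconn_x c z w.1.2.
  rewrite /Mconn_x scaler_sumr -big_split /=; apply: eq_bigr => b _.
  move: (koszul_mx _ _ _) => P.
  by rewrite !mxE scalerDl scalerA.
have Eu (a b : 'M[R]_(n, p)) : Mconn_u c z (k *: a + b) = k *: Mconn_u c z a + Mconn_u c z b.
  rewrite /Mconn_u scaler_sumr -big_split /=; apply: eq_bigr => i _.
  rewrite scaler_sumr -big_split /=; apply: eq_bigr => e _.
  move: (koszul_mx _ _ _) => P.
  by rewrite !mxE scalerDl scalerA.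
rewrite Et Ex Eu !scalerDr [X in X + _ = _]addrACA [LHS]addrACA.
by [].
Qed.

Lemma TconnD a t : {morph Tconn a t : v w / v + w}.
Proof. by move=> v w; have := Tconn_linear a t 1 v w; rewrite !scale1r. Qed.
Lemma Tconn0 a t : Tconn a t 0 = 0.
Proof. by rewrite -[0](subrr 0) -scaleN1r addrC Tconn_linear scaleN1r addNr. Qed.
Lemma TconnZ a t k (v : 'rV[R]_p) : Tconn a t (k *: v) = k *: Tconn a t v.
Proof. by rewrite -[k *: v]addr0 Tconn_linear Tconn0 addr0. Qed.
Lemma MconnD c z : jdom c z -> {morph Mconn c z : v w / v + w}.
Proof. by move=> zc v w; have := Mconn_linear zc 1 v w; rewrite !scale1r. Qed.
Lemma Mconn0 c z : jdom c z -> Mconn c z 0 = 0.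
Proof.
by move=> zc; rewrite -[0](subrr 0) -scaleN1r addrC (Mconn_linear zc) scaleN1r addNr.
Qed.
Lemma MconnZ c z k v : jdom c z -> Mconn c z (k *: v) = k *: Mconn c z v.
Proof. by move=> zc; rewrite -[k *: v]addr0 (Mconn_linear zc) Mconn0 // addr0. Qed.

(** The adapted components are differentiated separately, so the three subbundles
    are preserved. *)
Lemma cartan_assemble c X a b w z :
  cartan c X (fun y => assemble c y (a y) (b y) (w y)) z =
  assemble c z
    ('D_(X z) a z + a z *m Tconn c.1 z.1.1 (X z).1.1)
    ('D_(X z) b z + b z *m Mconn c z (X z))
    ('D_(X z) w z + (Mconn c z (X z))^T *m w z
       - w z *m (Tconn c.1 z.1.1 (X z).1.1)^T).
Proof.
rewrite /cartan ver_assemble.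
have -> // : (fun y => ver c y (assemble c y (a y) (b y) (w y))) = w.
by apply/funext => y; rewrite ver_assemble.
Qed.

Lemma assemble_t_sum c z (a : 'rV[R]_p) :
  \sum_e a 0 e *: delta_t Gam c e z = assemble c z a 0 0.
Proof.
rewrite [in RHS](row_sum_delta a).
rewrite (big_morph (fun a => assemble c z a 0 0) (id1 := 0) (op1 := +%R)); last 2 first.
- by move=> x y; rewrite -assembleD !addr0.
- by rewrite /assemble nl_term0 subr0.
by apply: eq_bigr => e _; rewrite delta_tE -assembleZ !scaler0.
Qed.

Lemma assemble_x_sum c z (b : 'rV[R]_n) :
  \sum_i b 0 i *: delta_x Gam c i z = assemble c z 0 b 0.
Proof.
rewrite [in RHS](row_sum_delta b).
rewrite (big_morph (fun b => assemble c z 0 b 0) (id1 := 0) (op1 := +%R)); last 2 first.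
- by move=> x y; rewrite -assembleD !addr0.
- by rewrite /assemble nl_term0 subr0.
by apply: eq_bigr => e _; rewrite delta_xE -assembleZ !scaler0.
Qed.

Lemma assemble_u_sum c z (w : 'M[R]_(n, p)) :
  \sum_i \sum_a w i a *: partial_u i a z = assemble c z 0 0 w.
Proof.
rewrite [in RHS](matrix_sum_delta w).
have fD x y : assemble c z 0 0 (x + y) = assemble c z 0 0 x + assemble c z 0 0 y.
  by rewrite -assembleD !addr0.
have f0 : assemble c z 0 0 0 = 0 by rewrite /assemble nl_term0 subr0.
rewrite (big_morph _ fD f0); apply: eq_bigr => i _.
rewrite (big_morph _ fD f0); apply: eq_bigr => a _.
by rewrite (partial_uE Gam c) -assembleZ !scaler0.
Qed.

Lemma proj_TE c Y z : proj_T Gam c Y z = assemble c z (Y z).1.1 0 0.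
Proof. exact: assemble_t_sum. Qed.

Lemma proj_ME c Y z : proj_M Gam c Y z = assemble c z 0 (Y z).1.2 0.
Proof. exact: assemble_x_sum. Qed.

Lemma proj_vE c Y z : proj_v Gam c Y z = assemble c z 0 0 (ver c z (Y z)).
Proof.
rewrite -assemble_u_sum; apply: eq_bigr => i _; apply: eq_bigr => a _.
by rewrite co_uE.
Qed.

Lemma JtensorE c X Y z : Jtensor h c X Y z =
  assemble c z 0 0 ((Y z).1.2^T *m (X z).1.1 *m (h c.1 z.1.1)^T).
Proof.
rewrite -assemble_u_sum; apply: eq_bigr => i _; apply: eq_bigr => a _.
rewrite -scaler_suml; congr (_ *: _); rewrite mxE; apply: eq_bigr => b _.
rewrite [X in _ = X * _]mxE big_ord1 [_^T i 0]mxE [_^T b a]mxE /co_t /co_x.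
by rewrite mulrC -mulrA [_ * h _ _ _ _]mulrC.
Qed.

(** The property of [h] on which the parallelism of [J] rests. *)
Lemma Tconn_metric a t w : cimage a t ->
  Tconn a t w *m h a t + h a t *m (Tconn a t w)^T = 'D_w (h a) t.
Proof.
move=> at_; rewrite [in RHS](row_sum_delta w) (derive_dir_sum _ _ _ (h_diff hh at_)).
rewrite /Tconn linear_sum mulmx_suml mulmx_sumr -big_split /=; apply: eq_bigr => b _.
rewrite linearZ /= -scalemxAl -scalemxAr -scalerDr koszul_metric.
- by rewrite (derive_dirZ _ _ (h_diff hh at_)).
- exact: h_sym.
- exact: h_unit.
- by move=> k; apply: dh_sym.
Qed.

Lemma cartan_Gamma c X Y z :
  [/\ cartan c X (proj_T Gam c Y) z - proj_T Gam c (cartan c X Y) z = 0,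
      cartan c X (proj_M Gam c Y) z - proj_M Gam c (cartan c X Y) z = 0
    & cartan c X (proj_v Gam c Y) z - proj_v Gam c (cartan c X Y) z = 0].
Proof.
have E1 : proj_T Gam c Y = (fun y => assemble c y (Y y).1.1 (cst 0 y) (cst 0 y)).
  by apply/funext => y; rewrite proj_TE.
have E2 : proj_M Gam c Y = (fun y => assemble c y (cst 0 y) (Y y).1.2 (cst 0 y)).
  by apply/funext => y; rewrite proj_ME.
have E3 : proj_v Gam c Y = (fun y => assemble c y (cst 0 y) (cst 0 y) (ver c y (Y y))).
  by apply/funext => y; rewrite proj_vE.
split; apply/eqP; rewrite subr_eq0; apply/eqP.
- rewrite E1 (cartan_assemble c X (fun y => (Y y).1.1)) proj_TE.
  by rewrite !derive_cst /= !mul0mx !mulmx0 subr0 !addr0.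
- rewrite E2 (cartan_assemble c X _ (fun y => (Y y).1.2)) proj_ME.
  by rewrite !derive_cst /= !mul0mx !mulmx0 subr0 !addr0.
rewrite E3 (cartan_assemble c X _ _ (fun y => ver c y (Y y))) proj_vE.
by rewrite !derive_cst /= !mul0mx !addr0 ver_assemble.
Qed.

End Cartan.

(** * The connection is linear, h-normal and metrical *)

Section CartanProps.
Context {R : realType} {p n : nat}.
Context {T : smooth_manifold R p} {M : smooth_manifold R n}.
Local Notation V := (jcoord R p n).
Variables (h : metric_family T) (g : dtensor_family T M) (Gam : nonlinear_coefs T M).
Implicit Types (c : jchart T M) (z v : V) (X Y : V -> V) (U : set V).
Local Notation ver := (ver Gam).
Local Notation assemble := (assemble Gam).
Local Notation Tconn := (Tconn h).
Local Notation Mconn_t := (Mconn_t g Gam).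
Local Notation Mconn_x := (Mconn_x g Gam).
Local Notation Mconn_u := (@Mconn_u R p n T M g).
Local Notation Mconn := (Mconn g Gam).
Local Notation cartan := (cartan h g Gam).

Hypothesis hh : semi_riemannian h.
Hypothesis hg : dtensor02 g.
Hypothesis g_sym : forall c z, jdom c z -> (g c z)^T = g c z.
Hypothesis g_unit : forall c z, jdom c z -> g c z \in unitmx.
Hypothesis Msmooth : forall c e, smooth_on (jdom c) (fun z => Mmx Gam c z e).
Hypothesis Nsmooth : forall c j, smooth_on (jdom c) (fun z => Nmx Gam c z j).

Lemma cartan_linear c U X Y : local_domain c U ->
  smooth_on U X -> smooth_on U Y ->
     [/\ smooth_on U (cartan c X Y),
         forall X' Y' : V -> V, {in U, X =1 X'} -> {in U, Y =1 Y'} ->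
           {in U, cartan c X Y =1 cartan c X' Y'},
         forall X' : V -> V, smooth_on U X' ->
           {in U, cartan c (X \+ X') Y =1 cartan c X Y \+ cartan c X' Y},
         forall Y' : V -> V, smooth_on U Y' ->
           {in U, cartan c X (Y \+ Y') =1 cartan c X Y \+ cartan c X Y'}
       & forall f : V -> R, smooth_on U f ->
           {in U, cartan c (fun z => f z *: X z) Y
                  =1 (fun z => f z *: cartan c X Y z)} /\
           {in U, cartan c X (fun z => f z *: Y z)
                  =1 (fun z => 'D_(X z) f z *: Y z + f z *: cartan c X Y z)}].
Proof.
move=> [oU Ud] sX sY.
have dt (Z : V -> V) z : smooth_on U Z -> U z -> differentiable (fun y => (Z y).1.1) z.
  by move=> sZ; apply: smooth_differentiable; apply: smooth_tcomp.
have dx (Z : V -> V) z : smooth_on U Z -> U z -> differentiable (fun y => (Z y).1.2) z.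
  by move=> sZ; apply: smooth_differentiable; apply: smooth_xcomp.
have dv (Z : V -> V) z : smooth_on U Z -> U z -> differentiable (fun y => ver c y (Z y)) z.
  by move=> sZ; apply: smooth_differentiable; apply: (ver_smooth Msmooth Nsmooth oU Ud).
split.
- exact: (cartan_smooth hh hg g_unit Msmooth Nsmooth oU Ud).
- move=> X' Y' EX EY z zU; have Uz : U z by move: zU; rewrite inE.
  have ED (W : normedModType R) (F : V -> V -> W) :
      'D_(X z) (fun y => F y (Y y)) z = 'D_(X' z) (fun y => F y (Y' y)) z.
    rewrite (EX z zU); apply: open_derive_eq oU _ Uz => y yU; by rewrite EY.
  by rewrite /cartan (ED _ (fun y v => v.1.1)) (ED _ (fun y v => v.1.2))
    (ED _ (fun y v => ver c y v)) (EX z zU) (EY z zU).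
- move=> X' sX' z; rewrite inE => Uz; have zc := Ud _ Uz.
  rewrite /= /cartan (MconnD Gam hg zc) TconnD -assembleD.
  rewrite !derive_dirD; [|by auto..].
  move: (Mconn c z (X z)) (Mconn c z (X' z)) (Tconn _ _ (X z).1.1) => W W' K.
  move: (Tconn _ _ (X' z).1.1) (ver c z (Y z)) => K' y.
  rewrite !linearD /= !(mulmxDr, mulmxDl) ?opprD.
  congr (assemble _ _ _ _ _); [by rewrite addrACA|by rewrite addrACA|].
  by rewrite [X in X + _ = _]addrACA [LHS]addrACA.
- move=> Y' sY' z; rewrite inE => Uz; have zc := Ud _ Uz.
  have -> : Y \+ Y' = (fun y => assemble c y ((Y y).1.1 + (Y' y).1.1)
      ((Y y).1.2 + (Y' y).1.2) (ver c y (Y y) + ver c y (Y' y))).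
    by apply/funext => y; rewrite assembleD !assemble_ver.
  rewrite (cartan_assemble h g Gam c X (fun y => _ + _) (fun y => _ + _) (fun y => _ + _)).
  rewrite [RHS]/= /cartan -assembleD.
  have DD k l (F G : V -> 'M[R]_(k, l)) : differentiable F z -> differentiable G z ->
      'D_(X z) (fun y => F y + G y) z = 'D_(X z) F z + 'D_(X z) G z.
    by move=> dF dG; apply: deriveD; apply: diff_derivable.
  rewrite (DD _ _ _ _ (dt Y z sY Uz) (dt Y' z sY' Uz)).
  rewrite (DD _ _ _ _ (dx Y z sY Uz) (dx Y' z sY' Uz)).
  rewrite (DD _ _ _ _ (dv Y z sY Uz) (dv Y' z sY' Uz)).
  move: (Mconn c z (X z)) (Tconn _ _ (X z).1.1) (ver c z (Y z)) (ver c z (Y' z)).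
  move=> W K y y'.
  rewrite !(mulmxDr, mulmxDl, opprD).
  congr (assemble _ _ _ _ _); [by rewrite addrACA|by rewrite addrACA|].
  by rewrite [X in X + _ = _]addrACA [LHS]addrACA.
move=> f sf; split=> z; rewrite inE => Uz; have zc := Ud _ Uz.
  rewrite /= /cartan (MconnZ Gam hg _ _ zc) TconnZ -assembleZ.
  rewrite !derive_dirZ; [|by auto..].
  move: (Mconn c z (X z)) (Tconn _ _ (X z).1.1) (ver c z (Y z)) => W K y.
  by rewrite !linearZ /= -!scalemxAl -?scalerN -!scalerDr.
have df : differentiable f z by apply: smooth_differentiable Uz.
have -> : (fun y => f y *: Y y) = (fun y => assemble c y (f y *: (Y y).1.1)
      (f y *: (Y y).1.2) (f y *: ver c y (Y y))).
  by apply/funext => y; rewrite assembleZ assemble_ver.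
rewrite (cartan_assemble h g Gam c X (fun y => _ *: _) (fun y => _ *: _) (fun y => _ *: _)).
rewrite (derive_scalemx (X z) df (dt Y z sY Uz)).
rewrite (derive_scalemx (X z) df (dx Y z sY Uz)).
rewrite (derive_scalemx (X z) df (dv Y z sY Uz)).
rewrite -[X in _ = _ *: X + _](assemble_ver Gam c z (Y z)).
rewrite /cartan -!assembleZ -assembleD.
move: (Mconn c z (X z)) (Tconn _ _ (X z).1.1) (ver c z (Y z)) => W K y.
by rewrite -!scalemxAl -!scalemxAr !scalerDr scalerN !addrA.
Qed.

Lemma cartan_Gcoef c z k i e : jdom c z ->
  Gcoef Gam cartan c z k i e =
  \sum_(l < n) invmx (g c z) k l / 2%:R *
      'D_(delta_t Gam c e z) (fun w => g c w l i) z.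
Proof.
move=> zc; rewrite /Gcoef /co_x.
have -> : delta_x Gam c i = (fun y => assemble c y (cst 0 y) (cst (delta_mx 0 i) y) (cst 0 y)).
  by apply/funext => y; rewrite delta_xE.
rewrite (cartan_assemble h g Gam c _ (cst 0) (cst (delta_mx 0 i)) (cst 0)).
rewrite [LHS]/= derive_cst add0r /= delta_tE /Mconn ver_assemble /=.
have -> : Mconn_x c z 0 = 0.
  by rewrite /Mconn_x big1 // => l _; rewrite (mxE _ _ 0 l) scale0r.
have -> : Mconn_u c z 0 = 0.
  rewrite /Mconn_u big1 // => l _; rewrite big1 // => a _.
  by rewrite (mxE _ _ l a) scale0r.
have gs : (invmx (g c z))^T = invmx (g c z) by apply: invmx_sym; apply: g_sym.
rewrite !addr0 -rowE /Mconn_t.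
have Dg l : 'D_(assemble c z (delta_mx 0 e) 0 0) (fun w => g c w l i) z
   = ('D_(assemble c z (delta_mx 0 e) 0 0) (g c) z) l i.
  by apply: esym; apply: derive_coord; apply: (g_diff hg).
under [RHS]eq_bigr do rewrite Dg.
have Ds := dg_sym hg g_sym (assemble c z (delta_mx 0 e) 0 0) zc.
move: ('D_(assemble _ _ _ _ _) _ _) Ds => D Ds.
move: (invmx (g c z)) gs => I gs.
rewrite !mxE mulr_sumr; apply: eq_bigr => l _.
by rewrite -[in RHS]gs -[in RHS]Ds !mxE; ring.
Qed.

Lemma cartan_Lcoef c z k i j : jdom c z ->
  Lcoef Gam cartan c z k i j =
  koszul_mx (g c z) (fun l => 'D_(delta_x Gam c l z) (g c) z) j i k.
Proof.
move=> zc; rewrite /Lcoef /co_x.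
have -> : delta_x Gam c i = (fun y => assemble c y (cst 0 y) (cst (delta_mx 0 i) y) (cst 0 y)).
  by apply/funext => y; rewrite delta_xE.
rewrite (cartan_assemble h g Gam c _ (cst 0) (cst (delta_mx 0 i)) (cst 0)).
rewrite [LHS]/= derive_cst add0r /= delta_xE /Mconn ver_assemble /=.
have -> : Mconn_t c z 0 = 0.
  have -> : Mconn_t c z 0 = 2%:R^-1 *: ('D_(assemble c z 0 0 0) (g c) z *m invmx (g c z)) by [].
  have -> : assemble c z 0 0 0 = 0 by rewrite /assemble nl_term0 subr0.
  by rewrite derive0 mul0mx scaler0.
have -> : Mconn_u c z 0 = 0.
  rewrite /Mconn_u big1 // => l _; rewrite big1 // => a _.
  by rewrite (mxE _ _ l a) scale0r.
rewrite add0r addr0 -rowE /Mconn_x.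
move: (koszul_mx _ _) => K.
rewrite (bigD1 j) //= big1 => [|l lj]; last by rewrite [_ 0 l]mxE (negbTE lj) andbF scale0r.
by rewrite [delta_mx _ _ _ _]mxE !eqxx scale1r addr0 [LHS]mxE.
Qed.

Lemma cartan_Ccoef c z k i j e : jdom c z ->
  Ccoef Gam cartan c z k i j e =
  koszul_mx (g c z) (fun l => 'D_(eu l e) (g c) z) j i k.
Proof.
move=> zc; rewrite /Ccoef /co_x.
have -> : delta_x Gam c i = (fun y => assemble c y (cst 0 y) (cst (delta_mx 0 i) y) (cst 0 y)).
  by apply/funext => y; rewrite delta_xE.
rewrite (cartan_assemble h g Gam c _ (cst 0) (cst (delta_mx 0 i)) (cst 0)).
rewrite [LHS]/= derive_cst add0r /= (partial_uE Gam c) /Mconn ver_assemble /=.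
have -> : Mconn_t c z 0 = 0.
  have -> : Mconn_t c z 0 = 2%:R^-1 *: ('D_(assemble c z 0 0 0) (g c) z *m invmx (g c z)) by [].
  have -> : assemble c z 0 0 0 = 0 by rewrite /assemble nl_term0 subr0.
  by rewrite derive0 mul0mx scaler0.
have -> : Mconn_x c z 0 = 0.
  by rewrite /Mconn_x big1 // => l _; rewrite (mxE _ _ 0 l) scale0r.
rewrite !add0r -rowE /Mconn_u (bigD1 j) //= [X in _ + X]big1 => [|l lj]; last first.
  by rewrite big1 // => a _; rewrite [delta_mx _ _ _ _]mxE (negbTE lj) scale0r.
rewrite (bigD1 e) //= [X in _ + X + _]big1 => [|a ae]; last first.
  by rewrite [delta_mx _ _ _ _]mxE (negbTE ae) andbF scale0r.
by rewrite [delta_mx _ _ _ _]mxE !eqxx scale1r !addr0 [LHS]mxE.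
Qed.

(** The coefficients [L] and [C] of [cartan] are Koszul coefficients for the
    derivatives of [g] along the spatial and vertical adapted directions. *)
Lemma cartan_metrical : metrical_properties Gam g cartan.
Proof.
move=> c z zc.
have gs := g_sym zc; have gu := g_unit zc; have gd := g_diff hg zc.
have Ds v : ('D_v (g c) z)^T = 'D_v (g c) z by apply: (dg_sym hg g_sym).
have metric (D : 'I_n -> 'M[R]_n) i j k : (forall l, (D l)^T = D l) ->
    D k i j - \sum_(m < n) g c z m j * koszul_mx (g c z) D k i m
     - \sum_(m < n) g c z i m * koszul_mx (g c z) D k j m = 0.
  move=> sD; have /matrixP /(_ i j) := koszul_metric k gs gu sD.
  rewrite [LHS]mxE => <-; move: (koszul_mx _ _ _) => K.
  rewrite mxE [X in _ + X - _ - _]mxE -addrA -opprD; apply/eqP; rewrite subr_eq0; apply/eqP.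
  congr (_ + _); apply: eq_bigr => m _; first by rewrite mulrC.
  by rewrite [K^T _ _]mxE.
split.
- split=> [i j k|i j k e].
    rewrite /cov_M -(derive_coord _ _ _ gd).
    under eq_bigr do rewrite cartan_Lcoef //.
    under [X in _ - X]eq_bigr do rewrite cartan_Lcoef //.
    by apply: (metric (fun l => 'D_(delta_x Gam c l z) (g c) z)).
  rewrite /cov_v -(derive_coord _ _ _ gd).
  under eq_bigr do rewrite cartan_Ccoef //.
  under [X in _ - X]eq_bigr do rewrite cartan_Ccoef //.
  by apply: (metric (fun l => 'D_(eu l e) (g c) z)).
- by move=> k j e; rewrite cartan_Gcoef.
- by move=> k i j; rewrite !cartan_Lcoef // [LHS]mxE [RHS]mxE koszul_sym.
by move=> i j k e; rewrite !cartan_Ccoef // [LHS]mxE [RHS]mxE koszul_sym.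
Qed.

Lemma cartan_delta_t c z X a b :
  co_t a (cartan c X (delta_t Gam c b)) z = Tconn c.1 z.1.1 (X z).1.1 b a.
Proof.
rewrite /co_t.
have -> : delta_t Gam c b = (fun y => assemble c y (cst (delta_mx 0 b) y) (cst 0 y) (cst 0 y)).
  by apply/funext => y; rewrite delta_tE.
rewrite (cartan_assemble h g Gam c _ (cst (delta_mx 0 b)) (cst 0) (cst 0)).
by rewrite [LHS]/= derive_cst add0r /= -rowE [LHS]mxE.
Qed.

(** In adapted components [J (X, Y)] is a product of a component of [Y], a component
    of [X] and [h].  By the product rule the claim reduces to the parallelism
    of [h]. *)
Lemma cartan_J c U X Y Z : local_domain c U ->
  smooth_on U X -> smooth_on U Y -> forall z : V, U z ->
  cartan c Z (Jtensor h c X Y) z - Jtensor h c (cartan c Z X) Y z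
     - Jtensor h c X (cartan c Z Y) z = 0.
Proof.
move=> [oU Ud] sX sY z Uz; have zc := Ud _ Uz.
have zt : cimage c.1 z.1.1 by case: zc.
have -> : Jtensor h c X Y = (fun y => assemble c y (cst 0 y) (cst 0 y)
    ((Y y).1.2^T *m (X y).1.1 *m (h c.1 y.1.1)^T)).
  by apply/funext => y; rewrite (JtensorE h Gam).
rewrite (cartan_assemble h g Gam c Z (cst 0) (cst 0) (fun y => _ *m _)).
rewrite !(JtensorE h Gam) !derive_cst !mul0mx !addr0.
have dYx : differentiable (fun y => (Y y).1.2) z.
  by apply: smooth_differentiable Uz; apply: smooth_xcomp.
have dXt : differentiable (fun y => (X y).1.1) z.
  by apply: smooth_differentiable Uz; apply: smooth_tcomp.
have [dH DH] := derive_base (Z z) (@tproj_linear R p n) (@tproj_continuous R p n)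
  (h_diff hh zt).
have [d1 D1] := derive_mulmx (Z z) (differentiable_trmx dYx) dXt.
have [d2 D2] := derive_mulmx (Z z) d1 (differentiable_trmx dH).
rewrite D2 D1 !derive_trmx // DH -(Tconn_metric hh _ zt).
rewrite /cartan /=.
have hs := h_sym hh zt.
move: ('D_(Z z) _ z) => Dx; move: ('D_(Z z) _ z) => Dt.
move: (Tconn _ _ _) (Mconn _ _ _) (h c.1 z.1.1) hs => K W H hs.
move: (X z).1.1 (Y z).1.2 => x y.
apply/eqP; rewrite -addrA -opprD subr_eq0 -assembleD !addr0; apply/eqP.
congr (assemble _ _ _ _ _).
rewrite !(linearD, trmx_mul, trmxK) /= !trmx_mul trmxK hs.
rewrite !(mulmxDl, mulmxDr) !mulmxA.
move: (Dx^T *m x *m H) (y^T *m Dt *m H) (y^T *m x *m H *m K^T) => e1 e2 e3.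
move: (y^T *m x *m K *m H) (W^T *m y^T *m x *m H) => e4 e5.
by apply/matrixP => i j; rewrite !mxE; ring.
Qed.

Lemma cartan_h_normal_local c z : jdom c z ->
  [/\ forall a b e, Gbar Gam cartan c z a b e = christoffel h c.1 z.1.1 a b e,
      forall a b j, Lbar Gam cartan c z a b j = 0
    & forall a b j e, Cbar Gam cartan c z a b j e = 0].
Proof.
move=> zc; have zt : cimage c.1 z.1.1 by case: zc.
split=> [a b e|a b j|a b j e].
- rewrite /Gbar cartan_delta_t /= (christoffelE hh) // /Tconn.
  move: (koszul_mx _ _) => K.
  rewrite (bigD1 e) //= big1 => [|l lj]; last by rewrite [_ 0 l]mxE (negbTE lj) andbF scale0r.
  by rewrite [delta_mx _ _ _ _]mxE !eqxx scale1r addr0.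
- by rewrite /Lbar cartan_delta_t /= Tconn0 mxE.
by rewrite /Cbar cartan_delta_t /= Tconn0 mxE.
Qed.

End CartanProps.

(** * Uniqueness *)

Section CartanUnique.
Context {R : realType} {p n : nat}.
Context {T : smooth_manifold R p} {M : smooth_manifold R n}.
Local Notation V := (jcoord R p n).
Variables (h : metric_family T) (g : dtensor_family T M) (Gam : nonlinear_coefs T M).
Implicit Types (c : jchart T M) (z v : V) (X Y : V -> V) (U : set V).
Local Notation ver := (ver Gam).
Local Notation assemble := (assemble Gam).
Local Notation Tconn := (Tconn h).
Local Notation Mconn_t := (Mconn_t g Gam).
Local Notation Mconn_x := (Mconn_x g Gam).
Local Notation Mconn_u := (@Mconn_u R p n T M g).
Local Notation Mconn := (Mconn g Gam).
Local Notation cartan := (cartan h g Gam).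

Hypothesis hh : semi_riemannian h.
Hypothesis hg : dtensor02 g.
Hypothesis g_sym : forall c z, jdom c z -> (g c z)^T = g c z.
Hypothesis g_unit : forall c z, jdom c z -> g c z \in unitmx.
Hypothesis Msmooth : forall c e, smooth_on (jdom c) (fun z => Mmx Gam c z e).
Hypothesis Nsmooth : forall c j, smooth_on (jdom c) (fun z => Nmx Gam c z j).

Section Local.
Variables (nabla : connection_family T M) (c : jchart T M) (U : set V).
Hypothesis nh : h_normal Gam h nabla.
Hypothesis nm : metrical_properties Gam g nabla.
Hypothesis Uc : local_domain c U.

Let oU : open U. Proof. by case: Uc. Qed.
Let Ud : U `<=` jdom c. Proof. by case: Uc. Qed.

Lemma nabla_local X Y : smooth_on U X -> smooth_on U Y ->
     [/\ smooth_on U (nabla c X Y),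
         forall X' Y' : V -> V, {in U, X =1 X'} -> {in U, Y =1 Y'} ->
           {in U, nabla c X Y =1 nabla c X' Y'},
         forall X' : V -> V, smooth_on U X' ->
           {in U, nabla c (X \+ X') Y =1 nabla c X Y \+ nabla c X' Y},
         forall Y' : V -> V, smooth_on U Y' ->
           {in U, nabla c X (Y \+ Y') =1 nabla c X Y \+ nabla c X Y'}
       & forall f : V -> R, smooth_on U f ->
           {in U, nabla c (fun z => f z *: X z) Y
                  =1 (fun z => f z *: nabla c X Y z)} /\
           {in U, nabla c X (fun z => f z *: Y z)
                  =1 (fun z => 'D_(X z) f z *: Y z + f z *: nabla c X Y z)}].
Proof. by case: nh => -[[H _] _] _ _ _ _; apply: H. Qed.

Lemma smooth0 (W : normedModType R) : smooth_on U (fun=> 0 : W).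
Proof. exact: smooth_cst. Qed.

Lemma smooth_scaleV (f : V -> R) X : smooth_on U f -> smooth_on U X ->
  smooth_on U (fun z => f z *: X z).
Proof.
move=> sf sX; apply: smooth_field => //.
- by apply: (@smooth_scalemx _ V _ _ _ f (fun z => (X z).1.1)) => //; apply: smooth_tcomp.
- by apply: (@smooth_scalemx _ V _ _ _ f (fun z => (X z).1.2)) => //; apply: smooth_xcomp.
by apply: (@smooth_scalemx _ V _ _ _ f (fun z => (X z).2)) => //; apply: smooth_ucomp.
Qed.

Lemma nabla0r X z : smooth_on U X -> U z -> nabla c X (fun=> 0) z = 0.
Proof.
move=> sX Uz; have [_ _ _ _ /(_ (fun=> 0) (smooth0 _))] := nabla_local sX (smooth0 V).
move=> [_ /(_ z)]; rewrite inE => /(_ Uz).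
by rewrite (_ : (fun z0 : V => _) = (fun=> 0)) ?scale0r ?addr0 ?scaler0 //;
   apply/funext => y; rewrite scaler0.
Qed.

Lemma nabla0l Y z : smooth_on U Y -> U z -> nabla c (fun=> 0) Y z = 0.
Proof.
move=> sY Uz; have [_ _ _ _ /(_ (fun=> 0) (smooth0 _))] := nabla_local (smooth0 V) sY.
move=> [/(_ z)]; rewrite inE => /(_ Uz).
by rewrite (_ : (fun z0 : V => _) = (fun=> 0)) ?scale0r //;
   apply/funext => y; rewrite scaler0.
Qed.

Lemma nabla_sum_r (I : Type) (r : seq I) (f : I -> V -> R) (F : I -> V -> V) X z :
  smooth_on U X -> (forall i, smooth_on U (f i)) -> (forall i, smooth_on U (F i)) -> U z ->
  nabla c X (fun y => \sum_(i <- r) f i y *: F i y) z =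
  \sum_(i <- r) ('D_(X z) (f i) z *: F i z + f i z *: nabla c X (F i) z).
Proof.
move=> sX sf sF Uz; elim: r => [|i r IH].
  rewrite big_nil -[RHS](nabla0r sX Uz); congr (nabla c X _ z).
  by apply/funext => y; rewrite big_nil.
rewrite big_cons -IH.
have -> : (fun y => \sum_(j <- i :: r) f j y *: F j y) =
    (fun y => f i y *: F i y) \+ (fun y => \sum_(j <- r) f j y *: F j y).
  by apply/funext => y; rewrite big_cons.
have s1 : smooth_on U (fun y => f i y *: F i y) by apply: smooth_scaleV.
have s2 : smooth_on U (fun y => \sum_(j <- r) f j y *: F j y).
  by apply: smooth_sum => // j _; apply: smooth_scaleV.
have [_ _ _ /(_ _ s2 z) H _] := nabla_local sX s1.
rewrite H ?inE //=; congr (_ + _).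
have [_ _ _ _ /(_ _ (sf i)) [_ /(_ z) H']] := nabla_local sX (sF i).
by rewrite H' ?inE.
Qed.

Lemma nabla_sum_l (I : Type) (r : seq I) (f : I -> V -> R) (F : I -> V -> V) Y z :
  smooth_on U Y -> (forall i, smooth_on U (f i)) -> (forall i, smooth_on U (F i)) -> U z ->
  nabla c (fun y => \sum_(i <- r) f i y *: F i y) Y z =
  \sum_(i <- r) f i z *: nabla c (F i) Y z.
Proof.
move=> sY sf sF Uz; elim: r => [|i r IH].
  rewrite big_nil -[RHS](nabla0l sY Uz); congr (nabla c _ Y z).
  by apply/funext => y; rewrite big_nil.
rewrite big_cons -IH.
have -> : (fun y => \sum_(j <- i :: r) f j y *: F j y) =
    (fun y => f i y *: F i y) \+ (fun y => \sum_(j <- r) f j y *: F j y).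
  by apply/funext => y; rewrite big_cons.
have s1 : smooth_on U (fun y => f i y *: F i y) by apply: smooth_scaleV.
have s2 : smooth_on U (fun y => \sum_(j <- r) f j y *: F j y).
  by apply: smooth_sum => // j _; apply: smooth_scaleV.
have [_ _ /(_ _ s2 z) H _ _] := nabla_local s1 sY.
rewrite H ?inE //=; congr (_ + _).
have [_ _ _ _ /(_ _ (sf i)) [/(_ z) H' _]] := nabla_local (sF i) sY.
by rewrite H' ?inE.
Qed.

Let sass := assemble_smooth Msmooth Nsmooth oU Ud.

Lemma delta_t_smooth b : smooth_on U (delta_t Gam c b).
Proof.
have -> : delta_t Gam c b = (fun y => assemble c y (delta_mx 0 b) 0 0).
  by apply/funext => y; rewrite delta_tE.
by apply: sass; apply: smooth_cst.
Qed.

Lemma delta_x_smooth i : smooth_on U (delta_x Gam c i).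
Proof.
have -> : delta_x Gam c i = (fun y => assemble c y 0 (delta_mx 0 i) 0).
  by apply/funext => y; rewrite delta_xE.
by apply: sass; apply: smooth_cst.
Qed.

Lemma partial_u_smooth i a : smooth_on U (partial_u i a : V -> V).
Proof. exact: smooth_cst. Qed.

(** Linearity over functions in the first argument: it is enough to know [nabla]
    along the adapted frame. *)
Lemma nabla_frame X Y z : smooth_on U X -> smooth_on U Y -> U z ->
  nabla c X Y z =
  \sum_e (X z).1.1 0 e *: nabla c (delta_t Gam c e) Y z
  + \sum_j (X z).1.2 0 j *: nabla c (delta_x Gam c j) Y z
  + \sum_j \sum_e (ver c z (X z)) j e *: nabla c (partial_u j e) Y z.
Proof.
move=> sX sY Uz.
pose X1 y := \sum_e (X y).1.1 0 e *: delta_t Gam c e y.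
pose X2 y := \sum_j (X y).1.2 0 j *: delta_x Gam c j y.
pose X3 y : V := \sum_je (ver c y (X y)) je.1 je.2 *: partial_u je.1 je.2 y.
have X3E y : X3 y = assemble c y 0 0 (ver c y (X y)).
  rewrite -assemble_u_sum /X3; rewrite [RHS]pair_bigA; exact: eq_bigr.
have EX : X = (X1 \+ (X2 \+ X3)).
  apply/funext => y; rewrite -[LHS](assemble_ver Gam c y) /= X3E.
  by rewrite /X1 /X2 assemble_t_sum assemble_x_sum -!assembleD !addr0 !add0r.
have sv := ver_smooth Msmooth Nsmooth oU Ud sX.
have st : forall e, smooth_on U (fun y => (X y).1.1 0 e : R).
  by move=> e; apply: smooth_coord => //; apply: smooth_tcomp.
have sx : forall e, smooth_on U (fun y => (X y).1.2 0 e : R).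
  by move=> e; apply: smooth_coord => //; apply: smooth_xcomp.
have su : forall je : 'I_n * 'I_p, smooth_on U (fun y => (ver c y (X y)) je.1 je.2 : R).
  by move=> e; apply: smooth_coord.
have s1 : smooth_on U X1.
  by apply: smooth_sum => // e _; apply: smooth_scaleV; [exact: st|exact: delta_t_smooth].
have s2 : smooth_on U X2.
  by apply: smooth_sum => // e _; apply: smooth_scaleV; [exact: sx|exact: delta_x_smooth].
have s3 : smooth_on U X3.
  by apply: smooth_sum => // e _; apply: smooth_scaleV; [exact: su|exact: partial_u_smooth].
have s23 : smooth_on U (X2 \+ X3) by apply: smoothD.
rewrite [in LHS]EX.
have [_ _ /(_ _ s23 z) H _ _] := nabla_local s1 sY.
rewrite H ?inE //= -addrA; congr (_ + _).
  by apply: nabla_sum_l => // e; exact: delta_t_smooth.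
have [_ _ /(_ _ s3 z) {}H _ _] := nabla_local s2 sY.
rewrite H ?inE //=; congr (_ + _).
  by apply: nabla_sum_l => // e; exact: delta_x_smooth.
rewrite pair_bigA.
apply: (nabla_sum_l (index_enum _) (f := fun je y => ver c y (X y) je.1 je.2)
   (F := fun je => partial_u je.1 je.2)) => // je; exact: partial_u_smooth.
Qed.

Lemma nabla_proj_T X Y z : smooth_on U X -> smooth_on U Y -> U z ->
  nabla c X (proj_T Gam c Y) z = proj_T Gam c (nabla c X Y) z.
Proof.
move=> sX sY Uz; case: nh => -[_ H] _ _ _ _.
by have [/eqP + _ _] := H c U X Y Uc sX sY z Uz; rewrite subr_eq0 => /eqP.
Qed.

Lemma nabla_proj_M X Y z : smooth_on U X -> smooth_on U Y -> U z ->
  nabla c X (proj_M Gam c Y) z = proj_M Gam c (nabla c X Y) z.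
Proof.
move=> sX sY Uz; case: nh => -[_ H] _ _ _ _.
by have [_ /eqP + _] := H c U X Y Uc sX sY z Uz; rewrite subr_eq0 => /eqP.
Qed.

Lemma tcomp_add3 (x y w : V) a :
  (x + y + w).1.1 0 a = x.1.1 0 a + y.1.1 0 a + w.1.1 0 a.
Proof. by rewrite [LHS]mxE [X in X + _]mxE. Qed.

Lemma xcomp_add3 (x y w : V) a :
  (x + y + w).1.2 0 a = x.1.2 0 a + y.1.2 0 a + w.1.2 0 a.
Proof. by rewrite [LHS]mxE [X in X + _]mxE. Qed.

Lemma tcomp_sum (I : Type) (r : seq I) (f : I -> R) (F : I -> V) a :
  (\sum_(i <- r) f i *: F i : V).1.1 0 a = \sum_(i <- r) f i * (F i).1.1 0 a.
Proof.
by elim/big_rec2: _ => [|i x y _ <-]; rewrite [LHS]mxE // [X in X + _]mxE.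
Qed.

Lemma xcomp_sum (I : Type) (r : seq I) (f : I -> R) (F : I -> V) a :
  (\sum_(i <- r) f i *: F i : V).1.2 0 a = \sum_(i <- r) f i * (F i).1.2 0 a.
Proof.
by elim/big_rec2: _ => [|i x y _ <-]; rewrite [LHS]mxE // [X in X + _]mxE.
Qed.

Lemma tcomp_sum2 (I J : Type) (r : seq I) (q : seq J) (f : I -> J -> R)
    (F : I -> J -> V) a :
  (\sum_(i <- r) \sum_(j <- q) f i j *: F i j : V).1.1 0 a
  = \sum_(i <- r) \sum_(j <- q) f i j * (F i j).1.1 0 a.
Proof.
by elim/big_rec2: _ => [|i x y _ <-]; rewrite [LHS]mxE // tcomp_sum.
Qed.

Lemma xcomp_sum2 (I J : Type) (r : seq I) (q : seq J) (f : I -> J -> R)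
    (F : I -> J -> V) a :
  (\sum_(i <- r) \sum_(j <- q) f i j *: F i j : V).1.2 0 a
  = \sum_(i <- r) \sum_(j <- q) f i j * (F i j).1.2 0 a.
Proof.
by elim/big_rec2: _ => [|i x y _ <-]; rewrite [LHS]mxE // xcomp_sum.
Qed.

(** The temporal coefficients of an h-normal connection are prescribed in all
    three adapted directions. *)
Lemma nabla_delta_t X b z : smooth_on U X -> U z ->
  nabla c X (delta_t Gam c b) z =
  assemble c z (row b (Tconn c.1 z.1.1 (X z).1.1)) 0 0.
Proof.
move=> sX Uz; have sd := delta_t_smooth b; have zc := Ud Uz.
have zt : cimage c.1 z.1.1 by case: zc.
have E : proj_T Gam c (delta_t Gam c b) = delta_t Gam c b.
  by apply/funext => y; rewrite proj_TE delta_tE.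
rewrite -[in LHS]E nabla_proj_T // proj_TE; congr (assemble _ _ _ _ _).
rewrite (nabla_frame sX sd Uz).
have [_ HG HL HC _] := nh.
apply/rowP => a; rewrite [RHS]mxE.
rewrite tcomp_add3 !tcomp_sum tcomp_sum2.
rewrite [X in _ + X + _]big1 => [|j _]; last first.
  by rewrite (HL c z zc a b j : (nabla c _ _ z).1.1 0 a = 0) mulr0.
rewrite [X in _ + X]big1 => [|j _]; last first.
  rewrite big1 // => e _.
  by rewrite (HC c z zc a b j e : (nabla c _ _ z).1.1 0 a = 0) mulr0.
rewrite !addr0 /Tconn summxE; apply: eq_bigr => e _.
rewrite [RHS]mxE; congr (_ * _).
by rewrite -(christoffelE hh) // -(HG c z zc).
Qed.

(** Along [delta/delta t^e] the coefficients are prescribed; along the other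
    directions they are symmetric and metric, so [koszul_unique] applies. *)
Lemma nabla_delta_x X i z : smooth_on U X -> U z ->
  nabla c X (delta_x Gam c i) z =
  assemble c z 0 (row i (Mconn c z (X z))) 0.
Proof.
move=> sX Uz; have sd := delta_x_smooth i; have zc := Ud Uz.
have E : proj_M Gam c (delta_x Gam c i) = delta_x Gam c i.
  by apply/funext => y; rewrite proj_ME delta_xE.
rewrite -[in LHS]E nabla_proj_M // proj_ME; congr (assemble _ _ _ _ _).
rewrite (nabla_frame sX sd Uz).
have [[mL mC] mG sL sC] := nm zc.
have gs := g_sym zc; have gu := g_unit zc; have gd := g_diff hg zc.
have uniq (D : 'I_n -> 'M[R]_n) (C : 'I_n -> 'I_n -> 'I_n -> R) :
    (forall i j k, D k i j - \sum_(m < n) g c z m j * C m i k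
        - \sum_(m < n) g c z i m * C m j k = 0) ->
    (forall k i j, C k i j = C k j i) ->
    forall k i j, C k i j = koszul_mx (g c z) D j i k.
  move=> mD cs k' i' j'.
  pose G j : 'M[R]_n := \matrix_(i, k) C k i j.
  rewrite -(koszul_unique j' gs gu (D := D) (G := G)) ?mxE //.
    by move=> a b d; rewrite !mxE.
  move=> a; apply/matrixP => b d; have := mD b d a.
  move=> /eqP; rewrite subr_eq0 subr_eq => /eqP ->.
  rewrite [LHS]mxE addrC [X in X + _]mxE [X in _ + X]mxE; congr (_ + _).
    by apply: eq_bigr => m _; rewrite [_^T _ _]mxE [G _ _ _]mxE.
  by apply: eq_bigr => m _; rewrite [G _ _ _]mxE mulrC.
apply/rowP => k; rewrite [RHS]mxE.
rewrite xcomp_add3 !xcomp_sum xcomp_sum2 /Mconn.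
rewrite [RHS](mxE _ _ i k) [X in _ = X + _](mxE _ _ i k).
congr (_ + _ + _).
- rewrite /Mconn_t -assemble_t_sum (derive_dir_sum _ _ _ gd).
  rewrite [RHS]mxE mulmx_suml summxE mulr_sumr; apply: eq_bigr => e _.
  rewrite (mG k i e : (nabla c _ _ z).1.2 0 k = _) (derive_dirZ _ _ gd).
  rewrite -scalemxAl [X in _ = _ * X]mxE mulrCA; congr (_ * _).
  have E2 l : 'D_(delta_t Gam c e z) (fun w => g c w l i) z =
     ('D_(delta_t Gam c e z) (g c) z) l i by apply: esym; exact: derive_coord.
  under eq_bigr do rewrite E2.
  have Ds := dg_sym hg g_sym (delta_t Gam c e z) zc.
  move: ('D_(delta_t _ _ _ _) _ _) Ds => D Ds.
  move: (invmx (g c z)) (invmx_sym gs) => I Is.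
  rewrite [X in _ = _ * X]mxE mulr_sumr; apply: eq_bigr => l _.
  by rewrite -[in RHS]Is -[in RHS]Ds ![_^T _ _]mxE; ring.
- rewrite /Mconn_x summxE; apply: eq_bigr => j _.
  rewrite [RHS]mxE; congr (_ * _).
  apply: (uniq _ (fun k i j => Lcoef Gam nabla c z k i j)) => //.
  by move=> i' j' k'; rewrite (derive_coord _ _ _ gd) -[RHS](mL i' j' k').
rewrite /Mconn_u summxE; apply: eq_bigr => j _.
rewrite summxE; apply: eq_bigr => e _.
rewrite [RHS]mxE; congr (_ * _).
apply: (uniq _ (fun k i j => Ccoef Gam nabla c z k i j e)) => //.
by move=> i' j' k'; rewrite (derive_coord _ _ _ gd) -[RHS](mC i' j' k' e).
Qed.

Lemma assemble_t_lin (I : Type) (r : seq I) (f : I -> R) (F : I -> 'rV[R]_p) z :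
  \sum_(i <- r) f i *: assemble c z (F i) 0 0 = assemble c z (\sum_(i <- r) f i *: F i) 0 0.
Proof.
elim/big_rec2: _ => [|i x y _ ->]; first by rewrite /assemble nl_term0 subr0.
by rewrite -assembleZ -assembleD !scaler0 !addr0.
Qed.

Lemma assemble_x_lin (I : Type) (r : seq I) (f : I -> R) (F : I -> 'rV[R]_n) z :
  \sum_(i <- r) f i *: assemble c z 0 (F i) 0 = assemble c z 0 (\sum_(i <- r) f i *: F i) 0.
Proof.
elim/big_rec2: _ => [|i x y _ ->]; first by rewrite /assemble nl_term0 subr0.
by rewrite -assembleZ -assembleD !scaler0 !addr0.
Qed.

Lemma assemble_u_lin (I : Type) (r : seq I) (F : I -> 'M[R]_(n, p)) z :
  \sum_(i <- r) assemble c z 0 0 (F i) = assemble c z 0 0 (\sum_(i <- r) F i).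
Proof.
elim/big_rec2: _ => [|i x y _ ->]; first by rewrite /assemble nl_term0 subr0.
by rewrite -assembleD !addr0.
Qed.

Lemma nabla_temporal X a z : smooth_on U X -> smooth_on U a -> U z ->
  nabla c X (fun y => assemble c y (a y) 0 0) z =
  assemble c z ('D_(X z) a z + a z *m Tconn c.1 z.1.1 (X z).1.1) 0 0.
Proof.
move=> sX sa Uz.
have -> : (fun y => assemble c y (a y) 0 0) = (fun y => \sum_b a y 0 b *: delta_t Gam c b y).
  by apply/funext => y; rewrite assemble_t_sum.
rewrite (nabla_sum_r _ (f := fun b y => a y 0 b)) //; last 2 first.
- by move=> b; apply: smooth_coord.
- by move=> b; apply: delta_t_smooth.
rewrite big_split /=.
under [X in _ + X]eq_bigr do rewrite nabla_delta_t //.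
rewrite assemble_t_lin -mulmx_sum_row -[X in _ = assemble _ _ _ X _]addr0.
rewrite -[X in _ = assemble _ _ _ _ X]addr0 assembleD; congr (_ + _).
rewrite -assemble_t_sum; apply: eq_bigr => b _; congr (_ *: _).
by apply: esym; apply: derive_coord; apply: smooth_differentiable Uz.
Qed.

Lemma nabla_spatial X b z : smooth_on U X -> smooth_on U b -> U z ->
  nabla c X (fun y => assemble c y 0 (b y) 0) z =
  assemble c z 0 ('D_(X z) b z + b z *m Mconn c z (X z)) 0.
Proof.
move=> sX sb Uz.
have -> : (fun y => assemble c y 0 (b y) 0) = (fun y => \sum_i b y 0 i *: delta_x Gam c i y).
  by apply/funext => y; rewrite assemble_x_sum.
rewrite (nabla_sum_r _ (f := fun i y => b y 0 i)) //; last 2 first.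
- by move=> i; apply: smooth_coord.
- by move=> i; apply: delta_x_smooth.
rewrite big_split /=.
under [X in _ + X]eq_bigr do rewrite nabla_delta_x //.
rewrite assemble_x_lin -mulmx_sum_row -[X in _ = assemble _ _ X _ _]addr0.
rewrite -[X in _ = assemble _ _ _ _ X]addr0 assembleD; congr (_ + _).
rewrite -assemble_x_sum; apply: eq_bigr => i _; congr (_ *: _).
by apply: esym; apply: derive_coord; apply: smooth_differentiable Uz.
Qed.

Lemma sum_delta_row (w : 'M[R]_(n, p)) :
  \sum_i (delta_mx 0 i : 'rV[R]_n)^T *m row i w = w.
Proof.
apply/matrixP => k l; rewrite summxE (bigD1 k) //= big1 => [|i ik].
  by rewrite addr0 mxE big_ord1 !mxE !eqxx mul1r.
by rewrite mxE big_ord1 !mxE [k == i]eq_sym (negbTE ik) andbF mul0r.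
Qed.

Lemma sum_row_row (W : 'M[R]_n) (w : 'M[R]_(n, p)) :
  \sum_i (row i W)^T *m row i w = W^T *m w.
Proof.
apply/matrixP => k l; rewrite summxE mxE; apply: eq_bigr => i _.
by rewrite mxE big_ord1 !mxE.
Qed.

(** A vertical field is a sum of values of [J] on pairs of horizontal fields, so
    the parallelism of [J] determines the connection on vertical fields. *)
Lemma nabla_vertical X w z : smooth_on U X -> smooth_on U w -> U z ->
  nabla c X (fun y => assemble c y 0 0 (w y)) z =
  assemble c z 0 0 ('D_(X z) w z + (Mconn c z (X z))^T *m w z
     - w z *m (Tconn c.1 z.1.1 (X z).1.1)^T).
Proof.
move=> sX sw Uz; have zc := Ud Uz; have zt : cimage c.1 z.1.1 by case: zc.
pose hE (y : V) := h c.1 y.1.1.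
have sh : smooth_on U hE.
  have := smooth_linear_pre (@tproj_linear R p n) (@tproj_continuous R p n)
    (h_smooth hh (a := c.1)).
  by apply: smooth_subset => y /Ud [].
have uh y : U y -> hE y \in unitmx by move=> /Ud [+ _]; apply: h_unit.
(* chosen such that [J] maps [a i] and [delta/delta x^i] to the row [i] of [w] *)
pose a i y := row i (w y) *m invmx (hE y).
have sr i : smooth_on U (fun y => row i (w y)).
  apply: smooth_mx => // k l.
  have -> : (fun y => row i (w y) k l) = (fun y => w y i l).
    by apply/funext => y; rewrite mxE.
  exact: smooth_coord.
have sa i : smooth_on U (a i) by apply: smooth_mulmx => //; exact: smooth_invmx.
pose A i y := assemble c y (a i y) 0 0.
have sA i : smooth_on U (A i) by apply: sass => //; apply: smooth_cst.
have JE i y : U y -> Jtensor h c (A i) (delta_x Gam c i) y =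
    assemble c y 0 0 ((delta_mx 0 i)^T *m row i (w y)).
  move=> Uy; rewrite (JtensorE h Gam) /= /a.
  have -> : (h c.1 y.1.1)^T = hE y by apply: h_sym hh _ _ _; case: (Ud Uy).
  by rewrite -mulmxA mulmxKV // uh.
have sJ i : smooth_on U (Jtensor h c (A i) (delta_x Gam c i)).
  apply: (@smooth_ext _ _ _ U (fun y => assemble c y 0 0 ((delta_mx 0 i)^T *m row i (w y)))) => //.
    by move=> y; rewrite inE => Uy; rewrite JE.
  apply: sass; try exact: smooth_cst.
  by apply: smooth_mulmx => //; exact: smooth_cst.
have -> : nabla c X (fun y => assemble c y 0 0 (w y)) z =
   nabla c X (fun y => \sum_i (fun=> 1 : R) y *: Jtensor h c (A i) (delta_x Gam c i) y) z.
  have sww : smooth_on U (fun y => assemble c y 0 0 (w y)).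
    by apply: sass => //; apply: smooth_cst.
  have [_ H _ _ _] := nabla_local sX sww.
  apply: H; rewrite ?inE // => y; rewrite inE => Uy.
  under eq_bigr do rewrite scale1r JE //.
  by rewrite assemble_u_lin sum_delta_row.
rewrite (nabla_sum_r _ (f := fun _ _ => 1)) //; last by move=> i; apply: smooth_cst.
under eq_bigr do rewrite (derive_cst (1 : R)) scale0r add0r scale1r.
have JN i : nabla c X (Jtensor h c (A i) (delta_x Gam c i)) z =
   Jtensor h c (nabla c X (A i)) (delta_x Gam c i) z +
   Jtensor h c (A i) (nabla c X (delta_x Gam c i)) z.
  have [_ _ _ _ HJ] := nh.
  have := HJ c U _ _ _ Uc (sA i) (delta_x_smooth i) sX z Uz.
  by move=> /eqP; rewrite -addrA -opprD subr_eq0 => /eqP.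
under eq_bigr do rewrite JN !(JtensorE h Gam) nabla_temporal // nabla_delta_x // -assembleD !addr0.
rewrite assemble_u_lin; congr (assemble _ _ _ _ _).
have dw : differentiable w z by apply: smooth_differentiable Uz.
have [dH DH] := derive_base (X z) (@tproj_linear R p n) (@tproj_continuous R p n)
  (h_diff hh zt).
rewrite addrAC -[X in _ = X + _]sum_delta_row -[X in _ = _ + X]sum_row_row -big_split.
apply: eq_bigr => i _.
have dai : differentiable (a i) z by apply: smooth_differentiable Uz.
have [_ Dah] := derive_mulmx (X z) dai dH.
have ahE y : U y -> a i y *m hE y = row i (w y).
  by move=> Uy; rewrite /a mulmxKV // uh.
have {}Dah : 'D_(X z) (a i) z *m hE z = row i ('D_(X z) w z)
    - a i z *m 'D_(X z).1.1 (h c.1) z.1.1.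
  rewrite -DH; apply/eqP; rewrite eq_sym subr_eq eq_sym -[X in X == _]Dah; apply/eqP.
  have -> : 'D_(X z) (fun y => a i y *m h c.1 y.1.1) z = 'D_(X z) (fun y => row i (w y)) z.
    by apply: open_derive_eq Uz => // y; rewrite inE => /ahE.
  apply/matrixP => k l; rewrite derive_coord; last first.
    by apply: smooth_differentiable Uz.
  have -> : (fun y => row i (w y) k l) = (fun y => w y i l).
    by apply/funext => y; rewrite mxE.
  by rewrite -(derive_coord _ _ _ dw) [RHS]mxE.
rewrite -(Tconn_metric hh _ zt) in Dah.
have hs : (h c.1 z.1.1)^T = hE z by exact: h_sym.
have aw := ahE z Uz.
rewrite hs /=.
move: Dah aw; rewrite -/(hE z).
move: (hE z) (Tconn _ _ _) (Mconn _ _ _) ('D_(X z) (a i) z) ('D_(X z) w z) (w z) (a i z).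
move=> H K W Da Dw ww aa Dah aw.
rewrite -![_ *m _ *m H]mulmxA aw; congr (_ *m _ + _).
have -> : (Da + aa *m K) *m H = row i Dw - row i ww *m K^T.
  by rewrite mulmxDl Dah mulmxDr !mulmxA aw; apply/matrixP => k l; rewrite !mxE; ring.
by rewrite -row_mul; apply/matrixP => k l; rewrite !mxE.
Qed.

Lemma nabla_cartan X Y z : smooth_on U X -> smooth_on U Y -> U z ->
  cartan c X Y z = nabla c X Y z.
Proof.
move=> sX sY Uz; rewrite /cartan.
pose Y1 y := assemble c y (Y y).1.1 0 0.
pose Y2 y := assemble c y 0 (Y y).1.2 0.
pose Y3 y := assemble c y 0 0 (ver c y (Y y)).
have EY : Y = (Y1 \+ (Y2 \+ Y3)).
  apply/funext => y; rewrite -[LHS](assemble_ver Gam c y) /=.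
  by rewrite -!assembleD !addr0 !add0r.
have st : smooth_on U (fun y => (Y y).1.1) by apply: smooth_tcomp.
have sx : smooth_on U (fun y => (Y y).1.2) by apply: smooth_xcomp.
have sv : smooth_on U (fun y => ver c y (Y y)) by apply: (ver_smooth Msmooth Nsmooth oU Ud).
have s1 : smooth_on U Y1 by apply: sass => //; apply: smooth_cst.
have s2 : smooth_on U Y2 by apply: sass => //; apply: smooth_cst.
have s3 : smooth_on U Y3 by apply: sass => //; apply: smooth_cst.
have s23 : smooth_on U (Y2 \+ Y3) by apply: smoothD.
rewrite [in RHS]EY.
have [_ _ _ /(_ _ s23 z) H _] := nabla_local sX s1.
rewrite H ?inE //=.
have [_ _ _ /(_ _ s3 z) {}H _] := nabla_local sX s2.
rewrite H ?inE //= (nabla_temporal sX st Uz) (nabla_spatial sX sx Uz) (nabla_vertical sX sv Uz).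
by rewrite -!assembleD !addr0 !add0r.
Qed.

End Local.

Lemma cartan_unique nabla : h_normal Gam h nabla -> metrical_properties Gam g nabla ->
  same_connection cartan nabla.
Proof.
by move=> nh nm c U X Y Uc sX sY z; rewrite inE => Uz; apply: nabla_cartan Uz.
Qed.

End CartanUnique.

(** * Independence of the chart *)

Section CartanTransform.
Context {R : realType} {p n : nat}.
Context {T : smooth_manifold R p} {M : smooth_manifold R n}.
Local Notation V := (jcoord R p n).
Variables (h : metric_family T) (g : dtensor_family T M) (Gam : nonlinear_coefs T M).
Implicit Types (c : jchart T M) (z v : V) (X Y : V -> V) (U : set V).
Local Notation ver := (ver Gam).
Local Notation assemble := (assemble Gam).
Local Notation Tconn := (Tconn h).
Local Notation Mconn_t := (Mconn_t g Gam).
Local Notation Mconn_x := (Mconn_x g Gam).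
Local Notation Mconn_u := (@Mconn_u R p n T M g).
Local Notation Mconn := (Mconn g Gam).
Local Notation cartan := (cartan h g Gam).

Hypothesis hh : semi_riemannian h.
Hypothesis hg : dtensor02 g.
Hypothesis g_sym : forall c z, jdom c z -> (g c z)^T = g c z.
Hypothesis g_unit : forall c z, jdom c z -> g c z \in unitmx.
Hypothesis Msmooth : forall c e, smooth_on (jdom c) (fun z => Mmx Gam c z e).
Hypothesis Nsmooth : forall c j, smooth_on (jdom c) (fun z => Nmx Gam c z j).

Lemma sum_scale_mulmx (W : lmodType R) k l (w : 'rV[R]_k) (A : 'M[R]_(k, l)) (F : 'I_l -> W) :
  \sum_i w 0 i *: (\sum_j A i j *: F j) = \sum_j (w *m A) 0 j *: F j.
Proof.
under eq_bigr do rewrite scaler_sumr.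
rewrite exchange_big /=; apply: eq_bigr => j _.
by rewrite mxE scaler_suml; apply: eq_bigr => i _; rewrite scalerA.
Qed.

Lemma koszul_mx_lin (m q : nat) (S : 'M[R]_m) (f : 'I_q -> R) (D : 'I_q -> 'I_m -> 'M[R]_m) k :
  koszul_mx S (fun l => \sum_e f e *: D e l) k = \sum_e f e *: koszul_mx S (D e) k.
Proof.
apply/matrixP => i j; rewrite mxE /koszul summxE.
under [RHS]eq_bigr do rewrite mxE [koszul_mx _ _ _ _ _]mxE /koszul mulr_sumr.
rewrite exchange_big /=; apply: eq_bigr => b _.
rewrite !summxE -!big_split /= -sumrN -big_split /= mulr_sumr.
by apply: eq_bigr => e _; rewrite !mxE; ring.
Qed.

Lemma mulmx_delta_mulmx k l (P : 'M[R]_k) (Q : 'M[R]_l) i j r s :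
  (P *m delta_mx i j *m Q) r s = P r i * Q j s.
Proof.
by rewrite -(mul_delta_mx (0 : 'I_1)) mulmxA -mulmxA -colE -rowE mxE big_ord1 !mxE.
Qed.

(** If [G] and [F] are related homogeneously in both indices, the contraction with
    [w] amounts to transforming [w] contragrediently. *)
Lemma contract_transform k l (P : 'M[R]_k) (Q : 'M[R]_l) (G F : 'I_k -> 'I_l -> 'M[R]_k)
    (w : 'M[R]_(k, l)) :
  (forall i e, G i e *m P = P *m \sum_j P i j *: \sum_f Q f e *: F j f) ->
  (\sum_i \sum_e w i e *: G i e) *m P =
  P *m \sum_j \sum_f (P^T *m w *m Q^T) j f *: F j f.
Proof.
move=> GF.
transitivity (P *m \sum_i \sum_e \sum_j \sum_f (P i j * w i e * Q f e) *: F j f).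
  rewrite mulmx_suml mulmx_sumr; apply: eq_bigr => i _.
  rewrite mulmx_suml mulmx_sumr; apply: eq_bigr => e _.
  rewrite -scalemxAl GF scalemxAr; congr (P *m _).
  rewrite scaler_sumr; apply: eq_bigr => j _.
  rewrite !scaler_sumr; apply: eq_bigr => f _.
  by rewrite !scalerA; congr (_ *: _); ring.
congr (P *m _); rewrite pair_bigA /= exchange_big; apply: eq_bigr => j _ /=.
rewrite exchange_big; apply: eq_bigr => f _ /=.
rewrite -scaler_suml; congr (_ *: _).
rewrite -(pair_bigA _ (fun i e => P i j * w i e * Q f e)) exchange_big mxE.
apply: eq_bigr => e _; rewrite mxE mulr_suml; apply: eq_bigr => i _.
by rewrite ![_^T _ _]mxE.
Qed.

Lemma derive_congruence (W : normedModType R) m (A S : W -> 'M[R]_m) (x v : W) :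
  differentiable A x -> differentiable S x ->
  'D_v (fun y => A y *m S y *m (A y)^T) x =
  'D_v A x *m S x *m (A x)^T + A x *m 'D_v S x *m (A x)^T + A x *m S x *m ('D_v A x)^T.
Proof.
move=> dA dS; have [d1 D1] := derive_mulmx v dA dS.
have [_ ->] := derive_mulmx v d1 (differentiable_trmx dA).
by rewrite D1 derive_trmx // mulmxDl.
Qed.

(** The derivative of the tensor law of [h] has the form required by
    [koszul_transform], with [dA] the symmetric Hessian of the change of charts. *)
Lemma Tconn_transform a a' t w : coverlap a a' t ->
  Tconn a t w *m cjac a a' t =
  'D_w (cjac a a') t + cjac a a' t *m Tconn a' (ctrans a a' t) (w *m cjac a a' t).
Proof.
move=> ta; have ta' := ctrans_overlap ta.
have at_ := coverlap_sub ta; have at' := coverlap_sub ta'.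
have dA := cjac_differentiable ta.
have dt := ctrans_differentiable ta.
have dh' := h_diff hh at'.
have hE : forall s, coverlap a a' s ->
    h a s = cjac a a' s *m h a' (ctrans a a' s) *m (cjac a a' s)^T.
  by move=> s; case: hh => _ H _ _; apply: H.
have dhE k : dh h a t k = 'D_(delta_mx 0 k) (cjac a a') t *m h a' (ctrans a a' t) *m (cjac a a' t)^T
    + cjac a a' t *m (\sum_l cjac a a' t k l *: dh h a' (ctrans a a' t) l) *m (cjac a a' t)^T
    + cjac a a' t *m h a' (ctrans a a' t) *m ('D_(delta_mx 0 k) (cjac a a') t)^T.
  have dc : differentiable (fun s => h a' (ctrans a a' s)) t.
    by apply: (@differentiable_comp _ _ _ _ (ctrans a a') (h a')).
  have <- : 'D_(delta_mx 0 k) (fun s => h a' (ctrans a a' s)) t =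
      \sum_l cjac a a' t k l *: dh h a' (ctrans a a' t) l.
    apply: etrans (derive_comp (delta_mx 0 k) dt dh') _.
    rewrite (derive_ctrans _ ta) -rowE [row k _]row_sum_delta (derive_dir_sum _ _ _ dh').
    by apply: eq_bigr => l _; rewrite (derive_dirZ _ _ dh') [row k _ 0 l]mxE.
  rewrite -(derive_congruence (delta_mx 0 k) dA dc).
  apply: open_derive_eq ta; first exact: coverlap_open.
  by move=> s; rewrite inE => /hE.
have key k := koszul_transform (dA := fun k => 'D_(delta_mx 0 k) (cjac a a') t) k
  (h_sym hh at_) (h_sym hh at') (h_unit hh at') (cjac_unit ta) (hE t ta)
  (fun l => dh_sym hh l at') dhE (fun k i e => derive_cjac_sym_entry k i e ta).
have DA : 'D_w (cjac a a') t = \sum_k w 0 k *: 'D_(delta_mx 0 k) (cjac a a') t.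
  rewrite [in LHS](row_sum_delta w) (derive_dir_sum _ _ _ dA).
  by apply: eq_bigr => k _; rewrite (derive_dirZ _ _ dA).
rewrite /Tconn mulmx_suml DA -sum_scale_mulmx mulmx_sumr -big_split /=.
apply: eq_bigr => k _.
by rewrite -scalemxAl key -scalemxAr scalerDr.
Qed.

Section Overlap.
Variables (c c' : jchart T M) (z : V).
Hypothesis zc : joverlap c c' z.
Hypothesis ver_transform : forall v,
  ver c' (jtrans c c' z) (djtrans c c' z v) =
  (jacM c c' z)^T *m ver c z v *m (invmx (jacT c c' z))^T.
Local Notation A := (jacM c c' z).
Local Notation B := (jacT c c' z).
Local Notation z' := (jtrans c c' z).

Let zd : jdom c z. Proof. exact: joverlap_sub zc. Qed.
Let zd' : jdom c' z'. Proof. exact: jtrans_dom. Qed.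
Let uA : A \in unitmx. Proof. exact: jacM_unit. Qed.
Let uB : B \in unitmx. Proof. exact: jacT_unit. Qed.

Lemma djtrans_assemble a b w :
  djtrans c c' z (assemble c z a b w) =
  assemble c' z' (a *m B) (b *m A) (A^T *m w *m (invmx B)^T).
Proof.
by rewrite -(assemble_ver Gam c' z' (djtrans _ _ _ _)) ver_transform ver_assemble.
Qed.

Lemma derive_g_transform v :
  'D_v (g c) z = djacM c c' z v *m g c' z' *m A^T
    + A *m 'D_(djtrans c c' z v) (g c') z' *m A^T
    + A *m g c' z' *m (djacM c c' z v)^T.
Proof.
have [_ zM] := zc.
have [dA DA] := derive_base v (@xproj_linear R p n) (@xproj_continuous R p n)
  (cjac_differentiable zM).
have [dg Dg] := derive_comp_jtrans zc v (g_diff hg zd').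
rewrite -Dg /djacM -DA.
apply: etrans _ (derive_congruence v dA dg).
apply: open_derive_eq zc; first exact: joverlap_open.
by move=> y; rewrite inE => yc; case: hg => _; apply.
Qed.

Lemma djacM0 v : v.1.2 = 0 -> djacM c c' z v = 0.
Proof. by rewrite /djacM => ->; rewrite derive0. Qed.

Lemma g_transform : g c z = A *m g c' z' *m A^T.
Proof. by case: hg => _; apply. Qed.

(** Along temporal directions the spatial Jacobian is constant, so no Hessian
    appears. *)
Lemma Mconn_t_transform a : Mconn_t c z a *m A = A *m Mconn_t c' z' (a *m B).
Proof.
rewrite /Mconn_t -scalemxAl -scalemxAr; congr (_ *: _).
have ug := g_unit zd; have ug' := g_unit zd'.
rewrite derive_g_transform djacM0 // trmx0 !mul0mx !mulmx0 add0r addr0.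
rewrite djtrans_assemble !mul0mx mulmx0 mul0mx.
move: ('D_(assemble c' z' (a *m B) 0 0) (g c') z') => D.
have -> : A *m D *m A^T = A *m D *m invmx (g c' z') *m invmx A *m g c z.
  by rewrite g_transform !mulmxA (mulmxKV uA) (mulmxKV ug').
by rewrite (mulmxK ug) (mulmxKV uA) mulmxA.
Qed.

(** The adapted frame changes tensorially, so the derivative of the tensor law
    of [g] along it has no other inhomogeneous term than the Hessian. *)
Lemma Mconn_x_transform b :
  Mconn_x c z b *m A = 'D_b (cjac c.2 c'.2) z.1.2 + A *m Mconn_x c' z' (b *m A).
Proof.
have [_ zM] := zc.
have dA := cjac_differentiable zM.
have DE k : 'D_(delta_x Gam c k z) (g c) z =
  'D_(delta_mx 0 k) (cjac c.2 c'.2) z.1.2 *m g c' z' *m A^T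
  + A *m (\sum_l A k l *: 'D_(delta_x Gam c' l z') (g c') z') *m A^T
  + A *m g c' z' *m ('D_(delta_mx 0 k) (cjac c.2 c'.2) z.1.2)^T.
  rewrite derive_g_transform.
  have -> : djacM c c' z (delta_x Gam c k z) = 'D_(delta_mx 0 k) (cjac c.2 c'.2) z.1.2 by [].
  have dg := g_diff hg zd'.
  have -> // : 'D_(djtrans c c' z (delta_x Gam c k z)) (g c') z' =
     \sum_l A k l *: 'D_(delta_x Gam c' l z') (g c') z'.
  rewrite delta_xE djtrans_assemble !mul0mx mulmx0 mul0mx -assemble_x_sum.
  rewrite (derive_dir_sum _ _ _ dg); apply: eq_bigr => l _.
  by rewrite (derive_dirZ _ _ dg) -rowE [row k _ 0 l]mxE.
have key k := koszul_transform k
  (g_sym zd) (g_sym zd') (g_unit zd') uA g_transform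
  (fun l => dg_sym hg g_sym (delta_x Gam c' l z') zd') DE
  (fun k i e => derive_cjac_sym_entry k i e zM).
have DA : 'D_b (cjac c.2 c'.2) z.1.2 =
    \sum_k b 0 k *: 'D_(delta_mx 0 k) (cjac c.2 c'.2) z.1.2.
  rewrite [in LHS](row_sum_delta b) (derive_dir_sum _ _ _ dA).
  by apply: eq_bigr => k _; rewrite (derive_dirZ _ _ dA).
rewrite /Mconn_x mulmx_suml DA -sum_scale_mulmx mulmx_sumr -big_split /=.
apply: eq_bigr => k _.
by rewrite -scalemxAl key -scalemxAr scalerDr.
Qed.

(** Along the fibres the Jacobians are constant and the law is homogeneous. *)
Lemma Mconn_u_transform w :
  Mconn_u c z w *m A = A *m Mconn_u c' z' (A^T *m w *m (invmx B)^T).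
Proof.
have dg := g_diff hg zd'.
pose D'' e l := \sum_e' invmx B e' e *: 'D_(eu l e') (g c') z'.
have DE e k : 'D_(eu k e) (g c) z =
  0 *m g c' z' *m A^T + A *m (\sum_l A k l *: D'' e l) *m A^T + A *m g c' z' *m 0^T.
  rewrite derive_g_transform djacM0 // trmx0 !mul0mx !mulmx0 !add0r !addr0.
  congr (_ *m _ *m _).
  have -> : eu k e = assemble c z 0 0 (delta_mx k e) by rewrite -partial_uE.
  rewrite djtrans_assemble !mul0mx -assemble_u_sum (derive_dir_sum _ _ _ dg).
  apply: eq_bigr => l _; rewrite (derive_dir_sum _ _ _ dg) scaler_sumr.
  apply: eq_bigr => e' _; rewrite (derive_dirZ _ _ dg) scalerA; congr (_ *: _).
  move: A (invmx B) => P Q.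
  by rewrite mulmx_delta_mulmx ![_^T _ _]mxE.
have sD'' e l : (D'' e l)^T = D'' e l.
  rewrite /D'' linear_sum; apply: eq_bigr => e' _.
  by rewrite linearZ /= (dg_sym hg g_sym _ zd').
have key e k : koszul_mx (g c z) (fun l => 'D_(eu l e) (g c) z) k *m A =
    0 + A *m \sum_l A k l *: koszul_mx (g c' z') (D'' e) l.
  apply: (koszul_transform (dA := fun=> 0)) => //.
  - exact: g_sym.
  - exact: g_sym.
  - exact: g_unit.
  - exact: g_transform.
  - by move=> l i j; rewrite !mxE.
apply: contract_transform => k e; rewrite key add0r.
congr (_ *m _); apply: eq_bigr => l _; congr (_ *: _).
exact: koszul_mx_lin.
Qed.

Lemma Mconn_transform v :
  Mconn c z v *m A = djacM c c' z v + A *m Mconn c' z' (djtrans c c' z v).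
Proof.
rewrite -[in djtrans _ _ _ v](assemble_ver Gam c z v) djtrans_assemble.
rewrite /Mconn ver_assemble [in RHS]/= !mulmxDl Mconn_t_transform Mconn_x_transform.
by rewrite Mconn_u_transform !mulmxDr -!addrA [LHS]addrCA.
Qed.

End Overlap.

(** A nonlinear connection is one for which the vertical component of a tangent
    vector is tensorial. *)
Hypothesis ver_transform : forall c c' z v, joverlap c c' z ->
  ver c' (jtrans c c' z) (djtrans c c' z v) =
  (jacM c c' z)^T *m ver c z v *m (invmx (jacT c c' z))^T.

(** The inhomogeneous terms [dA], [dB] of the connection matrices [W], [K] cancel
    the derivatives of the Jacobians in the vertical component. *)
Lemma vertical_component_transform (A W W' dA : 'M[R]_n) (B K K' dB : 'M[R]_p)
    (y dy : 'M[R]_(n, p)) :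
  B \in unitmx -> W *m A = dA + A *m W' -> K *m B = dB + B *m K' ->
  (dA^T *m y + A^T *m dy) *m (invmx B)^T
    + A^T *m y *m (- (invmx B *m dB *m invmx B))^T
    + W'^T *m (A^T *m y *m (invmx B)^T) - A^T *m y *m (invmx B)^T *m K'^T =
  A^T *m (dy + W^T *m y - y *m K^T) *m (invmx B)^T.
Proof.
move=> uB /(congr1 trmx); rewrite linearD /= !trmx_mul => WA KB.
have : invmx B *m K = invmx B *m dB *m invmx B + K' *m invmx B.
  by rewrite -[LHS](mulmxK uB) -[_ *m K *m B]mulmxA KB mulmxDr mulmxA mulVmx // mul1mx mulmxDl.
move=> /(congr1 trmx); rewrite linearD /= [in LHS]trmx_mul [X in _ + X]trmx_mul => KI.
rewrite linearN /= mulmxN !(mulmxDr, mulmxDl) !mulmxA mulmxN WA.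
have -> : - (A^T *m (y *m K^T)) *m (invmx B)^T = - (A^T *m y *m (K^T *m (invmx B)^T)).
  by rewrite mulNmx !mulmxA.
rewrite KI !(mulmxDr, mulmxDl) !mulmxA.
move: (dA^T *m y *m (invmx B)^T) (A^T *m dy *m (invmx B)^T) => e1 e2.
move: (A^T *m y *m (invmx B *m dB *m invmx B)^T) => e3.
move: (W'^T *m A^T *m y *m (invmx B)^T) (A^T *m y *m (invmx B)^T *m K'^T) => e4 e5.
by apply/matrixP => i j; rewrite !mxE; ring.
Qed.

Lemma differentiable_scalemx (W : normedModType R) k l (f : W -> R)
    (F : W -> 'M[R]_(k, l)) (x : W) :
  differentiable f x -> differentiable F x -> differentiable (fun y => f y *: F y) x.
Proof.
move=> df dF; apply: differentiable_mx => i j.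
have -> : (fun y => (f y *: F y) i j) = f * (fun y => F y i j).
  by apply/funext => y; rewrite mxE.
by apply: differentiableM => //; exact: differentiable_entry.
Qed.

Lemma ver_differentiable c z Y : jdom c z -> differentiable Y z ->
  differentiable (fun y => ver c y (Y y)) z.
Proof.
move=> zc dY.
have proj (k l : nat) (f : V -> 'M[R]_(k, l)) : linear f -> continuous f ->
    differentiable (fun y => f (Y y)) z.
  move=> lf cf; apply: (@differentiable_comp _ _ _ _ Y f) => //.
  by case: (linear_derive lf cf (Y z) 0).
have -> : (fun y => ver c y (Y y)) = (fun y => (Y y).2) +
   ((\sum_e (fun y => (Y y).1.1 0 e *: Mmx Gam c y e)) +
    (\sum_j (fun y => (Y y).1.2 0 j *: Nmx Gam c y j))).
  by apply/funext => y; rewrite /ver /nl_term !fctE !fct_sumE.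
apply: differentiableD.
  exact: (proj _ _ _ (@uproj_linear R p n) (@uproj_continuous R p n)).
apply: differentiableD; apply: differentiable_sum => i; apply: differentiable_scalemx.
- apply: differentiable_entry.
  exact: (proj _ _ _ (@tproj_linear R p n) (@tproj_continuous R p n)).
- have sM := Msmooth (c := c) i; exact: smooth_differentiable sM zc.
- apply: differentiable_entry.
  exact: (proj _ _ _ (@xproj_linear R p n) (@xproj_continuous R p n)).
have sN := Nsmooth (c := c) i; exact: smooth_differentiable sN zc.
Qed.

(** In each adapted component the derivative of the Jacobian is cancelled by the
    inhomogeneous term of the connection matrix. *)
Lemma cartan_transform c c' U X Y X' Y' :
  open U -> U `<=` joverlap c c' -> smooth_on U X -> smooth_on U Y ->
  smooth_on (jtrans c c' @` U) X' -> smooth_on (jtrans c c' @` U) Y' ->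
  same_field c c' U X X' -> same_field c c' U Y Y' ->
  same_field c c' U (cartan c X Y) (cartan c' X' Y').
Proof.
move=> oU Uo sX sY sX' sY' XX YY z Uz.
have zc := Uo _ Uz; have [zT zM] := zc.
have Ud : U `<=` jdom c by move=> y /Uo; apply: joverlap_sub.
have {}YY y : U y -> Y' (jtrans c c' y) = djtrans c c' y (Y y).
  by move=> Uy; rewrite YY // djtransE //; apply: Uo.
have zd' : jdom c' (jtrans c c' z) by apply: jtrans_dom.
have zt : cimage c.1 z.1.1 by case: (Ud _ Uz).
have vt := fun v => ver_transform v zc.
rewrite (djtransE zc) /cartan (djtrans_assemble vt) XX // (djtransE zc).
rewrite (YY _ Uz).
have dY' : differentiable Y' (jtrans c c' z).
  by apply: smooth_differentiable sY' _; exists z.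
have st : smooth_on U (fun y => (Y y).1.1) by apply: smooth_tcomp.
have sx : smooth_on U (fun y => (Y y).1.2) by apply: smooth_xcomp.
have sv : smooth_on U (fun y => ver c y (Y y)) by apply: (ver_smooth Msmooth Nsmooth oU Ud).
have dt := smooth_differentiable st Uz.
have dx := smooth_differentiable sx Uz.
have dv := smooth_differentiable sv Uz.
have [dA DA] := derive_base (X z) (@xproj_linear R p n) (@xproj_continuous R p n)
  (cjac_differentiable zM).
have [dB DB] := derive_base (X z) (@tproj_linear R p n) (@tproj_continuous R p n)
  (cjac_differentiable zT).
have [dBi DBi] := derive_cjac_back zc (X z).
have K := Tconn_transform (X z).1.1 zT.
have W := Mconn_transform zc vt (X z).
congr (assemble _ _ _ _ _).
- have dc : differentiable (fun y => (Y' y).1.1) (jtrans c c' z).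
    apply: (@differentiable_comp _ _ _ _ Y' (fun y : V => y.1.1)) => //.
    by case: (linear_derive (@tproj_linear R p n) (@tproj_continuous R p n) (Y' (jtrans c c' z)) 0).
  have [_ <-] := derive_comp_jtrans zc (X z) dc.
  have -> : 'D_(X z) (fun y => (Y' (jtrans c c' y)).1.1) z =
      'D_(X z) (fun y => (Y y).1.1 *m cjac c.1 c'.1 y.1.1) z.
    by apply: open_derive_eq Uz => // y; rewrite inE => /YY ->.
  have [_ ->] := derive_mulmx (X z) dt dB.
  rewrite DB mulmxDl -addrA; congr (_ + _).
  by rewrite /= -!mulmxA -mulmxDr K.
- have dc : differentiable (fun y => (Y' y).1.2) (jtrans c c' z).
    apply: (@differentiable_comp _ _ _ _ Y' (fun y : V => y.1.2)) => //.
    by case: (linear_derive (@xproj_linear R p n) (@xproj_continuous R p n) (Y' (jtrans c c' z)) 0).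
  have [_ <-] := derive_comp_jtrans zc (X z) dc.
  have -> : 'D_(X z) (fun y => (Y' (jtrans c c' y)).1.2) z =
      'D_(X z) (fun y => (Y y).1.2 *m cjac c.2 c'.2 y.1.2) z.
    by apply: open_derive_eq Uz => // y; rewrite inE => /YY ->.
  have [_ ->] := derive_mulmx (X z) dx dA.
  rewrite DA mulmxDl -addrA; congr (_ + _).
  by rewrite /= -!mulmxA -mulmxDr W.
have dc : differentiable (fun y => ver c' y (Y' y)) (jtrans c c' z).
  exact: ver_differentiable.
have [_ <-] := derive_comp_jtrans zc (X z) dc.
have -> : 'D_(X z) (fun y => ver c' (jtrans c c' y) (Y' (jtrans c c' y))) z =
    'D_(X z) (fun y : V => (cjac c.2 c'.2 y.1.2)^T *m ver c y (Y y) *m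
       (cjac c'.1 c.1 (ctrans c.1 c'.1 y.1.1))^T) z.
  apply: (open_derive_eq _ oU _ Uz) => y; rewrite inE => Uy.
  have yc := Uo _ Uy; have [yT _] := yc.
  by rewrite (YY y Uy) (ver_transform _ yc) (cjac_inv yT).
have [d1 D1] := derive_mulmx (X z) (differentiable_trmx dA) dv.
have [_ ->] := derive_mulmx (X z) d1 (differentiable_trmx dBi).
rewrite D1 !derive_trmx // DA DBi cjac_inv // ver_transform //.
exact: (vertical_component_transform _ _ (jacT_unit zc) W K).
Qed.

End CartanTransform.

(** * The canonical nonlinear connection *)

Section Canonical.
Context {R : realType} {p n : nat}.
Context {T : smooth_manifold R p} {M : smooth_manifold R n}.
Local Notation V := (jcoord R p n).
Variables (h : metric_family T) (L : function_family T M) (g : dtensor_family T M).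
Implicit Types (c : jchart T M) (z v : V) (X Y : V -> V) (U : set V).
Local Notation Gam := (canonical_nonlinear h L g).

Hypothesis hh : semi_riemannian h.
Hypothesis hL : metrical_lagrange_space h L g.

Lemma lagrange_dtensor : dtensor02 g. Proof. by case: hL. Qed.

Lemma lagrange_g_sym c z : jdom c z -> (g c z)^T = g c z.
Proof. by case: hL => _ _ H _ _ /H []. Qed.

Lemma lagrange_g_unit c z : jdom c z -> g c z \in unitmx.
Proof.
by case: hL => _ _ H _ _ /H [_ r]; rewrite -row_full_unit /row_full r.
Qed.

Lemma lagrange_smooth c : smooth_on (jdom c) (L c).
Proof. by case: hL => -[]. Qed.

Lemma lagrange_transform c c' z : joverlap c c' z -> L c z = L c' (jtrans c c' z).
Proof. by case: hL => -[_ H] _ _ _ _; apply: H. Qed.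

Lemma lagrange_hessian c z i j a b : jdom c z ->
  du i a (du j b (L c)) z = 2%:R * (invmx (h c.1 z.1.1) a b * g c z i j).
Proof.
by case: hL => _ _ _ _ H /H <-; rewrite mulrA divff ?mul1r.
Qed.

Lemma smooth_tbase (W : normedModType R) c (F : 'rV[R]_p -> W) :
  smooth_on (cimage c.1) F -> smooth_on (jdom c) (fun z : V => F z.1.1).
Proof.
move=> sF; have := smooth_linear_pre (@tproj_linear R p n) (@tproj_continuous R p n) sF.
by apply: smooth_subset => z [].
Qed.

Lemma koszul_h_smooth (a : chart T) b :
  smooth_on (cimage a) (fun t => koszul_mx (h a t) (dh h a t) b).
Proof.
apply: smooth_koszul_mx; [exact: cimage_open|by move=> t; apply: (h_unit hh)|exact: (h_smooth hh)|].
by move=> l; apply/smooth_derive/(h_smooth hh).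
Qed.

Lemma Mmx_canonical c z b : jdom c z ->
  Mmx Gam c z b = - (z.2 *m (koszul_mx (h c.1 z.1.1) (dh h c.1 z.1.1) b)^T).
Proof.
move=> [zt _]; apply/matrixP => i a; rewrite [LHS]mxE /= /Mcan.
have E e : christoffel h c.1 z.1.1 e a b =
  koszul_mx (h c.1 z.1.1) (dh h c.1 z.1.1) b a e by exact: christoffelE.
under eq_bigr do rewrite E.
move: (koszul_mx _ _ _) => K.
by rewrite !mxE; congr (- _); apply: eq_bigr => e _; rewrite mxE mulrC.
Qed.

Lemma canonical_Msmooth c b : smooth_on (jdom c) (fun z => Mmx Gam c z b).
Proof.
have oU := @jdom_open R p n T M c.
have s1 : smooth_on (jdom c) (fun z : V =>
    (-1) *: (z.2 *m (koszul_mx (h c.1 z.1.1) (dh h c.1 z.1.1) b)^T)).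
  apply: smooth_scalemx => //; first exact: smooth_cst.
  apply: smooth_mulmx => //.
    apply: smooth_linear; [exact: uproj_linear|exact: uproj_continuous].
  apply: smooth_trmx => //; apply: (smooth_tbase (koszul_h_smooth (a := c.1) b)).
apply: smooth_ext oU _ s1 => z; rewrite inE => zc.
by rewrite Mmx_canonical // scaleN1r.
Qed.

Lemma nl_term_split (G : nonlinear_coefs T M) c z a b :
  nl_term G c z a b = nl_term G c z a 0 + nl_term G c z 0 b.
Proof. by rewrite -nl_termD addr0 add0r. Qed.

Lemma canonical_M c z a : jdom c z ->
  nl_term Gam c z a 0 = - (z.2 *m (Tconn h c.1 z.1.1 a)^T).
Proof.
move=> zc; rewrite /nl_term [X in _ + X]big1 => [|j _]; last by rewrite mxE scale0r.
rewrite addr0 /Tconn linear_sum mulmx_sumr -sumrN; apply: eq_bigr => e _.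
by rewrite Mmx_canonical // linearZ /= -scalemxAr scalerN.
Qed.

(** The temporal coefficients satisfy their part of the law because they are
    Christoffel symbols of [h]; the law of the spatial ones is left as a
    hypothesis. *)
Lemma canonical_transform_reduction c c' z : joverlap c c' z ->
  (forall b, (jacM c c' z)^T *m nl_term Gam c z 0 b *m (invmx (jacT c c' z))^T =
     ('D_b (cjac c.2 c'.2) z.1.2)^T *m z.2 *m (invmx (jacT c c' z))^T
     + nl_term Gam c' (jtrans c c' z) 0 (b *m jacM c c' z)) ->
  forall v, ver Gam c' (jtrans c c' z) (djtrans c c' z v) =
  (jacM c c' z)^T *m ver Gam c z v *m (invmx (jacT c c' z))^T.
Proof.
move=> zc Nlaw v; have zd := joverlap_sub zc; have zd' := jtrans_dom zc.
have [zT zM] := zc; have uB := jacT_unit zc.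
have KB := Tconn_transform hh v.1.1 zT; rewrite -/(jacT c c' z) in KB.
rewrite /ver nl_term_split [in RHS]nl_term_split.
rewrite (canonical_M _ zd) (canonical_M _ zd').
have := Nlaw v.1.2; rewrite -/(djacM c c' z v).
have -> : nl_term Gam c' (jtrans c c' z) 0 (v.1.2 *m jacM c c' z) =
  nl_term Gam c' (jtrans c c' z) 0 (djtrans c c' z v).1.2 by [].
move: (nl_term _ _ _ _ _) (nl_term _ _ _ _ _) => N N'.
rewrite /= (cjac_inv zT) -/(jacT c c' z).
rewrite -/(djacM c c' z v) -/(djacT c c' z v) -/(jacM c c' z).
move: KB; rewrite -/(djacT c c' z v).
move: (jacM c c' z) (djacM c c' z v) (jacT c c' z) uB (djacT c c' z v) => A dA B uB dB.
move: (Tconn _ _ _ _) (Tconn _ _ _ _) => K K' KB NL.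
rewrite !mulmxDr !mulmxDl NL.
have KI : invmx B *m K' = invmx B *m dB *m invmx B + K *m invmx B.
  by rewrite -[LHS](mulmxK uB) -[_ *m K' *m B]mulmxA KB mulmxDr mulmxA mulVmx // mul1mx mulmxDl.
move: KI => /(congr1 trmx); rewrite linearD /= [in LHS]trmx_mul [X in _ + X]trmx_mul => KI.
have -> : A^T *m - (z.2 *m K'^T) *m (invmx B)^T = - (A^T *m z.2 *m (K'^T *m (invmx B)^T)).
  by rewrite mulmxN mulNmx !mulmxA.
rewrite KI !mulmxDr !mulmxA opprD.
by apply/matrixP => i j; rewrite !mxE; ring.
Qed.

Lemma vertical_frame (w : 'M[R]_(n, p)) :
  (0, 0, w) = \sum_i \sum_a w i a *: eu i a :> V.
Proof.
rewrite [LHS]jcoord_frame /= [X in X + _ + _]big1 => [|a _]; last first.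
  by rewrite [_ 0 a]mxE scale0r.
by rewrite add0r big1 ?add0r // => i _; rewrite [_ 0 i]mxE scale0r.
Qed.

Lemma ex_sum (b : 'rV[R]_n) : (0, b, 0) = \sum_j b 0 j *: ex j :> V.
Proof.
rewrite [LHS]jcoord_frame /= [X in X + _ + _]big1 => [|a _]; last first.
  by rewrite [_ 0 a]mxE scale0r.
rewrite add0r [X in _ + X]big1 ?addr0 // => i _; rewrite big1 // => a _.
by rewrite [_ i a]mxE scale0r.
Qed.

Lemma et_sum (a : 'rV[R]_p) : (a, 0, 0) = \sum_j a 0 j *: et j :> V.
Proof.
rewrite [LHS]jcoord_frame /= [X in _ + X + _]big1 => [|i _]; last first.
  by rewrite [_ 0 i]mxE scale0r.
rewrite addr0 [X in _ + X]big1 ?addr0 // => i _; rewrite big1 // => e _.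
by rewrite [_ i e]mxE scale0r.
Qed.

Lemma djtrans_spatial c c' z (b : 'rV[R]_n) :
  djtrans c c' z (0, b, 0) = (0, b *m jacM c c' z,
    ('D_b (cjac c.2 c'.2) z.1.2)^T *m z.2 *m (invmx (jacT c c' z))^T).
Proof.
have dT : djacT c c' z (0, b, 0) = 0 by rewrite /djacT derive0.
rewrite /djtrans dT; congr (_, _, _); first exact: mul0mx.
have -> : invmx (jacT c c' z) *m 0 *m invmx (jacT c c' z) = 0 by rewrite mulmx0 mul0mx.
by rewrite trmx0 !mulmx0 subr0 addr0.
Qed.

Lemma djtrans_vertical c c' z (w : 'M[R]_(n, p)) :
  djtrans c c' z (0, 0, w) =
  (0, 0, (jacM c c' z)^T *m w *m (invmx (jacT c c' z))^T).
Proof.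
have dT : djacT c c' z (0, 0, w) = 0 by rewrite /djacT derive0.
rewrite /djtrans dT djacM0 //; congr (_, _, _); [exact: mul0mx|exact: mul0mx|].
have -> : invmx (jacT c c' z) *m 0 *m invmx (jacT c c' z) = 0 by rewrite mulmx0 mul0mx.
by rewrite !trmx0 mulmx0 subr0 mul0mx add0r.
Qed.

Definition momentum (F : function_family T M) c z : 'M[R]_(n, p) :=
  \matrix_(i, a) du i a (F c) z.

Lemma momentum_smooth c : smooth_on (jdom c) (momentum L c).
Proof.
apply: smooth_mx => [|i a]; first exact: jdom_open.
have -> : (fun z => momentum L c z i a) = du i a (L c).
  by apply/funext => z; rewrite mxE.
exact/smooth_derive/lagrange_smooth.
Qed.

Lemma derive_L_transform c c' z v : joverlap c c' z ->
  'D_v (L c) z = 'D_(djtrans c c' z v) (L c') (jtrans c c' z).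
Proof.
move=> zc; have dL := smooth_differentiable (lagrange_smooth (c := c')) (jtrans_dom zc).
have [_ <-] := derive_comp_jtrans zc v dL.
apply: (open_derive_eq _ (@joverlap_open R p n T M c c') _ zc) => y.
by rewrite inE; apply: lagrange_transform.
Qed.

(** The change of jet coordinates is linear along the fibres. *)
Lemma momentum_transform c c' z : joverlap c c' z ->
  momentum L c z = jacM c c' z *m momentum L c' (jtrans c c' z) *m invmx (jacT c c' z).
Proof.
move=> zc.
have dL := smooth_differentiable (lagrange_smooth (c := c')) (jtrans_dom zc).
apply/matrixP => k e; rewrite [LHS]mxE /du (derive_L_transform _ zc).
rewrite [djtrans _ _ _ _]djtrans_vertical.
rewrite vertical_frame (derive_dir_sum _ _ _ dL).
move: (jacM c c' z) (invmx _) => P Q.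
under eq_bigr do rewrite (derive_dir_sum _ _ _ dL).
rewrite exchange_big mxE /=; apply: eq_bigr => f _.
rewrite mxE mulr_suml; apply: eq_bigr => l _.
rewrite [momentum _ _ _ _ _]mxE mulmx_delta_mulmx ![_^T _ _]mxE mulrAC.
exact: (derive_dirZ _ _ dL).
Qed.

End Canonical.

(** * Spatial coefficients for several times *)

Section MultiTime.
Context {R : realType} {p n : nat}.
Context {T : smooth_manifold R p} {M : smooth_manifold R n}.
Local Notation V := (jcoord R p n).
Variables (h : metric_family T) (L : function_family T M) (g : dtensor_family T M).
Implicit Types (c : jchart T M) (z v : V) (X Y : V -> V) (U : set V).
Local Notation Gam := (canonical_nonlinear h L g).

Hypothesis hh : semi_riemannian h.
Hypothesis hL : metrical_lagrange_space h L g.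

Let oU c : open (jdom c). Proof. exact: jdom_open. Qed.

Lemma inverse_metric_smooth c a b : smooth_on (jdom c) (fun z : V => invmx (h c.1 z.1.1) a b : R).
Proof.
apply: (smooth_tbase (F := fun t => invmx (h c.1 t) a b : R)).
apply: smooth_coord; first exact: cimage_open.
apply: smooth_invmx; [exact: cimage_open|by move=> t; apply: (h_unit hh)|exact: (h_smooth hh)].
Qed.

(** A further derivative of Kronecker regularity along the fibre, where [h] is
    constant. *)
Lemma hessian_vertical c z k e i a j b : jdom c z ->
  du k e (du i a (du j b (L c))) z =
  2%:R * (invmx (h c.1 z.1.1) a b * ('D_(eu k e) (g c) z) i j).
Proof.
move=> zc.
have gd := g_diff (lagrange_dtensor hL) zc.
pose q (w : V) : R := 2%:R * invmx (h c.1 w.1.1) a b.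
have sq : smooth_on (jdom c) q.
  by apply: smoothM => //; [exact: smooth_cst|exact: inverse_metric_smooth].
have dq := smooth_differentiable sq zc.
have dg : differentiable (fun w => g c w i j : R) z by apply: differentiable_entry.
have -> : du k e (du i a (du j b (L c))) z =
   'D_(eu k e) (q * (fun w => g c w i j : R)) z.
  apply: (@open_derive_eq R V _ (jdom c) _ _ (eu k e) z (@oU c) _ zc) => w.
  rewrite inE => wc; rewrite (lagrange_hessian hL) // mulrA.
  by [].
rewrite deriveM; try exact: diff_derivable.
have -> : 'D_(eu k e) q z = 0.
  apply: etrans (derive_linear_pre (fun t => 2%:R * invmx (h c.1 t) a b : R)
    (@tproj_linear R p n) z (eu k e)) _.
  exact: derive0.
by rewrite scaler0 addr0 -(derive_coord _ _ _ gd) mulrA.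
Qed.

(** The third vertical derivatives of [L] are symmetric in three pairs of
    indices, whereas Kronecker regularity separates temporal from spatial ones;
    exchanging pairs and contracting with [h] multiplies by [p] each time,
    so that [p ^ 2 = 1] unless the derivative vanishes. *)
Lemma g_vertical_const c z k e : (1 < p)%N -> jdom c z -> 'D_(eu k e) (g c) z = 0.
Proof.
move=> p1 zc; have zt : cimage c.1 z.1.1 by case: zc.
pose X k e i j := ('D_(eu k e) (g c) z) i j.
have sL := lagrange_smooth hL (c := c).
have swap1 (k' : 'I_n) (e' : 'I_p) i a j b : invmx (h c.1 z.1.1) a b * X k' e' i j =
    invmx (h c.1 z.1.1) e' b * X i a k' j.
  have two0 : (2%:R : R) != 0 by rewrite pnatr_eq0.
  apply: (mulfI two0).
  have e1 := hessian_vertical k' e' i a j b zc.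
  have e2 := hessian_vertical i a k' e' j b zc.
  have sF : smooth_on (jdom c) (du j b (L c)) by apply: smooth_derive.
  have sw := derive_swap (eu k' e') (eu i a) (@oU c) zc sF.
  exact: etrans (esym e1) (etrans sw e2).
(* contraction of the two temporal indices of [swap1] with [h] *)
have contr k' e' i j : p%:R * X k' e' i j = X i e' k' j.
  have hV := mulVmx (h_unit hh zt).
  have S a f : \sum_b invmx (h c.1 z.1.1) a b * h c.1 z.1.1 b f = (a == f)%:R.
    by have /matrixP /(_ a f) := hV; rewrite !mxE.
  transitivity (\sum_a \sum_b (invmx (h c.1 z.1.1) a b * X k' e' i j) * h c.1 z.1.1 b a).
    rewrite -[p in p%:R]card_ord -sumr_const mulr_suml; apply: eq_bigr => a _.
    transitivity ((\sum_b invmx (h c.1 z.1.1) a b * h c.1 z.1.1 b a) * X k' e' i j).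
      by rewrite S eqxx.
    by rewrite mulr_suml; apply: eq_bigr => b _; rewrite mulrAC.
  under eq_bigr => a _ do under eq_bigr => b _ do rewrite swap1.
  transitivity (\sum_a (\sum_b invmx (h c.1 z.1.1) e' b * h c.1 z.1.1 b a) * X i a k' j).
    apply: eq_bigr => a _; rewrite mulr_suml; apply: eq_bigr => b _.
    by rewrite mulrAC.
  rewrite (bigD1 e') //= S eqxx mul1r big1 ?addr0 // => a ae.
  by rewrite S eq_sym (negbTE ae) mul0r.
apply/matrixP => i j; rewrite [RHS]mxE -/(X k e i j).
have E : (p%:R ^+ 2 - 1) * X k e i j = 0.
  by rewrite mulrBl mul1r expr2 -mulrA contr contr subrr.
have : (p%:R ^+ 2 - 1 : R) != 0.
  rewrite subr_eq0 -natrX -[1]/(1%:R) eqr_nat gtn_eqF //.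
  by rewrite (@leq_trans (p ^ 1)) // leq_exp2l.
by move: E => /eqP; rewrite mulf_eq0 => /orP[-> //|/eqP].
Qed.

Lemma g_vertical c z (w : 'M[R]_(n, p)) : (1 < p)%N -> jdom c z ->
  'D_((0, 0, w) : V) (g c) z = 0.
Proof.
move=> p1 zc; have gd := g_diff (lagrange_dtensor hL) zc.
rewrite vertical_frame (derive_dir_sum _ _ _ gd) big1 // => i _.
rewrite (derive_dir_sum _ _ _ gd) big1 // => a _.
by rewrite (derive_dirZ _ _ gd) g_vertical_const // scaler0.
Qed.

Definition Umx c z : 'M[R]_(n, p) := \matrix_(i, a) Ucoef L c a i z.

Lemma zero_section_linear : linear (fun z : V => (z.1, 0) : V).
Proof. by move=> k x y; congr (_, _); rewrite /= scaler0 addr0. Qed.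

Lemma zero_section_continuous : continuous (fun z : V => (z.1, 0) : V).
Proof.
move=> x; apply: differentiable_continuous; apply: differentiable_pair.
  by case: (@linear_derive R V _ (fun z : V => z.1) _ _ x 0) => // y; exact: cvg_fst.
exact: differentiable_cst.
Qed.

Lemma Umx_smooth c : smooth_on (jdom c) (Umx c).
Proof.
apply: smooth_mx => // i a.
have -> : (fun z => Umx c z i a) = (du i a (L c)) \o (fun z : V => (z.1, 0) : V).
  by apply/funext => z; rewrite mxE.
have sL : smooth_on (jdom c) (du i a (L c)) by apply/smooth_derive/(lagrange_smooth hL).
exact: (smooth_linear_pre zero_section_linear zero_section_continuous sL).
Qed.

Lemma Umx_vertical c z (w : 'M[R]_(n, p)) : 'D_((0, 0, w) : V) (Umx c) z = 0.
Proof.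
have -> : Umx c = Umx c \o (fun z : V => (z.1, 0) : V).
  by apply/funext => y; apply/matrixP => i a; rewrite !mxE.
rewrite (derive_linear_pre _ zero_section_linear).
by rewrite -[X in derive _ _ X]/(0 : V) derive0.
Qed.

(** [U] is the value of the momenta on the zero section, which the changes of
    coordinates preserve. *)
Lemma Umx_transform c c' z : joverlap c c' z ->
  Umx c z = jacM c c' z *m Umx c' (jtrans c c' z) *m invmx (jacT c c' z).
Proof.
move=> zc; have z0c : joverlap c c' (z.1, 0) by [].
have UE d y : Umx d y = momentum L d (y.1, 0) by apply/matrixP => i a; rewrite !mxE.
have E0 : jtrans c c' (z.1, 0) = ((jtrans c c' z).1, 0).
  by rewrite /jtrans /= mulmx0 mul0mx.
by rewrite !UE -E0 (momentum_transform hL z0c).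
Qed.

Lemma Umx_diff c z : jdom c z -> differentiable (Umx c) z.
Proof. by apply: smooth_differentiable; apply: Umx_smooth. Qed.

(** The part of [curl] in which the direction [b] is contracted with [U] instead of
    being the direction of the derivative. *)
Definition curl_row d y (b : 'rV[R]_n) : 'M[R]_(n, p) :=
  \matrix_(k, e) (b *m 'D_(ex k) (Umx d) y) 0 e.

(** The exterior derivative in [x] of the one-forms [U], contracted with [b]. *)
Definition curl c z (b : 'rV[R]_n) : 'M[R]_(n, p) :=
  'D_((0, b, 0) : V) (Umx c) z - curl_row c z b.

Lemma row_of_rows k l (F : 'I_k -> 'rV[R]_l) i : row i (\matrix_(i, j) F i 0 j) = F i.
Proof. by apply/rowP => j; rewrite !mxE. Qed.

Lemma row_curl_row d y b k : row k (curl_row d y b) = b *m 'D_(ex k) (Umx d) y.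
Proof. exact: (row_of_rows (fun k => b *m 'D_(ex k) (Umx d) y)). Qed.

(** The Levi-Civita connection matrix of [g] in the variables [x], along [b]. *)
Definition xconn c z (b : 'rV[R]_n) : 'M[R]_n :=
  \sum_j b 0 j *: koszul_mx (g c z) (fun l => 'D_(ex l) (g c) z) j.

(** The tensorial summands of [N], contracted with [b], before [g] raises their
    index. *)
Definition Nforce c z (b : 'rV[R]_n) : 'M[R]_(n, p) :=
  2%:R^-1 *: (\matrix_(k, a) (b *m 'D_(et a) (g c) z) 0 k)
  + 4%:R^-1 *: (curl c z b *m (h c.1 z.1.1)^T).

Lemma curlE c z (b : 'rV[R]_n) k e : jdom c z ->
  \sum_j b 0 j * Ucurl L c e k j z = curl c z b k e.
Proof.
move=> zc; have dU := Umx_diff zc.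
have E v i a : 'D_v (Ucoef L c a i) z = ('D_v (Umx c) z) i a.
  rewrite (derive_coord _ _ _ dU).
  by have -> : (fun y => Umx c y i a) = Ucoef L c a i by apply/funext => y; rewrite mxE.
rewrite /curl /curl_row [RHS]mxE [X in _ = _ + X]mxE [X in _ = _ - X]mxE ex_sum.
rewrite (derive_dir_sum _ _ _ dU) summxE [X in _ = _ - X]mxE -sumrB.
apply: eq_bigr => j _; rewrite /Ucurl /dx !E (derive_dirZ _ _ dU).
by rewrite [X in _ = X - _]mxE mulrBr.
Qed.

Lemma canonical_N_multi_time c z b : (1 < p)%N -> jdom c z ->
  nl_term Gam c z 0 b = (xconn c z b)^T *m z.2 + invmx (g c z) *m Nforce c z b.
Proof.
move=> p1 zc; have gd := g_diff (lagrange_dtensor hL) zc.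
have gs := lagrange_g_sym hL zc.
rewrite /nl_term [X in X + _]big1 => [|e _]; last by rewrite [_ 0 e]mxE scale0r.
rewrite add0r; apply/matrixP => i a; rewrite summxE [RHS]mxE.
have E1 : ((xconn c z b)^T *m z.2) i a =
  \sum_j b 0 j * \sum_k gChristoffel g c z i j k * z.2 k a.
  under [RHS]eq_bigr do rewrite mulr_sumr.
  rewrite mxE exchange_big /=; apply: eq_bigr => k _.
  rewrite [_^T _ _]mxE /xconn summxE mulr_suml; apply: eq_bigr => j _.
  rewrite [X in X * _]mxE mulrA; congr (_ * _ * _).
  rewrite [LHS]mxE koszul_sym; last by move=> l; apply: (dg_sym (lagrange_dtensor hL) (lagrange_g_sym hL)).
  apply: eq_bigr => l _; rewrite /dx.
  have Ed v (r q : 'I_n) : ('D_v (g c) z) r q = 'D_v (fun w => g c w r q) z.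
    exact: derive_coord.
  by congr (_ * (_ + _ - _)); exact: Ed.
have E2 : (invmx (g c z) *m Nforce c z b) i a =
  \sum_j b 0 j * (\sum_k invmx (g c z) i k / 2%:R * dt a (fun w => g c w j k) z
   + \sum_k invmx (g c z) i k / 4%:R * \sum_e h c.1 z.1.1 a e * Ucurl L c e k j z).
  under [RHS]eq_bigr do rewrite mulrDr !mulr_sumr.
  rewrite big_split /= [X in _ = X + _]exchange_big [X in _ = _ + X]exchange_big /=.
  rewrite mxE -big_split /=; apply: eq_bigr => k _.
  rewrite /Nforce [X in _ * X]mxE mulrDr; congr (_ + _).
    rewrite [X in _ * X]mxE [X in _ * (_ * X)]mxE [X in _ * (_ * X)]mxE !mulr_sumr.
    apply: eq_bigr => j _; rewrite /dt -(derive_coord _ _ _ gd).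
    by move: (_ j k) => d; ring.
  rewrite [X in _ * X]mxE [X in _ * (_ * X)]mxE !mulr_sumr.
  transitivity (\sum_e \sum_j b 0 j * (invmx (g c z) i k / 4%:R * (h c.1 z.1.1 a e * Ucurl L c e k j z))).
    apply: eq_bigr => e _; rewrite -(curlE _ _ _ zc) [_^T _ _]mxE mulr_suml !mulr_sumr.
    by apply: eq_bigr => j _; ring.
  rewrite exchange_big; apply: eq_bigr => j _ /=.
  by rewrite !mulr_sumr.
rewrite E1 E2 -big_split /=; apply: eq_bigr => j _.
rewrite [LHS]mxE -mulrDr; congr (_ * _).
by rewrite [LHS]mxE /= /Ncan gtn_eqF // addrA.
Qed.

Lemma derive_drop_vertical (W : normedModType R) (F : V -> W) z
    (a : 'rV[R]_p) (b : 'rV[R]_n) (w : 'M[R]_(n, p)) :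
  differentiable F z -> (forall w : 'M[R]_(n, p), 'D_((0, 0, w) : V) F z = 0) ->
  'D_((a, b, w) : V) F z = 'D_((a, b, 0) : V) F z.
Proof.
move=> dF F0.
have -> : (a, b, w) = (a, b, 0) + (0, 0, w) :> V.
  by congr (_, _, _); rewrite /= ?addr0 ?add0r.
by rewrite (derive_dirD _ _ dF) F0 addr0.
Qed.

Section Overlap.
Variables (c c' : jchart T M) (z : V).
Hypotheses (p1 : (1 < p)%N) (zc : joverlap c c' z).
Local Notation A := (jacM c c' z).
Local Notation B := (jacT c c' z).
Local Notation z' := (jtrans c c' z).

Let zd : jdom c z. Proof. exact: joverlap_sub zc. Qed.
Let zd' : jdom c' z'. Proof. exact: jtrans_dom. Qed.
Let uA : A \in unitmx. Proof. exact: jacM_unit. Qed.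
Let uB : B \in unitmx. Proof. exact: jacT_unit. Qed.
Let dg' : differentiable (g c') z'.
Proof. exact: (g_diff (lagrange_dtensor hL) zd'). Qed.
Let dU' : differentiable (Umx c') z'. Proof. exact: Umx_diff. Qed.

Lemma derive_g_et a : 'D_((a, 0, 0) : V) (g c) z =
  A *m 'D_((a *m B, 0, 0) : V) (g c') z' *m A^T.
Proof.
rewrite (derive_g_transform (lagrange_dtensor hL) zc) djacM0 // trmx0 !mul0mx !mulmx0.
rewrite add0r addr0 /djtrans (derive_drop_vertical _ _ _ dg'); last first.
  by move=> w; apply: g_vertical.
by rewrite mul0mx.
Qed.

Lemma derive_g_ex b : 'D_((0, b, 0) : V) (g c) z =
  'D_b (cjac c.2 c'.2) z.1.2 *m g c' z' *m A^T
  + A *m 'D_((0, b *m A, 0) : V) (g c') z' *m A^T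
  + A *m g c' z' *m ('D_b (cjac c.2 c'.2) z.1.2)^T.
Proof.
rewrite (derive_g_transform (lagrange_dtensor hL) zc) /djtrans.
rewrite (derive_drop_vertical _ _ _ dg'); last by move=> w; apply: g_vertical.
by rewrite mul0mx.
Qed.

Lemma derive_Umx_ex b : 'D_((0, b, 0) : V) (Umx c) z =
  ('D_b (cjac c.2 c'.2) z.1.2 *m Umx c' z'
   + A *m 'D_((0, b *m A, 0) : V) (Umx c') z') *m invmx B.
Proof.
have [_ zM] := zc.
pose v : V := (0, b, 0).
have [dA DA] := derive_base v (@xproj_linear R p n) (@xproj_continuous R p n)
  (cjac_differentiable zM).
have [dBi DBi] := derive_cjac_back zc v.
have [dU DU] := derive_comp_jtrans zc v dU'.
have [d1 D1] := derive_mulmx v dA dU.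
have [_ D2] := derive_mulmx v d1 dBi.
have -> : 'D_v (Umx c) z = 'D_v (fun y : V => cjac c.2 c'.2 y.1.2 *m Umx c' (jtrans c c' y)
    *m cjac c'.1 c.1 (ctrans c.1 c'.1 y.1.1)) z.
  apply: (open_derive_eq _ (@joverlap_open R p n T M c c') _ zc) => y.
  rewrite inE => yc; rewrite (Umx_transform yc).
  by case: yc => yT _; rewrite (cjac_inv yT).
rewrite D2 D1 DA DU DBi.
have -> : djacT c c' z v = 0 by rewrite /djacT derive0.
have [zT _] := zc; rewrite (cjac_inv zT).
rewrite mulmx0 mul0mx oppr0 mulmx0 addr0.
have -> // : 'D_(djtrans c c' z v) (Umx c') z' = 'D_((0, b *m A, 0) : V) (Umx c') z'.
have -> : djtrans c c' z v = (0, b *m A, (djtrans c c' z v).2).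
  by rewrite /djtrans /= mul0mx.
by apply: (derive_drop_vertical _ _ _ dU') => w; apply: Umx_vertical.
Qed.

Lemma curl_row_transform b :
  curl_row c z b = ('D_b (cjac c.2 c'.2) z.1.2 *m Umx c' z'
    + A *m curl_row c' z' (b *m A)) *m invmx B.
Proof.
have [_ zM] := zc.
apply/row_matrixP => k; rewrite row_mul row_curl_row derive_Umx_ex mulmxA.
congr (_ *m _); rewrite mulmxDr [RHS]linearD /=; congr (_ + _).
  rewrite mulmxA (derive_cjac_sym (delta_mx 0 k) b zM) row_mul rowE.
  by [].
rewrite row_mul mulmxA ex_sum (derive_dir_sum _ _ _ dU') mulmx_sumr [RHS]mulmx_sum_row.
apply: eq_bigr => l _; rewrite (derive_dirZ _ _ dU') -scalemxAr row_curl_row.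
by rewrite -rowE.
Qed.

(** The Hessian terms of the two parts agree by symmetry of second derivatives. *)
Lemma curl_transform b : curl c z b = A *m curl c' z' (b *m A) *m invmx B.
Proof.
rewrite /curl curl_row_transform derive_Umx_ex -mulmxBl mulmxBr.
by rewrite opprD addrACA subrr add0r.
Qed.

Lemma Nforce_transform b : Nforce c z b = A *m Nforce c' z' (b *m A) *m B^T.
Proof.
have [zT _] := zc.
rewrite /Nforce mulmxDr mulmxDl -!scalemxAr -!scalemxAl; congr (_ *: _ + _ *: _).
  apply/matrixP => k a; rewrite [LHS]mxE.
  have -> : et a = (delta_mx 0 a, 0, 0) :> V by [].
  rewrite derive_g_et et_sum (derive_dir_sum _ _ _ dg').
  rewrite mulmx_sumr mulmx_suml mulmx_sumr summxE.
  rewrite mxE; apply: eq_bigr => e _.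
  rewrite (derive_dirZ _ _ dg') -rowE -scalemxAr -scalemxAl -scalemxAr.
  rewrite [LHS]mxE [B^T e a]mxE [row a B 0 e]mxE mulrC; congr (_ * _).
  rewrite !mulmxA [LHS]mxE [RHS]mxE; apply: eq_bigr => l _.
  by rewrite [X in _ = _ * X]mxE [A^T l k]mxE mulrC.
rewrite curl_transform -!mulmxA; congr (_ *m (_ *m _)).
case: hh => _ hE _ _; rewrite [h c.1 _](hE _ _ _ zT) -/(jacT c c' z).
by rewrite !trmx_mul trmxK !mulmxA mulVmx // mul1mx.
Qed.

(** As [g] does not depend on the fibre coordinates, it transforms like a metric
    that depends on [x] alone. *)
Lemma xconn_transform b :
  xconn c z b *m A = 'D_b (cjac c.2 c'.2) z.1.2 + A *m xconn c' z' (b *m A).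
Proof.
have [_ zM] := zc.
have dA := cjac_differentiable zM.
have gT := lagrange_dtensor hL.
have gs := lagrange_g_sym hL.
have DE k : 'D_(ex k) (g c) z =
  'D_(delta_mx 0 k) (cjac c.2 c'.2) z.1.2 *m g c' z' *m A^T
  + A *m (\sum_l A k l *: 'D_(ex l) (g c') z') *m A^T
  + A *m g c' z' *m ('D_(delta_mx 0 k) (cjac c.2 c'.2) z.1.2)^T.
  rewrite [LHS](derive_g_ex (delta_mx 0 k)) ex_sum (derive_dir_sum _ _ _ dg').
  congr (_ + _ *m _ *m _ + _); apply: eq_bigr => l _.
  by rewrite (derive_dirZ _ _ dg') -rowE [row k _ 0 l]mxE.
have key k := koszul_transform k (gs _ _ zd) (gs _ _ zd') (lagrange_g_unit hL zd') uA
  (g_transform gT zc) (fun l => dg_sym gT gs (ex l) zd') DE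
  (fun k i e => derive_cjac_sym_entry k i e zM).
have DA : 'D_b (cjac c.2 c'.2) z.1.2 =
    \sum_k b 0 k *: 'D_(delta_mx 0 k) (cjac c.2 c'.2) z.1.2.
  rewrite [in LHS](row_sum_delta b) (derive_dir_sum _ _ _ dA).
  by apply: eq_bigr => k _; rewrite (derive_dirZ _ _ dA).
rewrite /xconn mulmx_suml DA -sum_scale_mulmx mulmx_sumr -big_split /=.
apply: eq_bigr => k _.
by rewrite -scalemxAl key -scalemxAr scalerDr.
Qed.

(** Only the Levi-Civita part has an inhomogeneous term. *)
Lemma Ncoef_transform_multi_time b :
  A^T *m nl_term Gam c z 0 b *m (invmx B)^T =
  ('D_b (cjac c.2 c'.2) z.1.2)^T *m z.2 *m (invmx B)^T + nl_term Gam c' z' 0 (b *m A).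
Proof.
have [zT _] := zc.
rewrite !canonical_N_multi_time // Nforce_transform mulmxDr mulmxDl.
have ug' := lagrange_g_unit hL zd'.
have -> : z'.2 = A^T *m z.2 *m (invmx B)^T by rewrite /= (cjac_inv zT).
rewrite (g_transform (lagrange_dtensor hL) zc) addrA; congr (_ + _).
  have /(congr1 trmx) := xconn_transform b; rewrite linearD /= !trmx_mul => E.
  by rewrite mulmxA E !mulmxDl !mulmxA.
move: (Nforce _ _ _) => F.
have uS : A *m g c' z' *m A^T \in unitmx by rewrite !unitmx_mul uA ug' unitmx_tr uA.
have -> : invmx (A *m g c' z' *m A^T) *m (A *m F *m B^T) =
    invmx A^T *m (invmx (g c' z') *m F) *m B^T.
  rewrite -[RHS](mulKmx uS); congr (_ *m _); rewrite !mulmxA.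
  by rewrite mulmxK ?unitmx_tr // mulmxK.
rewrite -!mulmxA -trmx_mul mulVmx // trmx1 mulmx1.
by rewrite mulKVmx ?unitmx_tr.
Qed.

End Overlap.
End MultiTime.

(** * Smoothness of the spatial coefficients *)

Section NSmooth.
Context {R : realType} {p n : nat}.
Context {T : smooth_manifold R p} {M : smooth_manifold R n}.
Local Notation V := (jcoord R p n).
Variables (h : metric_family T) (L : function_family T M) (g : dtensor_family T M).
Implicit Types (c : jchart T M) (z v : V) (X Y : V -> V) (U : set V).
Local Notation Gam := (canonical_nonlinear h L g).

Hypothesis hh : semi_riemannian h.
Hypothesis hL : metrical_lagrange_space h L g.

Let oU c : open (jdom c). Proof. exact: jdom_open. Qed.

Lemma christoffel_smooth c e a b :
  smooth_on (jdom c) (fun z : V => christoffel h c.1 z.1.1 e a b).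
Proof.
have s1 : smooth_on (cimage c.1) (fun t => koszul_mx (h c.1 t) (dh h c.1 t) b a e : R).
  apply: smooth_coord; [exact: cimage_open|exact: (koszul_h_smooth hh)].
have s2 := smooth_tbase s1.
apply: smooth_ext (@oU c) _ s2 => z; rewrite inE => -[zt _].
by rewrite (christoffelE hh).
Qed.

Lemma spray_smooth c a i : smooth_on (jdom c) (spray h L g c a i).
Proof.
have sL := lagrange_smooth hL (c := c).
have sg := g_smooth (lagrange_dtensor hL) (c := c).
have sgi : smooth_on (jdom c) (fun z => invmx (g c z)).
  by apply: smooth_invmx => // z; apply: (lagrange_g_unit hL).
have sH := christoffel_smooth (c := c) a a a.
have su : smooth_on (jdom c) (fun z : V => z.2).
  by apply: smooth_linear; [exact: uproj_linear|exact: uproj_continuous].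
have shi : smooth_on (jdom c) (fun z : V => invmx (h c.1 z.1.1) a a : R).
  apply: (smooth_tbase (F := fun t => invmx (h c.1 t) a a : R)).
  apply: smooth_coord; first exact: cimage_open.
  apply: smooth_invmx; [exact: cimage_open|by move=> t; apply: (h_unit hh)|exact: (h_smooth hh)].
rewrite /spray; apply: smooth_sum => // k _.
apply: smoothM => //.
  by apply: smoothM; [|exact: smooth_coord|exact: smooth_cst].
have sdu : smooth_on (jdom c) (du k a (L c)) by apply: smooth_derive.
apply: smoothD => //; last first.
  apply: smoothM => //.
    apply: smoothM => //; apply: smoothM => //; exact: smooth_cst.
  apply: smooth_sum => // l _.
  apply: smoothM => //; exact: smooth_coord.
apply: smoothD => //; last by apply: smoothM.
apply: smoothD => //; last exact: smooth_derive.
apply: smoothB => //; last exact: smooth_derive.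
apply: smooth_sum => // j _; apply: smoothM => //; first exact: smooth_derive.
exact: smooth_coord.
Qed.

Lemma canonical_Nsmooth c j : smooth_on (jdom c) (fun z => Nmx Gam c z j).
Proof.
apply: smooth_mx => // i a.
have -> : (fun z => Nmx Gam c z j i a) = (fun z => Ncan h L g c z i a j).
  by apply/funext => z; rewrite mxE.
have sL := lagrange_smooth hL (c := c).
have sg := g_smooth (lagrange_dtensor hL) (c := c).
have sgi : smooth_on (jdom c) (fun z => invmx (g c z)).
  by apply: smooth_invmx => // z; apply: (lagrange_g_unit hL).
have su : smooth_on (jdom c) (fun z : V => z.2).
  by apply: smooth_linear; [exact: uproj_linear|exact: uproj_continuous].
have sh b e : smooth_on (jdom c) (fun z : V => h c.1 z.1.1 b e : R).
  apply: (smooth_tbase (F := fun t => h c.1 t b e : R)).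
  by apply: smooth_coord; [exact: cimage_open|exact: (h_smooth hh)].
rewrite /Ncan; have [p1|p1] := boolP (p == 1%N).
  apply: smoothM => //; apply: smooth_derive; exact: spray_smooth.
apply: smoothD => //; first apply: smoothD => //.
- apply: smooth_sum => // k _; apply: smoothM => //; last exact: smooth_coord.
  apply: smooth_sum => // l _; apply: smoothM => //.
    by apply: smoothM; [|exact: smooth_coord|exact: smooth_cst].
  by apply: smoothB => //; [apply: smoothD => //|]; apply: smooth_derive; apply: smooth_coord.
- apply: smooth_sum => // k _; apply: smoothM => //.
    by apply: smoothM; [|exact: smooth_coord|exact: smooth_cst].
  by apply: smooth_derive; apply: smooth_coord.
apply: smooth_sum => // k _; apply: smoothM => //.
  by apply: smoothM; [|exact: smooth_coord|exact: smooth_cst].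
apply: smooth_sum => // e _; apply: smoothM => //.
have sU b l : smooth_on (jdom c) (Ucoef L c b l).
  have sD : smooth_on (jdom c) (du l b (L c)) by apply: smooth_derive.
  exact: (smooth_linear_pre (@zero_section_linear R p n) (@zero_section_continuous R p n) sD).
by apply: smoothB => //; apply: smooth_derive.
Qed.

End NSmooth.

(** * Spatial coefficients for one time: the Euler-Lagrange equation *)

Section SingleTime.
Context {R : realType} {n : nat}.
Context {T : smooth_manifold R 1} {M : smooth_manifold R n}.
Local Notation V := (jcoord R 1 n).
Variables (h : metric_family T) (L : function_family T M) (g : dtensor_family T M).
Implicit Types (c : jchart T M) (z v : V).
Local Notation Gam := (canonical_nonlinear h L g).
Local Notation tau := (delta_mx 0 0 : 'rV[R]_1).

Hypothesis hh : semi_riemannian h.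
Hypothesis hL : metrical_lagrange_space h L g.

Definition Hcoef c z : R := christoffel h c.1 z.1.1 0 0 0.
Definition hinv c z : R := invmx (h c.1 z.1.1) 0 0.

Definition xgrad c z : 'M[R]_(n, 1) := \matrix_(k, e) dx k (L c) z.

(** The Euler-Lagrange expression of the density [L sqrt |h|] minus
    [2 h^11 g (x'' - H x')], its part proportional to the covariant acceleration.
    The factor [Hcoef] of the momenta is the logarithmic derivative of
    [sqrt |h|]. *)
Definition euler c z : 'M[R]_(n, 1) :=
  'D_((tau, z.2^T, 0) : V) (momentum L c) z - xgrad c z
  + Hcoef c z *: momentum L c z
  + (2%:R * hinv c z * Hcoef c z) *: (g c z *m z.2).

(** The functions [spray], as a column. *)
Definition sprayv c z : 'M[R]_(n, 1) := 4%:R^-1 *: (invmx (g c z) *m euler c z).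

Lemma momentum_diff c z : jdom c z -> differentiable (momentum L c) z.
Proof. by apply: smooth_differentiable; apply: (momentum_smooth hL). Qed.

Lemma euler_entry (D X P Q : 'M[R]_(n, 1)) (a b : R) k :
  (D - X + a *: P + b *: Q) k 0 = D k 0 - X k 0 + a * P k 0 + b * Q k 0.
Proof. by rewrite !mxE. Qed.

Lemma sprayE c z i : jdom c z -> spray h L g c 0 i z = sprayv c z i 0.
Proof.
move=> zc; have dP := momentum_diff zc.
have E v k : 'D_v (du k 0 (L c)) z = ('D_v (momentum L c) z) k 0.
  rewrite (derive_coord _ _ _ dP).
  by have -> : (fun y => momentum L c y k 0) = du k 0 (L c) by apply/funext => y; rewrite mxE.
rewrite /spray [RHS]mxE [X in _ = _ * X]mxE [RHS]mulr_sumr; apply: eq_bigr => k _.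
rewrite [RHS]mulrA [_ ^-1 * _]mulrC; congr (_ * _).
rewrite /euler.
have -> : (tau, z.2^T, 0) = et 0 + \sum_j z.2^T 0 j *: ex j :> V.
  by rewrite -ex_sum; congr (_, _, _); rewrite /= ?addr0 ?add0r.
rewrite (derive_dirD _ _ dP) (derive_dir_sum _ _ _ dP) euler_entry.
have XE : xgrad c z k 0 = dx k (L c) z by rewrite mxE.
have PE : momentum L c z k 0 = du k 0 (L c) z by rewrite mxE.
have QE : (g c z *m z.2) k 0 = \sum_(l < n) g c z k l * z.2 l 0 by rewrite mxE.
rewrite XE PE QE -/(Hcoef c z) -/(hinv c z).
have DE : ('D_(et 0) (momentum L c) z + \sum_j 'D_(z.2^T 0 j *: ex j) (momentum L c) z) k 0
   = dt 0 (du k 0 (L c)) z + \sum_j dx j (du k 0 (L c)) z * z.2 j 0.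
  rewrite [LHS]mxE summxE; congr (_ + _); first exact: esym (E _ _).
  apply: eq_bigr => j _; rewrite (derive_dirZ _ _ dP) [LHS]mxE [_^T 0 j]mxE mulrC.
  congr (_ * _); exact: esym (E _ _).
by rewrite DE; ring.
Qed.

(** Kronecker regularity for a single temporal index. *)
Lemma momentum_vertical c z w : jdom c z ->
  'D_((0, 0, w) : V) (momentum L c) z = (2%:R * hinv c z) *: (g c z *m w).
Proof.
move=> zc; have dP := momentum_diff zc.
rewrite vertical_frame (derive_dir_sum _ _ _ dP).
apply/matrixP => k e; rewrite (ord1 e) summxE [RHS]mxE [X in _ = _ * X]mxE mulr_sumr.
apply: eq_bigr => i _; rewrite big_ord1 (derive_dirZ _ _ dP) [LHS]mxE.
have -> : ('D_(eu i 0) (momentum L c) z) k 0 = du i 0 (du k 0 (L c)) z.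
  rewrite (derive_coord _ _ _ dP).
  by have -> : (fun y => momentum L c y k 0) = du k 0 (L c) by apply/funext => y; rewrite mxE.
rewrite (lagrange_hessian hL) // -/(hinv c z).
have -> : g c z i k = g c z k i by rewrite -[in LHS](lagrange_g_sym hL zc) mxE.
by ring.
Qed.

(** A derivative along the fibre is computed with the base point fixed, where the
    Jacobians are constant. *)
Lemma derive_vertical_line (W : normedModType R) (F : V -> W) z (w : 'M[R]_(n, 1)) :
  'D_((0, 0, w) : V) F z = 'D_w (fun u => F (z.1, u)) z.2.
Proof.
rewrite /derive.
have -> // : (fun h => h^-1 *: ((F \o shift z) (h *: ((0, 0, w) : V)) - F z)) =
  (fun h => h^-1 *: (((fun u => F (z.1, u)) \o shift z.2) (h *: w) - F (z.1, z.2))).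
apply/funext => r; congr (_ *: (_ - _)) => /=; last by case: (z).
congr F; rewrite [LHS]surjective_pairing; congr pair.
rewrite [LHS]surjective_pairing [RHS]surjective_pairing; congr pair => /=;
  by rewrite scaler0 add0r.
Qed.

Lemma sprayv_smooth c : smooth_on (jdom c) (sprayv c).
Proof.
apply: smooth_mx => [|i e]; first exact: jdom_open.
apply: smooth_ext (@jdom_open R 1 n T M c) _ (spray_smooth hh hL (c := c) 0 i) => y.
by rewrite inE (ord1 e) => /sprayE ->.
Qed.

Lemma canonical_N_single_time c z b : jdom c z ->
  nl_term Gam c z 0 b = h c.1 z.1.1 0 0 *: 'D_((0, 0, b^T) : V) (sprayv c) z.
Proof.
move=> zc; have dS := smooth_differentiable (sprayv_smooth (c := c)) zc.
rewrite /nl_term [X in X + _]big1 => [|e _]; last by rewrite [_ 0 e]mxE scale0r.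
rewrite add0r vertical_frame (derive_dir_sum _ _ _ dS) scaler_sumr.
apply: eq_bigr => j _; rewrite big_ord1 (derive_dirZ _ _ dS) [b^T j 0]mxE scalerA mulrC -scalerA.
congr (_ *: _); apply/matrixP => i e; rewrite (ord1 e) [LHS]mxE [RHS]mxE /= /Ncan eqxx.
congr (_ * _); rewrite (derive_coord _ _ _ dS).
apply: (open_derive_eq _ (@jdom_open R 1 n T M c) _ zc) => y.
by rewrite inE; apply: sprayE.
Qed.

Section Overlap.
Variables (c c' : jchart T M) (z : V).
Hypothesis zc : joverlap c c' z.
Local Notation A := (jacM c c' z).
Local Notation z' := (jtrans c c' z).
Local Notation beta := (jacT c c' z 0 0).
Local Notation taub := (('D_tau (cjac c.1 c'.1) z.1.1) 0 0).
Local Notation Au := ('D_(z.2^T) (cjac c.2 c'.2) z.1.2).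

Let zd : jdom c z. Proof. exact: joverlap_sub zc. Qed.
Let zd' : jdom c' z'. Proof. exact: jtrans_dom. Qed.
Let uA : A \in unitmx. Proof. exact: jacM_unit. Qed.
Let zt : coverlap c.1 c'.1 z.1.1. Proof. by case: zc. Qed.
Let zx : coverlap c.2 c'.2 z.1.2. Proof. by case: zc. Qed.

Lemma jacT_scalar : jacT c c' z = beta%:M. Proof. exact: mx11_scalar. Qed.

Lemma beta_neq0 : beta != 0.
Proof.
have := jacT_unit zc; rewrite [X in X \in _ -> _]jacT_scalar.
by move: (jacT c c' z 0 0) => b; rewrite unitmxE det_scalar1 unitfE.
Qed.

Lemma invmx_jacT : invmx (jacT c c' z) = (beta^-1)%:M.
Proof. by rewrite [in LHS]jacT_scalar invmx_scalar. Qed.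

Lemma Tconn1 a t w : cimage a t -> Tconn h a t w 0 0 = w 0 0 * christoffel h a t 0 0 0.
Proof.
move=> at_; rewrite /Tconn big_ord1 [LHS]mxE; congr (_ * _).
exact: esym (christoffelE hh _ _ _ at_).
Qed.

Lemma Hcoef_transform : Hcoef c z * beta = taub + beta ^+ 2 * Hcoef c' z'.
Proof.
have zt' := ctrans_overlap zt.
have := Tconn_transform hh tau zt.
move=> /matrixP /(_ 0 0).
have T1 := Tconn1 tau (coverlap_sub zt).
have T2 := Tconn1 (tau *m jacT c c' z) (coverlap_sub zt').
move: T1 T2; rewrite -/(jacT c c' z).
move: (Tconn _ _ _ _) (Tconn _ _ _ _) => K' K T1 T2.
have -> : (K *m jacT c c' z) 0 0 = K 0 0 * beta by rewrite mxE big_ord1.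
rewrite T1 [X in X * _ * _]mxE !eqxx mul1r => ->.
rewrite [LHS]mxE; congr (_ + _).
rewrite [LHS]mxE big_ord1 T2 -rowE [row _ _ _ _]mxE.
by rewrite mulrA expr2.
Qed.

Lemma hinvE d y : jdom d y -> hinv d y = (h d.1 y.1.1 0 0)^-1.
Proof.
move=> [yt _]; rewrite /hinv [h d.1 y.1.1]mx11_scalar invmx_scalar.
by rewrite !mxE.
Qed.

Lemma h_transform : h c.1 z.1.1 0 0 = beta ^+ 2 * h c'.1 z'.1.1 0 0.
Proof.
case: hh => _ H _ _; rewrite (H _ _ _ zt) -/(jacT c c' z).
move: (jacT c c' z) => P; rewrite -/(z'.1.1).
by rewrite mxE big_ord1 [P^T 0 0]mxE mxE big_ord1; ring.
Qed.

Lemma hinv_transform : hinv c z = beta ^- 2 * hinv c' z'.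
Proof. by rewrite !hinvE // h_transform invfM. Qed.

(** The tangent vector [(1, x', 0)] of a curve without acceleration is mapped to a
    multiple of the corresponding vector, up to a vertical vector made of second
    derivatives of the changes of coordinates. *)
Lemma djtrans_euler :
  djtrans c c' z (tau, z.2^T, 0) = beta *: ((tau, z'.2^T, 0) : V)
   + (0, 0, beta^-1 *: (Au^T *m z.2) - (beta ^- 2 * taub) *: (A^T *m z.2)).
Proof.
have z2 : z'.2 = beta^-1 *: (A^T *m z.2).
  by rewrite /= (cjac_inv zt) -/(jacT c c' z) invmx_jacT tr_scalar_mx mul_mx_scalar.
have tM : djacT c c' z (tau, z.2^T, 0) = taub%:M by exact: mx11_scalar.
have b0 := beta_neq0.
have tj : tau *m jacT c c' z = beta *: tau.
  by rewrite [in LHS]jacT_scalar mul_mx_scalar.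
rewrite /djtrans tM invmx_jacT z2 /djacM -[(_, _, _).1.1]/tau tj.
rewrite -[(_, _, _).1.2]/(z.2^T) -[(_, _, _).2]/(0 : 'M[R]_(n, 1)).
move: (jacT c c' z 0 0) (taub) ('D_(z.2^T) _ _) b0 => b t Q b0.
have vE (x : 'rV[R]_1) (y : 'rV[R]_n) (w : 'M[R]_(n, 1)) :
    b *: ((x, y, 0) : V) + (0, 0, w) = (b *: x, b *: y, w).
  by congr (_, _, _); rewrite /= ?scaler0 ?addr0 ?add0r.
rewrite vE; congr (_, _, _).
  by rewrite linearZ /= scalerA divff // scale1r trmx_mul trmxK.
rewrite mulmx0 addr0 -!scalar_mxM !tr_scalar_mx !mul_mx_scalar.
congr (_ - _ *: _); by rewrite expr2 invfM mulrAC.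
Qed.

Lemma derive_momentum_euler :
  'D_((tau, z.2^T, 0) : V) (momentum L c) z =
   beta^-1 *: (Au *m momentum L c' z')
   + A *m 'D_((tau, z'.2^T, 0) : V) (momentum L c') z'
   + (2%:R * hinv c' z' * beta ^- 2) *: (A *m g c' z' *m Au^T *m z.2)
   - (2%:R * hinv c' z' * beta ^- 3 * taub) *: (A *m g c' z' *m A^T *m z.2)
   - (beta ^- 2 * taub) *: (A *m momentum L c' z').
Proof.
pose v : V := (tau, z.2^T, 0).
have dP' := momentum_diff zd'.
have [dA DA] := derive_base v (@xproj_linear R 1 n) (@xproj_continuous R 1 n)
  (cjac_differentiable zx).
have [dBi DBi] := derive_cjac_back zc v.
have [dP DP] := derive_comp_jtrans zc v dP'.
have [d1 D1] := derive_mulmx v dA dP.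
have [_ D2] := derive_mulmx v d1 dBi.
have -> : 'D_v (momentum L c) z = 'D_v (fun y : V => cjac c.2 c'.2 y.1.2
    *m momentum L c' (jtrans c c' y) *m cjac c'.1 c.1 (ctrans c.1 c'.1 y.1.1)) z.
  apply: (open_derive_eq _ (@joverlap_open R 1 n T M c c') _ zc) => y.
  rewrite inE => yc; rewrite (momentum_transform hL yc).
  by case: yc => yT _; rewrite (cjac_inv yT).
rewrite D2 D1 DA DP DBi (cjac_inv zt) -/(jacT c c' z) invmx_jacT.
have tM : djacT c c' z v = taub%:M by exact: mx11_scalar.
rewrite tM -/(jacM c c' z) djtrans_euler.
rewrite (derive_dirD _ _ dP') (derive_dirZ _ _ dP') (momentum_vertical _ zd').
have -> : v.1.2 = z.2^T by [].
have b0 := beta_neq0.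
move: (jacT c c' z 0 0) (taub) ('D_(z.2^T) _ _) b0 => b t Q b0.
move: ('D__ _ _) (momentum _ _ _) (jacM _ _ _) (g _ _) (hinv _ _) => D P' A0 g' k.
rewrite -!scalar_mxM mulmxN !mul_mx_scalar !mulmxDr !mulmxN -!scalemxAr !mulmxDr !mulmxN -!scalemxAr !mulmxA.
move: (Q *m P') (A0 *m D) (A0 *m g' *m Q^T *m z.2) (A0 *m g' *m A0^T *m z.2) (A0 *m P').
move=> e1 e2 e3 e4 e5.
by apply/matrixP => i j; rewrite !mxE; field.
Qed.

Lemma xgrad_transform :
  xgrad c z = A *m xgrad c' z' + beta^-1 *: (Au *m momentum L c' z').
Proof.
have dL := smooth_differentiable (lagrange_smooth hL (c := c')) zd'.
apply/matrixP => k e; rewrite (ord1 e) [LHS]mxE /dx (derive_L_transform hL _ zc).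
have -> : djtrans c c' z (ex k) = \sum_l ((delta_mx 0 k : 'rV[R]_n) *m A) 0 l *: ex l
   + \sum_l \sum_f (beta^-1 *: (('D_(delta_mx 0 k : 'rV[R]_n) (cjac c.2 c'.2) z.1.2)^T *m z.2)) l f *: eu l f :> V.
  rewrite -ex_sum -vertical_frame [LHS]djtrans_spatial invmx_jacT tr_scalar_mx.
  by rewrite mul_mx_scalar; congr (_, _, _); rewrite /= ?addr0 ?add0r.
rewrite (derive_dirD _ _ dL) !(derive_dir_sum _ _ _ dL).
rewrite [RHS]mxE [X in _ = X + _]mxE [X in _ = _ + X]mxE; congr (_ + _).
  apply: eq_bigr => l _; rewrite (derive_dirZ _ _ dL) -rowE [row k _ 0 l]mxE.
  by congr (_ * _); rewrite mxE.
have sym := derive_cjac_sym z.2^T (delta_mx 0 k) zx.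
have -> : (Au *m momentum L c' z') k 0 =
    (z.2^T *m 'D_(delta_mx 0 k) (cjac c.2 c'.2) z.1.2 *m momentum L c' z') 0 0.
  by rewrite -sym -mulmxA -rowE [RHS]mxE.
move: ('D_(delta_mx 0 k) _ _) => Q.
rewrite [X in _ = _ * X]mxE mulr_sumr; apply: eq_bigr => l _.
rewrite big_ord1 (derive_dirZ _ _ dL).
have -> : momentum L c' z' l 0 = 'D_(eu l 0) (L c') z' by rewrite mxE.
rewrite mulrA; congr (_ * _).
rewrite [LHS]mxE; congr (_ * _).
by rewrite -[Q^T *m z.2]trmxK trmx_mul trmxK [LHS]mxE.
Qed.

Lemma z2_transform : z'.2 = beta^-1 *: (A^T *m z.2).
Proof.
by rewrite /= (cjac_inv zt) -/(jacT c c' z) invmx_jacT tr_scalar_mx mul_mx_scalar.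
Qed.

(** The whole Euler-Lagrange expression is a covector.  The Hessian by which the
    covariant acceleration transforms reappears here with the opposite sign. *)
Lemma euler_transform :
  euler c z = A *m euler c' z' + (2%:R * hinv c z) *: (A *m g c' z' *m Au^T *m z.2).
Proof.
have b0 := beta_neq0.
have HE : Hcoef c z = (taub + beta ^+ 2 * Hcoef c' z') / beta.
  by rewrite -Hcoef_transform mulfK.
have gz : g c z *m z.2 = A *m g c' z' *m A^T *m z.2.
  by rewrite (g_transform (lagrange_dtensor hL) zc).
have Pz : momentum L c z = beta^-1 *: (A *m momentum L c' z').
  by rewrite (momentum_transform hL zc) invmx_jacT mul_mx_scalar.
rewrite /euler derive_momentum_euler xgrad_transform HE hinv_transform gz Pz.
move: ('D_(tau, z'.2^T, 0) (momentum L c') z') => D.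
rewrite z2_transform.
move: (jacT c c' z 0 0) (taub) ('D_(z.2^T) _ _) b0 => b t Q b0.
move: (momentum _ _ _) (jacM _ _ _) (g _ _) (hinv _ _) => P' A0 g' k.
move: (Hcoef _ _) (xgrad _ _) => H' X'.
rewrite !mulmxDr mulmxN -!scalemxAr !mulmxA.
move: (Q *m P') (A0 *m D) (A0 *m g' *m Q^T *m z.2) (A0 *m g' *m A0^T *m z.2) (A0 *m P') (A0 *m X').
move=> e1 e2 e3 e4 e5 e6.
by apply/matrixP => i j; rewrite !mxE; field.
Qed.

(** Raising the index with [g] in [euler_transform]. *)
Lemma sprayv_transform :
  A^T *m sprayv c z = (2%:R^-1 * hinv c z) *: (Au^T *m z.2) + sprayv c' z'.
Proof.
have ug' := lagrange_g_unit hL zd'.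
rewrite /sprayv euler_transform (g_transform (lagrange_dtensor hL) zc) mulmxDr -!scalemxAr.
move: (euler _ _) (hinv c z) ('D_(z.2^T) _ _) => E k Q.
have inv (w : 'M[R]_(n, 1)) : A^T *m (invmx (A *m g c' z' *m A^T) *m (A *m w)) =
    invmx (g c' z') *m w.
  have uS : A *m g c' z' *m A^T \in unitmx by rewrite !unitmx_mul uA ug' unitmx_tr uA.
  have -> : A *m w = A *m g c' z' *m A^T *m (invmx A^T *m (invmx (g c' z') *m w)).
    by rewrite !mulmxA mulmxK ?unitmx_tr // mulmxK.
  by rewrite mulKmx // mulKVmx ?unitmx_tr.
have -> : A *m g c' z' *m Q^T *m z.2 = A *m (g c' z' *m (Q^T *m z.2)) by rewrite !mulmxA.
rewrite mulmxDr -scalemxAr inv inv mulKmx // scalerDr scalerA addrC.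
by congr (_ *: _ + _); field.
Qed.

End Overlap.

Section Spray.
Variables (c c' : jchart T M) (z : V).
Hypothesis zc : joverlap c c' z.
Local Notation A := (jacM c c' z).
Local Notation z' := (jtrans c c' z).
Local Notation beta := (jacT c c' z 0 0).
Local Notation taub := (('D_tau (cjac c.1 c'.1) z.1.1) 0 0).
Local Notation Au := ('D_(z.2^T) (cjac c.2 c'.2) z.1.2).

Let zd : jdom c z. Proof. exact: joverlap_sub zc. Qed.
Let zd' : jdom c' z'. Proof. exact: jtrans_dom. Qed.
Let uA : A \in unitmx. Proof. exact: jacM_unit. Qed.
Let zt : coverlap c.1 c'.1 z.1.1. Proof. by case: zc. Qed.
Let zx : coverlap c.2 c'.2 z.1.2. Proof. by case: zc. Qed.

(** [sprayv_transform] holds along the whole fibre, and its inhomogeneous part is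
    quadratic there.  By symmetry of second derivatives the two terms of its
    derivative agree, which compensates the factor [1/2]. *)
Lemma derive_sprayv_transform b :
  A^T *m 'D_((0, 0, b^T) : V) (sprayv c) z =
  hinv c z *: (('D_b (cjac c.2 c'.2) z.1.2)^T *m z.2)
  + beta^-1 *: 'D_((0, 0, (b *m A)^T) : V) (sprayv c') z'.
Proof.
pose v : V := (0, 0, b^T).
have dS := smooth_differentiable (sprayv_smooth (c := c)) zd.
have dS' := smooth_differentiable (sprayv_smooth (c := c')) zd'.
have dC := cjac_differentiable zx.
have [d1 D1] := derive_mulmx v (differentiable_cst A^T z) dS.
have [d2 D2] := derive_comp_jtrans zc v dS'.
have D3 : 'D_v (fun y => A^T *m sprayv c y - sprayv c' (jtrans c c' y)) z =
    A^T *m 'D_v (sprayv c) z - beta^-1 *: 'D_((0, 0, (b *m A)^T) : V) (sprayv c') z'.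
  rewrite deriveB; [|exact: diff_derivable|exact: diff_derivable].
  rewrite D1 D2 derive_cst mul0mx add0r; congr (_ - _).
  rewrite [djtrans _ _ _ _]djtrans_vertical invmx_jacT tr_scalar_mx mul_mx_scalar -trmx_mul.
  rewrite -(derive_dirZ _ _ dS'); congr ('D_ _ _ _).
  by congr (_, _, _); rewrite /= scaler0.
apply/eqP; rewrite -subr_eq -D3 derive_vertical_line; apply/eqP.
pose Q (u : 'M[R]_(n, 1)) := 'd (cjac c.2 c'.2) (z.1.2) u^T.
have QE u : Q u = 'D_(u^T) (cjac c.2 c'.2) z.1.2 by rewrite deriveE.
have -> : (fun u => A^T *m sprayv c (z.1, u) - sprayv c' (jtrans c c' (z.1, u))) =
    (fun u => (2%:R^-1 * hinv c z) *: ((Q u)^T *m u)).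
  apply/funext => u; have uc : joverlap c c' (z.1, u) by [].
  by rewrite (sprayv_transform uc) QE addrK.
have cQ : continuous Q.
  move=> u; apply: continuous_comp; last exact: (diff_continuous dC).
    apply: differentiable_continuous; apply: differentiable_trmx.
  by case: (linear_derive (l := @id 'M[R]_(n, 1)) (fun _ _ _ => erefl) (fun x => cvg_id) u 0).
have lQ : linear Q by move=> k x y; rewrite /Q !linearP.
have [dQ DQ] := linear_derive lQ cQ z.2 b^T.
have [di Di] := linear_derive (l := @id 'M[R]_(n, 1)) (fun _ _ _ => erefl) (fun x => cvg_id) z.2 b^T.
have [dq Dq] := derive_mulmx b^T (differentiable_trmx dQ) di.
rewrite deriveZ; last exact: diff_derivable.
rewrite Dq Di (derive_trmx _ dQ) DQ !QE trmxK.
have := derive_cjac_sym z.2^T b zx.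
move: ('D_b (cjac c.2 c'.2) z.1.2) (Au) => P P' /(congr1 trmx).
rewrite !trmx_mul trmxK => ->.
rewrite scalerDr -scalerDl.
by congr (_ *: _); field.
Qed.

(** [N] is [h_11] times the derivative of the spray along the fibre. *)
Lemma Ncoef_transform_single_time b :
  A^T *m nl_term Gam c z 0 b *m (invmx (jacT c c' z))^T =
  ('D_b (cjac c.2 c'.2) z.1.2)^T *m z.2 *m (invmx (jacT c c' z))^T
  + nl_term Gam c' z' 0 (b *m A).
Proof.
have b0 := beta_neq0 zc.
have h0 : h c.1 z.1.1 0 0 != 0.
  case: (zd) => at_ _; have := h_unit hh at_; rewrite [X in X \in _ -> _]mx11_scalar.
  by rewrite unitmxE det_scalar1 unitfE.
have hE : h c'.1 z'.1.1 0 0 = beta ^- 2 * h c.1 z.1.1 0 0.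
  by rewrite (h_transform zc) mulKf // expf_neq0.
rewrite !canonical_N_single_time // invmx_jacT tr_scalar_mx !mul_mx_scalar -scalemxAr.
rewrite derive_sprayv_transform hinvE // hE !scalerDr !scalerA; congr (_ *: _ + _ *: _).
  by rewrite mulfK.
by rewrite mulrAC expr2 invfM.
Qed.

End Spray.
End SingleTime.

(** * Existence and uniqueness *)

Lemma canonical_transform (R : realType) (p n : nat)
    (T : smooth_manifold R p) (M : smooth_manifold R n)
    (h : metric_family T) (L : function_family T M) (g : dtensor_family T M)
    (c c' : jchart T M) (z v : jcoord R p n) :
  (0 < p)%N -> semi_riemannian h -> metrical_lagrange_space h L g ->
  joverlap c c' z ->
  ver (canonical_nonlinear h L g) c' (jtrans c c' z) (djtrans c c' z v) =
  (jacM c c' z)^T *m ver (canonical_nonlinear h L g) c z v *m (invmx (jacT c c' z))^T.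
Proof.
move=> p_gt0 hh hL zc; apply: canonical_transform_reduction => // b.
have [p1|p1] := eqVneq p 1%N; last first.
  by apply: Ncoef_transform_multi_time => //; rewrite ltn_neqAle eq_sym p1.
by subst p; apply: Ncoef_transform_single_time.
Qed.

Theorem theorem4p3 (R : realType) (p n : nat) (hp : (0 < p)%N) (hn : (0 < n)%N)
  (T : smooth_manifold R p) (M : smooth_manifold R n)
  (h : metric_family T) (L : function_family T M) (g : dtensor_family T M)
  (hh : semi_riemannian h) (hL : metrical_lagrange_space h L g) :
  exists nabla : connection_family T M,
    (h_normal (canonical_nonlinear h L g) h nabla /\
     metrical_properties (canonical_nonlinear h L g) g nabla) /\
    forall nabla' : connection_family T M,
      h_normal (canonical_nonlinear h L g) h nabla' ->
      metrical_properties (canonical_nonlinear h L g) g nabla' ->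
      same_connection nabla nabla'.
Proof.
have hg := lagrange_dtensor hL.
have gs := lagrange_g_sym hL; have gu := lagrange_g_unit hL.
have Ms c e : smooth_on (jdom c) (fun z => Mmx (canonical_nonlinear h L g) c z e).
  exact: canonical_Msmooth.
have Ns c j : smooth_on (jdom c) (fun z => Nmx (canonical_nonlinear h L g) c z j).
  exact: canonical_Nsmooth.
exists (cartan h g (canonical_nonlinear h L g)); split; last first.
  by move=> nabla' nh nm; apply: cartan_unique.
split; last exact: cartan_metrical.
split.
- split; last by move=> c U X Y _ _ _ z _; apply: cartan_Gamma.
  split; first by move=> c U X Y; apply: cartan_linear.
  move=> c c' U X Y X' Y'; apply: cartan_transform => // d d' z v.
  exact: canonical_transform.
- by move=> c z zc a b e; case: (cartan_h_normal_local g (canonical_nonlinear h L g) hh zc).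
- by move=> c z zc a b e; case: (cartan_h_normal_local g (canonical_nonlinear h L g) hh zc).
- by move=> c z zc a b j e; case: (cartan_h_normal_local g (canonical_nonlinear h L g) hh zc).
by move=> c U X Y Z Uc sX sY _ z Uz; apply: cartan_J Uc sX sY _ Uz.
Qed.
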